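(* Let $D\in\mathbb{R}^{m\times n}$, $\Omega\subseteq\{1,\dots,m\}\times\{1,\dots,n\}$, $\lambda>0$ and a positive integer $d$ be given, and let $\{(U_k,V_k)\}_{k\ge0}$, with $U_k\in\mathbb{R}^{m\times d}$ and $V_k\in\mathbb{R}^{n\times d}$, be a sequence generated by the proximal alternating linearized minimization (PALM) iteration described in the context. Then $\{(U_k,V_k)\}$ is a Cauchy sequence and converges to a critical point of $$\min_{U\in\mathbb{R}^{m\times d},\,V\in\mathbb{R}^{n\times d}}\ \frac{\lambda\left(2\|U\|_*+\|V\|_F^2\right)}{3}+\frac12\left\|\mathcal{P}_\Omega(UV^T)-\mathcal{P}_\Omega(D)\right\|_F^2 .$$
   Context: $\|\cdot\|_*$ is the nuclear norm (sum of singular values), $\|\cdot\|_F$ the Frobenius norm, $\|\cdot\|_2$ the spectral norm. $\mathcal{P}_\Omega$ is the linear projection with $\mathcal{P}_\Omega(D)_{ij}=D_{ij}$ if $(i,j)\in\Omega$ and $0$ otherwise. PALM iteration (Algorithm 1, regarded as generating an infinite sequence, i.e. without its stopping test). Start from an initial pair $(U_0,V_0)$. For $k=0,1,2,\dots$: 1. Put $g_k(U)=\frac12\|\mathcal{P}_\Omega(UV_k^T)-\mathcal{P}_\Omega(D)\|_F^2$, $l^g_{k+1}=\|V_k\|_2^2$, and $$U_{k+1}=\arg\min_{U}\ \frac{2\lambda}{3}\|U\|_*+g_k(U_k)+\langle\nabla g_k(U_k),U-U_k\rangle+\frac{l^g_{k+1}}{2}\|U-U_k\|_F^2 .$$ 2.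 Put $h_k(V)=\frac12\|\mathcal{P}_\Omega(U_{k+1}V^T)-\mathcal{P}_\Omega(D)\|_F^2$, $l^h_{k+1}=\|U_{k+1}\|_2^2$, and $$V_{k+1}=\arg\min_{V}\ \frac{\lambda}{3}\|V\|_F^2+h_k(V_k)+\langle\nabla h_k(V_k),V-V_k\rangle+\frac{l^h_{k+1}}{2}\|V-V_k\|_F^2 .$$ Critical points. For a proper lower semi-continuous $f:\mathbb{R}^N\to(-\infty,+\infty]$ with $\mathrm{dom} f=\{x:f(x)<+\infty\}$, the Fréchet sub-differential at $x\in\mathrm{dom} f$ is $$\widehat\partial f(x)=\left\{u\in\mathbb{R}^N:\ \liminf_{y\to x,\,y\ne x}\frac{f(y)-f(x)-\langle u,y-x\rangle}{\|y-x\|_2}\ge0\right\},$$ and $\widehat\partial f(x)=\emptyset$ if $x\notin\mathrm{dom} f$. The limiting sub-differential $\partial f(x)$ is the set of $u$ for which there exist $x^k\to x$ with $f(x^k)\to f(x)$ and $u^k\in\widehat\partial f(x^k)$ with $u^k\to u$. A point $x$ is a critical point of $f$ if $0\in\partial f(x)$. A critical point of the minimization problem means a critical point of its objective as a function of $(U,V)$. *)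

(* Defs.v *)
From mathcomp Require Export all_boot all_order all_algebra.
From mathcomp Require Export polyrcf.
From mathcomp Require Export all_classical all_reals all_analysis.
Set Implicit Arguments.
Unset Strict Implicit.
Unset Printing Implicit Defensive.
Import Order.TTheory GRing.Theory Num.Theory.
Import numFieldNormedType.Exports.
Local Open Scope classical_set_scope.
Local Open Scope ring_scope.

Definition mxdot (R : realType) (p q : nat) (A B : 'M[R]_(p, q)) : R :=
  \tr (A^T *m B).

(* Needed because the norm `|A| of the library is the sup norm of the entries;
   both norms induce the same topology and uniform structure. *)
Definition frob_norm (R : realType) (p q : nat) (A : 'M[R]_(p, q)) : R :=
  Num.sqrt (mxdot A A).

(* Square roots of the eigenvalues of A^T A, repeated according to algebraic
   multiplicity. This sequence has length q, so when p < q it contains extra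
   zeros, which affect neither the sum nor the maximum. *)
Definition singular_values (R : realType) (p q : nat) (A : 'M[R]_(p, q)) :
    seq R :=
  let chi := char_poly (A^T *m A) in
  flatten [seq nseq (mup x chi) (Num.sqrt x) | x <- rootsR chi].

Definition nuclear_norm (R : realType) (p q : nat) (A : 'M[R]_(p, q)) : R :=
  \sum_(s <- singular_values A) s.

Definition spectral_norm (R : realType) (p q : nat) (A : 'M[R]_(p, q)) : R :=
  \big[Num.max/0]_(s <- singular_values A) s.

Definition proj_mask (R : realType) (m n : nat) (Omega : {set 'I_m * 'I_n})
    (D : 'M[R]_(m, n)) : 'M[R]_(m, n) :=
  \matrix_(i, j) (if (i, j) \in Omega then D i j else 0).

Definition mxgrad (R : realType) (p q : nat) (f : 'M[R]_(p, q) -> R)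
    (A : 'M[R]_(p, q)) : 'M[R]_(p, q) :=
  \matrix_(i, j) 'D_(delta_mx i j) f A.

Definition is_argmin (R : realType) (T : Type) (F : T -> R) (x : T) : Prop :=
  forall y : T, F x <= F y.

Definition fit (R : realType) (m n d : nat) (D : 'M[R]_(m, n))
    (Omega : {set 'I_m * 'I_n}) (U : 'M[R]_(m, d)) (V : 'M[R]_(n, d)) : R :=
  2^-1 * frob_norm (proj_mask Omega (U *m V^T) - proj_mask Omega D) ^+ 2.

Definition palm_U_model (R : realType) (m n d : nat) (D : 'M[R]_(m, n))
    (Omega : {set 'I_m * 'I_n}) (lambda : R) (Uk : 'M[R]_(m, d))
    (Vk : 'M[R]_(n, d)) (U : 'M[R]_(m, d)) : R :=
  let g := fun W : 'M[R]_(m, d) => fit D Omega W Vk in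
  2 * lambda / 3 * nuclear_norm U + g Uk + mxdot (mxgrad g Uk) (U - Uk)
  + spectral_norm Vk ^+ 2 / 2 * frob_norm (U - Uk) ^+ 2.

Definition palm_V_model (R : realType) (m n d : nat) (D : 'M[R]_(m, n))
    (Omega : {set 'I_m * 'I_n}) (lambda : R) (Uk1 : 'M[R]_(m, d))
    (Vk : 'M[R]_(n, d)) (V : 'M[R]_(n, d)) : R :=
  let h := fun W : 'M[R]_(n, d) => fit D Omega Uk1 W in
  lambda / 3 * frob_norm V ^+ 2 + h Vk + mxdot (mxgrad h Vk) (V - Vk)
  + spectral_norm Uk1 ^+ 2 / 2 * frob_norm (V - Vk) ^+ 2.

Definition palm_sequence (R : realType) (m n d : nat) (D : 'M[R]_(m, n))
    (Omega : {set 'I_m * 'I_n}) (lambda : R) (U : nat -> 'M[R]_(m, d))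
    (V : nat -> 'M[R]_(n, d)) : Prop :=
  forall k : nat,
    is_argmin (palm_U_model D Omega lambda (U k) (V k)) (U k.+1) /\
    is_argmin (palm_V_model D Omega lambda (U k.+1) (V k)) (V k.+1).

Definition objective (R : realType) (m n d : nat) (D : 'M[R]_(m, n))
    (Omega : {set 'I_m * 'I_n}) (lambda : R)
    (X : 'M[R]_(m, d) * 'M[R]_(n, d)) : R :=
  lambda * (2 * nuclear_norm X.1 + frob_norm X.2 ^+ 2) / 3
  + fit D Omega X.1 X.2.

(* The space of pairs (U, V) plays the role of R^N, N = m d + n d, with the
   Euclidean structure of the stacked entries. *)
Definition pairdot (R : realType) (m n d : nat)
    (X Y : 'M[R]_(m, d) * 'M[R]_(n, d)) : R :=
  mxdot X.1 Y.1 + mxdot X.2 Y.2.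

Definition pairnorm (R : realType) (m n d : nat)
    (X : 'M[R]_(m, d) * 'M[R]_(n, d)) : R :=
  Num.sqrt (pairdot X X).

(* The subdifferentials are meant for f with values in ]-oo, +oo]. *)
Definition frechet_subdiff (R : realType) (m n d : nat)
    (f : 'M[R]_(m, d) * 'M[R]_(n, d) -> \bar R)
    (x : 'M[R]_(m, d) * 'M[R]_(n, d)) :
    set ('M[R]_(m, d) * 'M[R]_(n, d)) :=
  [set u | (f x < +oo)%E /\
    (0 <= limf_einf
       (fun y => (f y - f x - (pairdot u (y - x))%:E)
                 * ((pairnorm (y - x))^-1)%:E) x^')%E].

Definition limiting_subdiff (R : realType) (m n d : nat)
    (f : 'M[R]_(m, d) * 'M[R]_(n, d) -> \bar R)
    (x : 'M[R]_(m, d) * 'M[R]_(n, d)) :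
    set ('M[R]_(m, d) * 'M[R]_(n, d)) :=
  [set u | exists xs us : nat -> 'M[R]_(m, d) * 'M[R]_(n, d),
    [/\ xs @ \oo --> x,
        f (xs k) @[k --> \oo] --> f x,
        forall k, frechet_subdiff f (xs k) (us k) &
        us @ \oo --> u]].

Definition critical_point (R : realType) (m n d : nat)
    (f : 'M[R]_(m, d) * 'M[R]_(n, d) -> \bar R)
    (x : 'M[R]_(m, d) * 'M[R]_(n, d)) : Prop :=
  limiting_subdiff f x 0.

(* Main.v *)
(* The iteration decreases the objective [F] by at least [a delta_k^2], where
   [delta_k] is the length of the [k]-th step, and the slope of [F] at the
   [k+1]-st iterate is at most [c delta_k].  (If [||V_k||_2] is not bounded below,
   the proximal threshold eventually kills [U_(k+1)], and the iteration stops at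
   [(0, 0)].)  The nuclear norm is the maximum of [<W, U>] over the contractions
   [W], so [F], its values and its subgradients are described by polynomial
   conditions with quantifiers, which can be eliminated.

   Instead of a desingularizing function, the Kurdyka-Lojasiewicz argument uses a
   curve directly.  For small [t > 0] let [z(t)] minimize the slope among the points
   of a fixed ball with [F = F* + t], ties being broken lexicographically.  The
   coordinates of [z] are semialgebraic functions of one variable, hence monotone
   near 0, so [z] has finite length.  With [s_k = F_(k+1) - F*], weak convexity gives
   [a delta_(k+1)^2 <= s_k - s_(k+1) <= 2 c delta_k l_k + C l_k^2], where [l_k] is
   the variation of [z] between [s_(k+1)] and [s_k]; so [sum l_k < oo] implies
   [sum delta_k < oo].  No regularity of [z] beyond monotonicity is needed. *)

Require Import Defs.
From mathcomp Require ordered_qelim qe_rcf.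
From mathcomp Require Import complex ring lra.
Import Order.TTheory GRing.Theory Num.Theory.
Import numFieldNormedType.Exports.
Local Open Scope classical_set_scope.
Local Open Scope ring_scope.
Set Implicit Arguments.
Unset Strict Implicit.
Unset Printing Implicit Defensive.

(** * Semialgebraic sets *)

(** A desingularizing function would require regularity of semialgebraic functions at 0, such as a
    Puiseux expansion. Here the semialgebraic input is reduced to quantifier elimination and to the
    fact that a semialgebraic predicate of one variable has a constant truth value just to the right
    of any point.

    The curve suffices because the iterate of value [F* + s_k] competes in the minimization that
    defines [z(s_k)]: the slope at [z(s_k)] is at most [c delta_k], however far [z(s_k)] is from the
    iterate. Weak convexity is applied only between [z(s_k)] and [z(s_(k+1))], whose values are
    those of the iterates.

    To keep the slope polynomial, a subgradient [W] of the nuclear norm becomes a third block of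
    coordinates, and the minimization runs over triples [(U, V, W)]; [W] is a contraction, so this
    block stays bounded along the iteration. The values are shifted by one index because a
    subgradient is known only at the output of a step. *)

(* A context is a type [T] with finitely many coordinate functions [vs]. A bound
   variable extends it to [T * R] ([ext1]) or [T * 'rV_N] ([ext]), so that formulas
   need no variable names. *)
Inductive polyf (R : realType) (T : Type) (vs : seq (T -> R)) : (T -> R) -> Prop :=
| polyf_cst c : polyf vs (fun=> c)
| polyf_var i : (i < size vs)%N -> polyf vs (nth (fun=> 0) vs i)
| polyf_add f g : polyf vs f -> polyf vs g -> polyf vs (fun t => f t + g t)
| polyf_mul f g : polyf vs f -> polyf vs g -> polyf vs (fun t => f t * g t).

(** Quantifier-free sets only: closure under quantifiers is a theorem, [semialg_ex]. The single kind
    of atom is enough, equalities and strict inequalities being Boolean combinations of large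
    ones. *)
Inductive semialg (R : realType) (T : Type) (vs : seq (T -> R)) : (T -> Prop) -> Prop :=
| semialg_ge0 f : polyf vs f -> semialg vs (fun t => 0 <= f t)
| semialg_not P : semialg vs P -> semialg vs (fun t => ~ P t)
| semialg_and P Q : semialg vs P -> semialg vs Q ->
    semialg vs (fun t => P t /\ Q t).

Definition ext1 (R : realType) (T : Type) (vs : seq (T -> R)) :
    seq (T * R -> R) :=
  rcons [seq (fun p : T * R => v p.1) | v <- vs] (fun p : T * R => p.2).

Definition ext (R : realType) (T : Type) (vs : seq (T -> R)) (N : nat) :
    seq (T * 'rV[R]_N -> R) :=
  [seq (fun p : T * 'rV[R]_N => v p.1) | v <- vs]
  ++ [seq (fun p : T * 'rV[R]_N => p.2 0 j) | j <- enum 'I_N].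

Notation coords R N :=
  [seq (fun x : 'rV[R]_N => x 0 j) | j <- enum 'I_N].

Section Polyf.
Variables (R : realType).
Implicit Type T : Type.

Lemma polyf_comp T T' (vs : seq (T -> R)) (vs' : seq (T' -> R)) (phi : T' -> T) f :
  (forall i, (i < size vs)%N -> polyf vs' (nth (fun=> 0) vs i \o phi)) ->
  polyf vs f -> polyf vs' (fun t => f (phi t)).
Proof.
move=> H; elim=> [c|i /H //|f1 g1 _ IHf _ IHg|f1 g1 _ IHf _ IHg].
- exact: polyf_cst.
- exact: polyf_add.
- exact: polyf_mul.
Qed.

Lemma polyf_opp T (vs : seq (T -> R)) f : polyf vs f -> polyf vs (fun t => - f t).
Proof.
move=> hf; have -> : (fun t => - f t) = (fun t => (-1) * f t).
  by apply/funext => t; rewrite mulN1r.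
exact: polyf_mul (polyf_cst _ _) hf.
Qed.

Lemma polyf_sub T (vs : seq (T -> R)) f g : polyf vs f -> polyf vs g ->
  polyf vs (fun t => f t - g t).
Proof. by move=> hf hg; apply: polyf_add => //; exact: polyf_opp. Qed.

Lemma polyf_sum T (vs : seq (T -> R)) (I : Type) (r : seq I) (f : I -> T -> R) :
  (forall i, polyf vs (f i)) -> polyf vs (fun t => \sum_(i <- r) f i t).
Proof.
move=> H; elim: r => [|i r IH].
  rewrite (_ : (fun t => _) = fun=> 0); first exact: polyf_cst.
  by apply/funext => t; rewrite big_nil.
rewrite (_ : (fun t => _) = fun t => f i t + \sum_(j <- r) f j t).
  exact: polyf_add.
by apply/funext => t; rewrite big_cons.
Qed.

Lemma size_ext T (vs : seq (T -> R)) N : size (ext vs N) = (size vs + N)%N.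
Proof. by rewrite size_cat 2!size_map size_enum_ord. Qed.

Lemma polyf_ext_fst T (vs : seq (T -> R)) N f : polyf vs f ->
  polyf (ext vs N) (fun p => f p.1).
Proof.
apply: polyf_comp => i iv.
rewrite (_ : _ \o _ = nth (fun=> 0) (ext vs N) i).
  by apply: polyf_var; rewrite size_ext ltn_addr.
by rewrite /ext nth_cat size_map iv (nth_map (fun=> 0)).
Qed.

Lemma polyf_ext_snd T (vs : seq (T -> R)) N (j : 'I_N) :
  polyf (ext vs N) (fun p => p.2 0 j).
Proof.
rewrite (_ : (fun p => _) = nth (fun=> 0) (ext vs N) (size vs + j)%N).
  by apply: polyf_var; rewrite size_ext ltn_add2l.
rewrite /ext nth_cat size_map ltnNge leq_addr /= addKn.
by rewrite (nth_map j) ?size_enum_ord // nth_ord_enum.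
Qed.

Lemma polyf_ext1_fst T (vs : seq (T -> R)) f : polyf vs f ->
  polyf (ext1 vs) (fun p => f p.1).
Proof.
apply: polyf_comp => i iv.
rewrite (_ : _ \o _ = nth (fun=> 0) (ext1 vs) i).
  by apply: polyf_var; rewrite size_rcons size_map ltnW.
by rewrite /ext1 nth_rcons size_map iv (nth_map (fun=> 0)).
Qed.

Lemma polyf_ext1_snd T (vs : seq (T -> R)) : polyf (ext1 vs) (fun p => p.2).
Proof.
rewrite (_ : (fun p => _) = nth (fun=> 0) (ext1 vs) (size vs)).
  by apply: polyf_var; rewrite size_rcons size_map.
by rewrite /ext1 nth_rcons size_map ltnn eqxx.
Qed.

Lemma polyf_coord N (j : 'I_N) :
  polyf (coords R N) (fun x => x 0 j).
Proof.
rewrite (_ : (fun x => _) = nth (fun=> 0) (coords R N) j).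
  by apply: polyf_var; rewrite size_map size_enum_ord.
by rewrite (nth_map j) ?size_enum_ord // nth_ord_enum.
Qed.

Lemma polyf_continuous N (f : 'rV[R]_N -> R) :
  polyf (coords R N) f -> continuous f.
Proof.
elim=> [c|i iN|f1 g1 _ cf _ cg|f1 g1 _ cf _ cg] x.
- exact: cst_continuous.
- rewrite size_map size_enum_ord in iN.
  rewrite (nth_map (Ordinal iN)) ?size_enum_ord //.
  exact: coord_continuous.
- exact: (cvgD (cf x) (cg x)).
- exact: (cvgM (cf x) (cg x)).
Qed.

Lemma polyf_ext_last T (vs : seq (T -> R)) N (f : 'rV[R]_N -> R) :
  polyf (coords R N) f -> polyf (ext vs N) (fun q => f q.2).
Proof.
apply: polyf_comp => i; rewrite size_map size_enum_ord => iN.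
by rewrite (nth_map (Ordinal iN)) ?size_enum_ord //; exact: polyf_ext_snd.
Qed.

Lemma polyf_horner (f : R -> R) : polyf [:: id] f -> exists p : {poly R}, f =1 horner p.
Proof.
elim=> [c|i|f1 g1 _ [p pE] _ [q qE]|f1 g1 _ [p pE] _ [q qE]].
- by exists c%:P => x; rewrite hornerC.
- by case: i => // _; exists 'X => x; rewrite hornerX.
- by exists (p + q) => x; rewrite hornerD pE qE.
- by exists (p * q) => x; rewrite hornerM pE qE.
Qed.

Lemma polyf_term T (vs : seq (T -> R)) f : polyf vs f ->
  exists tm : GRing.term R, forall t, GRing.eval [seq v t | v <- vs] tm = f t.
Proof.
elim=> [c|i iv|f1 g1 _ [p pE] _ [q qE]|f1 g1 _ [p pE] _ [q qE]].
- by exists (GRing.Const c).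
- by exists (GRing.Var _ i) => t /=; rewrite (nth_map (fun=> 0)).
- by exists (GRing.Add p q) => t /=; rewrite pE qE.
- by exists (GRing.Mul p q) => t /=; rewrite pE qE.
Qed.

(** [rterm] excludes inverses, and a variable outside the context evaluates to the default 0, which
    is a constant. *)
Lemma term_polyf T (vs : seq (T -> R)) (tm : GRing.term R) : GRing.rterm tm ->
  polyf vs (fun t => GRing.eval [seq v t | v <- vs] tm).
Proof.
elim: tm => [i|c|n|a IHa b IHb|a IHa|a IHa n|a IHa b IHb|a IHa|a IHa n] //=.
- move=> _; have [iv|vi] := ltnP i (size vs).
    rewrite (_ : (fun t => _) = nth (fun=> 0) vs i); first exact: polyf_var.
    by apply/funext => t; rewrite (nth_map (fun=> 0)).
  rewrite (_ : (fun t => _) = fun=> 0); first exact: polyf_cst.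
  by apply/funext => t; rewrite nth_default // size_map.
- by move=> _; exact: polyf_cst.
- by move=> _; exact: polyf_cst.
- by case/andP=> /IHa ? /IHb ?; exact: polyf_add.
- by move/IHa; exact: polyf_opp.
- move=> /IHa ha; rewrite (_ : (fun t => _) =
    fun t => n%:R * GRing.eval [seq v t | v <- vs] a).
    by apply: polyf_mul => //; exact: polyf_cst.
  by apply/funext => t; rewrite mulr_natl.
- by case/andP=> /IHa ? /IHb ?; exact: polyf_mul.
- move=> /IHa ha; elim: n => [|n IHn].
    by under eq_fun do rewrite expr0; exact: polyf_cst.
  by under eq_fun do rewrite exprS; exact: polyf_mul.
Qed.

End Polyf.

(** * Boolean operations and quantifier elimination *)

Section Semialg.
Variables (R : realType).
Implicit Type T : Type.

Lemma semialg_iff T (vs : seq (T -> R)) (P Q : T -> Prop) :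
  (forall t, P t <-> Q t) -> semialg vs P -> semialg vs Q.
Proof. by move=> PQ; rewrite (_ : P = Q) //; apply/funext => t; apply/propext. Qed.

Lemma semialg_le T (vs : seq (T -> R)) f g : polyf vs f -> polyf vs g ->
  semialg vs (fun t => f t <= g t).
Proof.
move=> hf hg; apply: (semialg_iff _ (semialg_ge0 (polyf_sub hg hf))) => t.
by rewrite subr_ge0.
Qed.

Lemma semialg_lt T (vs : seq (T -> R)) f g : polyf vs f -> polyf vs g ->
  semialg vs (fun t => f t < g t).
Proof.
move=> hf hg; apply: (semialg_iff _ (semialg_not (semialg_le hg hf))) => t.
by rewrite ltNge; split => /negP.
Qed.

Lemma semialg_eq T (vs : seq (T -> R)) f g : polyf vs f -> polyf vs g ->
  semialg vs (fun t => f t = g t).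
Proof.
move=> hf hg.
apply: (semialg_iff _ (semialg_and (semialg_le hf hg) (semialg_le hg hf))) => t.
by split=> [[h1 h2]|->//]; apply/eqP; rewrite eq_le h1 h2.
Qed.

Lemma semialg_or T (vs : seq (T -> R)) P Q : semialg vs P -> semialg vs Q ->
  semialg vs (fun t => P t \/ Q t).
Proof.
move=> hP hQ.
apply: (semialg_iff _ (semialg_not (semialg_and (semialg_not hP) (semialg_not hQ)))).
by move=> t; split=> [/not_andP[/contrapT|/contrapT]|[h [h1 h2]|h [h1 h2]]]; tauto.
Qed.

Lemma semialg_imp T (vs : seq (T -> R)) P Q : semialg vs P -> semialg vs Q ->
  semialg vs (fun t => P t -> Q t).
Proof.
move=> hP hQ; apply: (semialg_iff _ (semialg_or (semialg_not hP) hQ)) => t.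
by split=> [[]//|h]; have [/h|] := pselect (P t); tauto.
Qed.

Lemma semialg_bool T (vs : seq (T -> R)) (b : bool) : semialg vs (fun=> b).
Proof.
(* The sign of this constant encodes [b]. *)
have h : semialg vs (fun=> 0 <= (-1) ^+ (~~ b) :> R).
  exact: semialg_ge0 (polyf_cst _ _).
by apply: semialg_iff h => _; case: b => /=; rewrite ?expr0 ?expr1 ?ler01 // ler0N1.
Qed.

Lemma semialg_comp T T' (vs : seq (T -> R)) (vs' : seq (T' -> R)) (phi : T' -> T) P :
  (forall i, (i < size vs)%N -> polyf vs' (nth (fun=> 0) vs i \o phi)) ->
  semialg vs P -> semialg vs' (fun t => P (phi t)).
Proof.
move=> H; elim=> [f hf|Q _ IH|Q1 Q2 _ IH1 _ IH2].
- by apply: semialg_ge0 (polyf_comp H hf).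
- exact: semialg_not.
- exact: semialg_and.
Qed.

Lemma semialg_ext_comp T T' (vs : seq (T -> R)) (vs' : seq (T' -> R)) N
    (phi : T' -> T) (psi : T' -> 'rV[R]_N) P :
  (forall i, (i < size vs)%N -> polyf vs' (nth (fun=> 0) vs i \o phi)) ->
  (forall j, polyf vs' (fun t => psi t 0 j)) ->
  semialg (ext vs N) P -> semialg vs' (fun t => P (phi t, psi t)).
Proof.
move=> H1 H2; apply: (@semialg_comp _ _ _ _ (fun t => (phi t, psi t))) => i.
rewrite size_ext => iv; rewrite /ext.
have [ivs|vsi] := ltnP i (size vs).
  by rewrite nth_cat size_map ivs (nth_map (fun=> 0)) //; exact: H1.
rewrite nth_cat size_map ltnNge vsi /=.
have iN : (i - size vs < N)%N by rewrite ltn_subLR.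
rewrite (nth_map (Ordinal iN)) ?size_enum_ord //.
exact: H2.
Qed.

Lemma semialg_formula T (vs : seq (T -> R)) P : semialg vs P ->
  exists f : ordered_qelim.ord.formula R,
    forall t, P t <-> ordered_qelim.ord.holds [seq v t | v <- vs] f.
Proof.
elim=> [f /polyf_term[tm tmE]|Q _ [f fE]|Q1 Q2 _ [f fE] _ [g gE]].
- by exists (ordered_qelim.ord.Le (GRing.Const 0) tm) => t /=; rewrite tmE.
- by exists (ordered_qelim.ord.Not f) => t /=; rewrite fE.
- by exists (ordered_qelim.ord.And f g) => t /=; rewrite fE gE.
Qed.

Lemma qf_formula_semialg T (vs : seq (T -> R)) (f : ordered_qelim.ord.formula R) :
  ordered_qelim.ord.qf_form f && ordered_qelim.ord.rformula f ->
  semialg vs (fun t => ordered_qelim.ord.qf_eval [seq v t | v <- vs] f).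
Proof.
elim: f => //=.
- by move=> b _; exact: semialg_bool.
- move=> a b /andP[ra rb].
  by apply: semialg_iff (semialg_eq (term_polyf vs ra) (term_polyf vs rb)) => t;
    split=> /eqP.
- by move=> a b /andP[ra rb]; exact: semialg_lt (term_polyf vs ra) (term_polyf vs rb).
- by move=> a b /andP[ra rb]; exact: semialg_le (term_polyf vs ra) (term_polyf vs rb).
- move=> f IHf g IHg; rewrite andbACA => /andP[/IHf hf /IHg hg].
  by apply: semialg_iff (semialg_and hf hg) => t; split=> /andP.
- move=> f IHf g IHg; rewrite andbACA => /andP[/IHf hf /IHg hg].
  by apply: semialg_iff (semialg_or hf hg) => t; split=> /orP.
- move=> f IHf g IHg; rewrite andbACA => /andP[/IHf hf /IHg hg].
  by apply: semialg_iff (semialg_imp hf hg) => t; split=> /implyP.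
- move=> f IHf /IHf hf.
  by apply: semialg_iff (semialg_not hf) => t; split=> /negP.
Qed.

(* Tarski-Seidenberg *)
Lemma formula_semialg T (vs : seq (T -> R)) (f : ordered_qelim.ord.formula R) :
  semialg vs (fun t => ordered_qelim.ord.holds [seq v t | v <- vs] f).
Proof.
have rf := ordered_qelim.ord.to_rform_rformula f.
have := ordered_qelim.ord.quantifier_elim_wf (@qe_rcf.wf_QE_wproj R) rf.
move=> /(qf_formula_semialg vs); apply: semialg_iff => t.
rewrite -ordered_qelim.ord.to_rformP.
have P := ordered_qelim.ord.quantifier_elim_rformP
  (@qe_rcf.wf_QE_wproj R) (@qe_rcf.valid_QE_wproj R) [seq v t | v <- vs] rf.
by split=> /P.
Qed.

(** The bound variables are numbered from the length of the environment on. Setting the entry at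
    that index appends it, so the witnesses form a suffix; this is why [ext] puts the new
    coordinates last. *)
Lemma holds_foldr_exists (f : ordered_qelim.ord.formula R) N (e : seq R) :
  ordered_qelim.ord.holds e
    (foldr (@ordered_qelim.ord.Exists R) f (iota (size e) N)) <->
  exists s : seq R, size s = N /\ ordered_qelim.ord.holds (e ++ s) f.
Proof.
have rconsE (e' : seq R) y : set_nth 0 e' (size e') y = rcons e' y.
  by elim: e' => //= a e' ->.
elim: N e => [|N IH] e /=.
  split=> [h|[s [/size0nil -> ]]]; last by rewrite cats0.
  by exists [::]; rewrite cats0.
split=> [[y]|[[|y s] [//= [sN]]]].
  rewrite rconsE -(size_rcons e y) IH => -[s [sN h]].
  by exists (y :: s); rewrite /= sN -cat_rcons.
by move=> h; exists y; rewrite rconsE -(size_rcons e y) IH; exists s; rewrite cat_rcons.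
Qed.

Lemma semialg_ex T (vs : seq (T -> R)) N (P : T * 'rV[R]_N -> Prop) :
  semialg (ext vs N) P -> semialg vs (fun t => exists x, P (t, x)).
Proof.
move=> /semialg_formula[f fE].
have h := formula_semialg vs
  (foldr (@ordered_qelim.ord.Exists R) f (iota (size vs) N)).
apply: semialg_iff h => t.
rewrite -(size_map (fun v => v t) vs) holds_foldr_exists.
split=> [[s [sN h]]|[x /fE]].
  exists (\row_j s`_j); apply/fE; move: h; congr (ordered_qelim.ord.holds _ _).
  rewrite map_cat -2!map_comp; congr (_ ++ _).
  apply: (@eq_from_nth _ 0); first by rewrite [RHS]size_map size_enum_ord.
  rewrite sN => i iN.
  by rewrite (nth_map (Ordinal iN)) ?size_enum_ord //= mxE nth_enum_ord.
rewrite map_cat -2!map_comp => h; eexists; split; last exact: h.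
by rewrite size_map size_enum_ord.
Qed.

Lemma semialg_all T (vs : seq (T -> R)) N (P : T * 'rV[R]_N -> Prop) :
  semialg (ext vs N) P -> semialg vs (fun t => forall x, P (t, x)).
Proof.
move=> hP; apply: semialg_iff (semialg_not (semialg_ex (semialg_not hP))) => t.
split=> [h x|h [x]]; last by have := h x.
by apply: contrapT => nP; apply: h; exists x.
Qed.

Lemma semialg_ex1 T (vs : seq (T -> R)) (P : T * R -> Prop) :
  semialg (ext1 vs) P -> semialg vs (fun t => exists x, P (t, x)).
Proof.
move=> hP.
have h : semialg (ext vs 1) (fun p => P (p.1, p.2 0 0)).
  apply: (semialg_comp (phi := fun p : T * 'rV_1 => (p.1, p.2 0 0))) hP => i.
  rewrite size_rcons size_map ltnS leq_eqVlt => /predU1P[->|iv].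
    rewrite /ext1 nth_rcons size_map ltnn eqxx; exact: polyf_ext_snd.
  rewrite /ext1 nth_rcons size_map iv (nth_map (fun=> 0)) //.
  by apply: polyf_ext_fst; exact: polyf_var.
apply: semialg_iff (semialg_ex h) => t /=.
by split=> [[x]|[x Px]]; [exists (x 0 0)|exists (const_mx x); rewrite mxE].
Qed.

Lemma semialg_all1 T (vs : seq (T -> R)) (P : T * R -> Prop) :
  semialg (ext1 vs) P -> semialg vs (fun t => forall x, P (t, x)).
Proof.
move=> hP; apply: semialg_iff (semialg_not (semialg_ex1 (semialg_not hP))) => t.
split=> [h x|h [x]]; last by have := h x.
by apply: contrapT => nP; apply: h; exists x.
Qed.

End Semialg.

(** * Monotonicity of semialgebraic functions of one variable *)

(** An explicit radius instead of a filter makes this visibly a first-order formula over the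
    reals. *)
Definition ev_right (R : realType) (t : R) (P : R -> Prop) :=
  exists d, 0 < d /\ forall s, t < s -> s < t + d -> P s.

Definition ev_left (R : realType) (t : R) (P : R -> Prop) :=
  exists d, 0 < d /\ forall s, t - d < s -> s < t -> P s.

Section OneVariable.
Variable R : realType.
Implicit Types (t s : R) (P Q : R -> Prop).

Lemma ev_right_and t P Q : ev_right t P -> ev_right t Q ->
  ev_right t (fun s => P s /\ Q s).
Proof.
move=> [d [d0 hP]] [d' [d'0 hQ]]; exists (Num.min d d').
rewrite lt_min d0; split=> // s ts; rewrite -ltrBlDl lt_min !ltrBlDl => /andP[? ?].
by split; [exact: hP|exact: hQ].
Qed.

Lemma ev_left_and t P Q : ev_left t P -> ev_left t Q ->
  ev_left t (fun s => P s /\ Q s).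
Proof.
move=> [d [d0 hP]] [d' [d'0 hQ]]; exists (Num.min d d').
rewrite lt_min d0; split=> // s; rewrite ltrBlDr -ltrBlDl lt_min !ltrBlDl.
rewrite -!ltrBlDr => /andP[? ?] st.
by split; [exact: hP|exact: hQ].
Qed.

Lemma ev_right_imp t P Q : (forall s, t < s -> P s -> Q s) ->
  ev_right t P -> ev_right t Q.
Proof. by move=> PQ [d [d0 hP]]; exists d; split=> // s ts sd; apply/PQ/hP. Qed.

Lemma ev_left_imp t P Q : (forall s, s < t -> P s -> Q s) ->
  ev_left t P -> ev_left t Q.
Proof. by move=> PQ [d [d0 hP]]; exists d; split=> // s ts sd; apply/PQ/hP. Qed.

Lemma ev_right_ex t P : ev_right t P -> exists2 s, t < s & P s.
Proof.
move=> [d [d0 hP]]; have ts : t < t + d / 2 by rewrite ltrDl divr_gt0.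
by exists (t + d / 2) => //; apply: hP => //; rewrite ltrD2l gtr_pMr// invf_lt1 ?ltr1n.
Qed.

Lemma ev_left_ex t P : ev_left t P -> exists2 s, s < t & P s.
Proof.
move=> [d [d0 hP]]; have ts : t - d / 2 < t by rewrite ltrBlDr ltrDl divr_gt0.
exists (t - d / 2) => //; apply: hP => //.
by rewrite ltrD2l ltrN2 gtr_pMr// invf_lt1 ?ltr1n.
Qed.

Lemma ev_right_lt t b : t < b -> ev_right t (fun s => s < b).
Proof. by move=> tb; exists (b - t); rewrite subr_gt0; split=> // s _; rewrite addrC subrK. Qed.

Lemma ev_left_gt t b : b < t -> ev_left t (fun s => b < s).
Proof.
move=> tb; exists (t - b); rewrite subr_gt0; split=> // s.
by rewrite opprB addrC subrK.
Qed.

(** A nonzero polynomial has constant sign between [t] and its next root, and the dichotomy is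
    inherited by Boolean combinations. *)
Lemma semialg_ev_right_dich t P : semialg [:: id] P ->
  ev_right t P \/ ev_right t (fun s => ~ P s).
Proof.
elim=> [f /polyf_horner[p pE]|Q _ [h|h]|P1 P2 _ [h1|h1] _ [h2|h2]].
- have [p0|p0] := eqVneq p 0.
    by left; exists 1; split=> // s _ _; rewrite pE p0 horner0.
  have tt1 : t < t + 1 by rewrite ltrDl.
  (* The root is searched for up to [t + 1], which serves as the bound when there is none. *)
  have tn := next_root_gt tt1 p0.
  have sE s : t < s -> s < t + (next_root p t (t + 1) - t) ->
      (0 <= f s) = (0 <= sgp_right p t).
    move=> ts sn; rewrite pE -[LHS]sgr_ge0 (@sgr_neighpr _ (t + 1) p t) //.
    by rewrite /neighpr in_itv /= ts; move: sn; rewrite addrC subrK.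
  have [h|h] := boolP (0 <= sgp_right p t); [left|right].
    exists (next_root p t (t + 1) - t); rewrite subr_gt0; split=> // s ts sn.
    by rewrite sE.
  exists (next_root p t (t + 1) - t); rewrite subr_gt0; split=> // s ts sn.
  by rewrite sE //; exact/negP.
- by right; apply: ev_right_imp h => s _ ? /(_ _).
- by left.
- by left; exact: ev_right_and.
- by right; apply: ev_right_imp h2 => s _ ? [].
- by right; apply: ev_right_imp h1 => s _ ? [].
- by right; apply: ev_right_imp h1 => s _ ? [].
Qed.

Lemma semialg_ev_left_dich t P : semialg [:: id] P ->
  ev_left t P \/ ev_left t (fun s => ~ P s).
Proof.
move=> hP.
have hN : semialg [:: id] (fun s => P (- s)).
  apply: semialg_comp hP => -[|//] _.
  exact: polyf_opp (polyf_var (vs := [:: id]) (i := 0) isT).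
have [[d [d0 h]]|[d [d0 h]]] := semialg_ev_right_dich (- t) hN; [left|right];
  exists d; split=> // s; rewrite -ltrN2 opprB addrC => h1 h2;
  by rewrite -[s]opprK; apply: h; rewrite // ltrN2.
Qed.

(** Local behaviour at [t] is itself a semialgebraic condition on [t], so the dichotomy can be
    applied a second time, to [t] near 0. *)
Lemma semialg_ev_right (Q : R * R -> Prop) : semialg [:: fst; snd] Q ->
  semialg [:: id] (fun t => ev_right t (fun s => Q (t, s))).
Proof.
move=> hQ.
have v0 : polyf [:: (@id R)] id by exact: (polyf_var (vs := [:: id]) (i := 0)).
apply: (@semialg_ex1 _ _ _ (fun p : R * R => 0 < p.2 /\
  forall s, p.1 < s -> s < p.1 + p.2 -> Q (p.1, s))).
apply: semialg_and; first by apply: semialg_lt (polyf_cst _ _) (polyf_ext1_snd _).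
apply: (@semialg_all1 _ _ _ (fun p : R * R * R => p.1.1 < p.2 ->
  p.2 < p.1.1 + p.1.2 -> Q (p.1.1, p.2))).
have h1 : polyf (ext1 (ext1 [:: (@id R)])) (fun p : R * R * R => p.1.1).
  exact: (polyf_ext1_fst (polyf_ext1_fst v0)).
have h2 : polyf (ext1 (ext1 [:: (@id R)])) (fun p : R * R * R => p.1.2).
  exact: (polyf_ext1_fst (polyf_ext1_snd _)).
have h3 := polyf_ext1_snd (ext1 [:: (@id R)]).
apply: semialg_imp; first exact: semialg_lt.
apply: semialg_imp; first by apply: semialg_lt => //; exact: polyf_add.
by apply: (semialg_comp (phi := fun p : R * R * R => (p.1.1, p.2))) hQ => -[|[|]].
Qed.

Lemma semialg_ev_left (Q : R * R -> Prop) : semialg [:: fst; snd] Q ->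
  semialg [:: id] (fun t => ev_left t (fun s => Q (t, s))).
Proof.
move=> hQ.
have v0 : polyf [:: (@id R)] id by exact: (polyf_var (vs := [:: id]) (i := 0)).
apply: (@semialg_ex1 _ _ _ (fun p : R * R => 0 < p.2 /\
  forall s, p.1 - p.2 < s -> s < p.1 -> Q (p.1, s))).
apply: semialg_and; first by apply: semialg_lt (polyf_cst _ _) (polyf_ext1_snd _).
apply: (@semialg_all1 _ _ _ (fun p : R * R * R => p.1.1 - p.1.2 < p.2 ->
  p.2 < p.1.1 -> Q (p.1.1, p.2))).
have h1 : polyf (ext1 (ext1 [:: (@id R)])) (fun p : R * R * R => p.1.1).
  exact: (polyf_ext1_fst (polyf_ext1_fst v0)).
have h2 : polyf (ext1 (ext1 [:: (@id R)])) (fun p : R * R * R => p.1.2).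
  exact: (polyf_ext1_fst (polyf_ext1_snd _)).
have h3 := polyf_ext1_snd (ext1 [:: (@id R)]).
apply: semialg_imp; first by apply: semialg_lt => //; exact: polyf_sub.
apply: semialg_imp; first exact: semialg_lt.
by apply: (semialg_comp (phi := fun p : R * R * R => (p.1.1, p.2))) hQ => -[|[|]].
Qed.

(** A function has only countably many strict local minimum points, whereas an open interval is
    uncountable because its Lebesgue measure is positive. *)
Lemma no_strict_local_min (f : R -> R) (a b : R) : a < b ->
  (forall t, a < t -> t < b -> exists d, 0 < d /\
     forall s, t - d < s -> s < t + d -> s != t -> f t < f s) -> False.
Proof.
move=> ab H.
(* Rational endpoints of an isolating interval determine the minimum point. *)
have /choice[q qP] : forall t, exists u : rat * rat, a < t -> t < b ->
    [/\ ratr u.1 < t, t < ratr u.2 &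
     forall s, ratr u.1 < s -> s < ratr u.2 -> s != t -> f t < f s].
  move=> t.
  have [[at_ tb]|nt] := pselect (a < t /\ t < b); last first.
    by exists (0, 0) => ? ?; case: nt.
  have [d [d0 hd]] := H t at_ tb.
  have td : t - d < t by rewrite ltrBlDr ltrDl.
  have td' : t < t + d by rewrite ltrDl.
  have [x] := rat_in_itvoo td; rewrite in_itv /= => /andP[x1 x2].
  have [y] := rat_in_itvoo td'; rewrite in_itv /= => /andP[y1 y2].
  exists (x, y) => _ _; split=> //= s xs sy st; apply: hd => //.
    exact: lt_trans xs.
  exact: lt_trans y2.
have cI : countable `]a, b[%classic.
  apply/countable_injP; exists (fun t => pickle (q t)) => s t.
  rewrite !inE /= !in_itv /= => /andP[as_ sb] /andP[at_ tb] /(pcan_inj pickleK) qE.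
  have [s1 s2 s3] := qP s as_ sb; have [t1 t2 t3] := qP t at_ tb.
  apply: contrapT => /eqP st.
  have := s3 t; rewrite qE eq_sym => /(_ t1 t2 st).
  by apply/negP; rewrite -leNgt ltW // t3 // -qE.
have := countable_lebesgue_measure0 cI.
rewrite lebesgue_measure_itv /= lte_fin ab -EFinD => -[] /eqP.
by rewrite subr_eq0 gt_eqF.
Qed.

(** Let [c] be the supremum of the points up to which [f] stays above [f s]. The left condition
    carries the inequality to [c]; the right condition carries it past [c] unless [c = t]. *)
Lemma locally_nondecreasing (f : R -> R) (a b : R) :
  (forall t, a < t -> t < b -> ev_right t (fun s => f t <= f s)) ->
  (forall t, a < t -> t < b -> ev_left t (fun s => f s <= f t)) ->
  forall s t, a < s -> s <= t -> t < b -> f s <= f t.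
Proof.
move=> HR HL s t as_ st tb.
pose S := [set u | s <= u <= t /\ forall v, s <= v -> v <= u -> f s <= f v].
have Ss : S s.
  split; first by rewrite lexx.
  by move=> v sv vs; have -> : v = s by apply/eqP; rewrite eq_le sv vs.
have ubS : ubound S t by move=> u [/andP[]].
have supS : has_sup S by split; [exists s|exists t].
set c := sup S.
have sc : s <= c by apply: ub_le_sup => //; exists t.
have ct : c <= t by apply: ge_sup => //; exists s.
have below v : s <= v -> v < c -> f s <= f v.
  move=> sv vc; have [u Su vu] := sup_gt (ex_intro _ s Ss) vc.
  by case: Su => _; apply => //; exact: ltW.
have fc : f s <= f c.
  move: sc; rewrite le_eqVlt => /predU1P[->//|sc].
  have cb : c < b := le_lt_trans ct tb.
  have [u uc [us fu]] := ev_left_ex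
    (ev_left_and (ev_left_gt sc) (HL c (lt_trans as_ sc) cb)).
  by apply: le_trans fu; apply: below => //; exact: ltW.
move: ct; rewrite le_eqVlt => /predU1P[<-//|ct].
have [d [d0 hd]] := ev_right_and (ev_right_lt ct)
  (HR c (lt_le_trans as_ sc) (lt_trans ct tb)).
have h2 : 0 < d / 2 by rewrite divr_gt0.
have hdd : d / 2 < d by rewrite gtr_pMr// invf_lt1 ?ltr1n.
suff : S (c + d / 2).
  move=> /(ub_le_sup (ex_intro _ t ubS)); rewrite -/c.
  by rewrite leNgt ltrDl h2.
have [||ut fu] := hd (c + d / 2); rewrite ?ltrDl ?ltrD2l //.
split; first by rewrite (le_trans sc) ?lerDl ?ltW.
move=> v sv vu; have [vc|cv|->//] := ltgtP v c; first exact: below.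
apply: (le_trans fc); have [] // := hd v cv.
by apply: le_lt_trans vu _; rewrite ltrD2l.
Qed.

(* The sign of [f s - f t] for [s] just to the right and just to the left of [t] is
   the same for all small [t > 0]. Local monotonicity propagates, and the
   remaining cases, where every [t] is a strict local extremum, are impossible. *)
Lemma semialg_monotone (f : R -> R) (L : R * R -> Prop) (e : R) : 0 < e ->
  semialg [:: fst; snd] L ->
  (forall t s, 0 < t < e -> 0 < s < e -> L (t, s) <-> f t < f s) ->
  exists e', [/\ 0 < e', e' <= e &
    (forall s t, 0 < s -> s <= t -> t < e' -> f s <= f t) \/
    (forall s t, 0 < s -> s <= t -> t < e' -> f t <= f s)].
Proof.
move=> e0 hL LE.
have hG : semialg [:: fst; snd] (fun p => L (p.2, p.1)).
  apply: (semialg_comp (phi := fun p : R * R => (p.2, p.1))) hL => -[|[|//]] _.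
    exact: (polyf_var (vs := [:: fst; snd]) (i := 1)).
  exact: (polyf_var (vs := [:: fst; snd]) (i := 0)).
have evE (Q1 Q2 : R -> Prop) :
    ev_right 0 Q1 -> ev_right 0 Q2 -> exists e', [/\ 0 < e', e' <= e &
      forall t, 0 < t -> t < e' -> Q1 t /\ Q2 t].
  move=> h1 h2; have [d [d0 hd]] := ev_right_and h1 h2.
  exists (Num.min d e); rewrite lt_min d0 e0 ge_min lexx orbT; split=> // t t0.
  by rewrite lt_min => /andP[td te]; apply: hd; rewrite ?add0r.
have itv e' t : 0 < t -> t < e' -> e' <= e -> 0 < t < e.
  by move=> t0 te' e'e; rewrite t0 (lt_le_trans te').
have itvR t : 0 < t < e -> ev_right t (fun s => 0 < s < e).
  move=> /andP[t0 te]; apply: ev_right_imp (ev_right_lt te) => s ts se.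
  by rewrite se (lt_trans t0).
have itvL t : 0 < t < e -> ev_left t (fun s => 0 < s < e).
  move=> /andP[t0 te]; apply: ev_left_imp (ev_left_gt t0) => s ts se.
  by rewrite se (lt_trans ts).
have v0 : polyf [:: (@id R)] id by exact: (polyf_var (vs := [:: id]) (i := 0)).
have secL t : semialg [:: id] (fun s => L (t, s)).
  by apply: (semialg_comp (phi := fun s => (t, s))) hL => -[|[|//]] _ //;
    exact: (polyf_cst _ t).
have secG t : semialg [:: id] (fun s => L (s, t)).
  by apply: (semialg_comp (phi := fun s => (s, t))) hL => -[|[|//]] _ //;
    exact: (polyf_cst _ t).
(* By the dichotomy, the failure of a strict inequality near [t] means that the opposite large
   inequality holds there. *)
have mono e' : e' <= e ->
    (forall t, 0 < t -> t < e' -> ~ ev_right t (fun s => L (s, t))) ->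
    (forall t, 0 < t -> t < e' -> ~ ev_left t (fun s => L (t, s))) ->
    forall s t, 0 < s -> s <= t -> t < e' -> f s <= f t.
  move=> e'e h1 h2; apply: locally_nondecreasing => t t0 te'.
    have [/(h1 t t0 te')//|h] := semialg_ev_right_dich t (secG t).
    have ht := itv _ _ t0 te' e'e.
    apply: ev_right_imp (ev_right_and (itvR t ht) h) => s _ [hs nL].
    by rewrite leNgt; apply/negP => h3; apply/nL/LE.
  have [/(h2 t t0 te')//|h] := semialg_ev_left_dich t (secL t).
  have ht := itv _ _ t0 te' e'e.
  apply: ev_left_imp (ev_left_and (itvL t ht) h) => s _ [hs nL].
  by rewrite leNgt; apply/negP => h3; apply/nL/LE.
have antimono e' : e' <= e ->
    (forall t, 0 < t -> t < e' -> ~ ev_right t (fun s => L (t, s))) ->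
    (forall t, 0 < t -> t < e' -> ~ ev_left t (fun s => L (s, t))) ->
    forall s t, 0 < s -> s <= t -> t < e' -> f t <= f s.
  move=> e'e h1 h2 s t s0 st te'; rewrite -lerN2; move: s t s0 st te'.
  apply: (@locally_nondecreasing (fun s => - f s)) => t t0 te'.
    have [/(h1 t t0 te')//|h] := semialg_ev_right_dich t (secL t).
    have ht := itv _ _ t0 te' e'e.
    apply: ev_right_imp (ev_right_and (itvR t ht) h) => s _ [hs nL].
    by rewrite lerN2 leNgt; apply/negP => h3; apply/nL/LE.
  have [/(h2 t t0 te')//|h] := semialg_ev_left_dich t (secG t).
  have ht := itv _ _ t0 te' e'e.
  apply: ev_left_imp (ev_left_and (itvL t ht) h) => s _ [hs nL].
  by rewrite lerN2 leNgt; apply/negP => h3; apply/nL/LE.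
have isolate t (Q : R -> Prop) : ev_right t Q -> ev_left t Q ->
    exists d, 0 < d /\ forall s, t - d < s -> s < t + d -> s != t -> Q s.
  move=> [d [d0 hd]] [d' [d'0 hd']]; exists (Num.min d d'); rewrite lt_min d0.
  split=> // s h1 h2 st; have [ss|ss|sE] := ltgtP s t.
  - by apply: hd' => //; apply: le_lt_trans h1; rewrite lerD2l lerN2 ge_min lexx orbT.
  - by apply: hd => //; apply: lt_le_trans h2 _; rewrite lerD2l ge_min lexx.
  - by rewrite sE eqxx in st.
(* [A] and [B] refer to points [s] to the right and to the left of [t]; [L] stands for [f t < f s]
   and [G] for [f s < f t]. *)
have dAL := semialg_ev_right_dich 0 (semialg_ev_right hL).
have dAG := semialg_ev_right_dich 0 (semialg_ev_right hG).
have dBL := semialg_ev_right_dich 0 (semialg_ev_left hL).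
have dBG := semialg_ev_right_dich 0 (semialg_ev_left hG).
have half e' : 0 < e' -> e' <= e -> [/\ 0 < e' / 2, e' / 2 < e' & 0 < e' / 2 < e].
  move=> e'0 e'e; have h0 : 0 < e' / 2 by rewrite divr_gt0.
  have h1 : e' / 2 < e' by rewrite gtr_pMr// invf_lt1 ?ltr1n.
  by split=> //; exact: itv h1 e'e.
have notALG : ev_right 0 (fun t => ev_right t (fun s => L (t, s))) ->
    ~ ev_right 0 (fun t => ev_right t (fun s => L (s, t))).
  move=> hAL hAG; have [e' [e'0 e'e H]] := evE _ _ hAL hAG.
  have [t0 te' ht] := half _ e'0 e'e; have [h1 h2] := H _ t0 te'.
  have [s _ [hs [/LE h3 /LE h4]]] :=
    ev_right_ex (ev_right_and (itvR _ ht) (ev_right_and h1 h2)).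
  by have := lt_trans (h3 ht hs) (h4 hs ht); rewrite ltxx.
have notBLG : ev_right 0 (fun t => ev_left t (fun s => L (t, s))) ->
    ~ ev_right 0 (fun t => ev_left t (fun s => L (s, t))).
  move=> hBL hBG; have [e' [e'0 e'e H]] := evE _ _ hBL hBG.
  have [t0 te' ht] := half _ e'0 e'e; have [h1 h2] := H _ t0 te'.
  have [s _ [hs [/LE h3 /LE h4]]] :=
    ev_left_ex (ev_left_and (itvL _ ht) (ev_left_and h1 h2)).
  by have := lt_trans (h3 ht hs) (h4 hs ht); rewrite ltxx.
have notLL : ev_right 0 (fun t => ev_right t (fun s => L (t, s))) ->
    ~ ev_right 0 (fun t => ev_left t (fun s => L (t, s))).
  move=> hAL hBL; have [e' [e'0 e'e H]] := evE _ _ hAL hBL.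
  apply: (@no_strict_local_min f _ _ e'0) => t t0 te'; have [h1 h2] := H _ t0 te'.
  have ht := itv _ _ t0 te' e'e.
  apply: isolate; [apply: ev_right_imp (ev_right_and (itvR t ht) h1)
                  |apply: ev_left_imp (ev_left_and (itvL t ht) h2)] => s _ [hs];
    by move=> /LE; apply.
have notGG : ev_right 0 (fun t => ev_right t (fun s => L (s, t))) ->
    ~ ev_right 0 (fun t => ev_left t (fun s => L (s, t))).
  move=> hAG hBG; have [e' [e'0 e'e H]] := evE _ _ hAG hBG.
  apply: (@no_strict_local_min (fun s => - f s) _ _ e'0) => t t0 te'.
  have [h1 h2] := H _ t0 te'; have ht := itv _ _ t0 te' e'e.
  apply: isolate; [apply: ev_right_imp (ev_right_and (itvR t ht) h1)
                  |apply: ev_left_imp (ev_left_and (itvL t ht) h2)] => s _ [hs];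
    by rewrite ltrN2 => /LE; apply.
have nondec : ~ ev_right 0 (fun t => ev_right t (fun s => L (s, t))) ->
    ~ ev_right 0 (fun t => ev_left t (fun s => L (t, s))) ->
    exists e', [/\ 0 < e', e' <= e &
      (forall s t, 0 < s -> s <= t -> t < e' -> f s <= f t) \/
      (forall s t, 0 < s -> s <= t -> t < e' -> f t <= f s)].
  move=> nAG nBL; case: dAG => // hAG; case: dBL => // hBL.
  have [e' [e'0 e'e H]] := evE _ _ hAG hBL.
  exists e'; split=> //; left.
  by apply: mono => // t t0 te'; have [] := H t t0 te'.
(* A strict increase on either side excludes strict decrease on both sides, which leaves [f]
   nondecreasing. Without any strict increase [f] is nonincreasing. *)
have [hAL|hAL] := dAL.
  by apply: nondec; [exact: notALG|exact: notLL].
have [hBG|hBG] := dBG.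
  by apply: nondec => h; [exact: notGG hBG|exact: notBLG hBG].
have [e' [e'0 e'e H]] := evE _ _ hAL hBG.
exists e'; split=> //; right.
by apply: antimono => // t t0 te'; have [] := H t t0 te'.
Qed.

End OneVariable.

(** * Semialgebraic selection *)

Definition argmin_slice (R : realType) (N : nat) (S : R * 'rV[R]_N -> Prop)
    (phi : 'rV[R]_N -> R) : R * 'rV[R]_N -> Prop :=
  fun p => S p /\ forall x, S (p.1, x) -> phi p.2 <= phi x.

Section Selection.
Variables (R : realType) (N : nat).
Implicit Types (S : R * 'rV[R]_N -> Prop) (phi : 'rV[R]_N -> R).

Lemma semialg_argmin_slice S phi : polyf (coords R N) phi ->
  semialg (ext [:: id] N) S -> semialg (ext [:: id] N) (argmin_slice S phi).
Proof.
move=> hphi hS; apply: semialg_and => //.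
apply: (@semialg_all _ _ _ _ (fun q : R * 'rV[R]_N * 'rV[R]_N =>
  S (q.1.1, q.2) -> phi q.1.2 <= phi q.2)).
apply: semialg_imp.
  apply: semialg_ext_comp hS => [[|//] _|j]; last exact: polyf_ext_snd.
  apply: (@polyf_ext_fst _ _ _ _ (fun p : R * 'rV[R]_N => p.1)).
  by apply: (@polyf_ext_fst _ _ [:: id] _ id); exact: (polyf_var (vs := [:: id]) (i := 0)).
apply: semialg_le; last exact: polyf_ext_last.
by apply: (@polyf_ext_fst _ _ _ _ (fun p : R * 'rV[R]_N => phi p.2)); exact: polyf_ext_last.
Qed.

(** The minimizers again form a nonempty compact set, so further functions can be minimized on them
    in turn. *)
Lemma compact_argmin_slice S phi t : continuous phi ->
  compact [set x | S (t, x)] -> (exists x, S (t, x)) ->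
  compact [set x | argmin_slice S phi (t, x)] /\ exists x, argmin_slice S phi (t, x).
Proof.
move=> cphi cS [x0 Sx0].
have [c] := @EVT_min_rV _ _ phi [set x | S (t, x)] (ex_intro _ x0 Sx0) cS
  (continuous_subspaceT cphi).
rewrite inE /= => Sc cmin.
have cle x : S (t, x) -> phi c <= phi x by move=> Sx; apply: cmin; rewrite inE.
split; last by exists c; split.
have -> : [set x | argmin_slice S phi (t, x)] =
    [set x | S (t, x)] `&` phi @^-1` [set y | y <= phi c].
  apply/seteqP; split => [x [/= Sx xmin]|x [/= Sx xc]]; split=> //=; first exact: xmin.
  by move=> y /= Sy; apply: le_trans xc (cle _ Sy).
apply: compact_closedI => //.
by apply: closed_comp => [x _|]; [exact: cphi|exact: closed_le].
Qed.

(** On each slice a definable rule singles out one minimizer of [phi], so the coordinates of [z] are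
    semialgebraic functions of [t], monotone near 0. Finitely many intervals of monotonicity have a
    common part. *)
Lemma semialg_selection S phi (e : R) : 0 < e ->
  semialg (ext [:: id] N) S -> polyf (coords R N) phi ->
  (forall t, 0 < t < e -> compact [set x | S (t, x)] /\ exists x, S (t, x)) ->
  exists (e' : R) (z : R -> 'rV[R]_N), [/\ 0 < e', e' <= e,
    forall t, 0 < t < e' -> S (t, z t) /\ forall x, S (t, x) -> phi (z t) <= phi x &
    forall j : 'I_N,
      (forall s t, 0 < s -> s <= t -> t < e' -> z s 0 j <= z t 0 j) \/
      (forall s t, 0 < s -> s <= t -> t < e' -> z t 0 j <= z s 0 j)].
Proof.
move=> e0 hS hphi cS.
pose step S (j : 'I_N) := argmin_slice S (fun x => x 0 j).
(* Lexicographic minimization makes the selection unique. *)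
pose P := foldl step (argmin_slice S phi) (enum 'I_N).
have foldP (l : seq 'I_N) S' : semialg (ext [:: id] N) S' ->
    (forall t, 0 < t < e -> compact [set x | S' (t, x)] /\ exists x, S' (t, x)) ->
  [/\ semialg (ext [:: id] N) (foldl step S' l),
      forall t, 0 < t < e -> exists x, foldl step S' l (t, x),
      forall p, foldl step S' l p -> S' p &
      forall j t x y, j \in l -> foldl step S' l (t, x) -> foldl step S' l (t, y) ->
        x 0 j = y 0 j].
  elim: l S' => [|j l IH] S' hS' cS' /=.
    by split=> // t /cS'[].
  have [||h1 h2 h3 h4] := IH (step S' j).
  - by apply: semialg_argmin_slice => //; exact: polyf_coord.
  - move=> t /cS'[? ?]; apply: compact_argmin_slice => //; exact: coord_continuous.
  split=> // [p /h3[]//|i t x y]; rewrite inE => /predU1P[->|/h4]; last exact.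
  move=> /h3[/= Sx xmin] /h3[/= Sy ymin]; apply/eqP.
  by rewrite eq_le xmin // ymin.
have [|t te|PS Pex Psub Puniq] := foldP (enum 'I_N) (argmin_slice S phi).
- exact: semialg_argmin_slice.
- have [? ?] := cS t te; apply: compact_argmin_slice => //; exact: polyf_continuous.
have /choice[z zP] : forall t, exists x, 0 < t < e -> P (t, x).
  move=> t; have [/Pex[x Px]|_] := boolP (0 < t < e); first by exists x.
  by exists 0.
(* [z] comes from choice, yet the order of its coordinates is definable: by uniqueness it can be
   read off any points of [P] above [t] and [s]. *)
have hL (j : 'I_N) : semialg [:: (@fst R R); (@snd R R)] (fun p : R * R =>
    exists x, exists y, (P (p.1, x) /\ P (p.2, y)) /\ x 0 j < y 0 j).
  apply: (@semialg_ex _ _ _ _ (fun q : R * R * 'rV[R]_N => exists y,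
    (P (q.1.1, q.2) /\ P (q.1.2, y)) /\ q.2 0 j < y 0 j)).
  apply: (@semialg_ex _ _ _ _ (fun q : R * R * 'rV[R]_N * 'rV[R]_N =>
    (P (q.1.1.1, q.1.2) /\ P (q.1.1.2, q.2)) /\ q.1.2 0 j < q.2 0 j)).
  have h12 k : polyf (ext (ext [:: (@fst R R); (@snd R R)] N) N)
      (fun q : R * R * 'rV[R]_N * 'rV[R]_N => q.1.2 0 k).
    apply: (@polyf_ext_fst _ _ _ _ (fun q : R * R * 'rV[R]_N => q.2 0 k)).
    exact: polyf_ext_snd.
  have h2 k := polyf_ext_snd (ext [:: (@fst R R); (@snd R R)] N) k.
  apply: semialg_and; last exact: semialg_lt.
  apply: semialg_and; apply: semialg_ext_comp PS => [[|//] _|k] //.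
    apply: (@polyf_ext_fst _ _ _ _ (fun q : R * R * 'rV[R]_N => q.1.1)).
    apply: (@polyf_ext_fst _ _ _ _ (@fst R R)).
    exact: (polyf_var (vs := [:: fst; snd]) (i := 0)).
  apply: (@polyf_ext_fst _ _ _ _ (fun q : R * R * 'rV[R]_N => q.1.2)).
  apply: (@polyf_ext_fst _ _ _ _ (@snd R R)).
  exact: (polyf_var (vs := [:: fst; snd]) (i := 1)).
have hmono (j : 'I_N) : exists e', [/\ 0 < e', e' <= e &
      (forall s t, 0 < s -> s <= t -> t < e' -> z s 0 j <= z t 0 j) \/
      (forall s t, 0 < s -> s <= t -> t < e' -> z t 0 j <= z s 0 j)].
  apply: (semialg_monotone (f := fun t => z t 0 j) e0 (hL j)) => t s te se /=.
  split=> [[x [y [[Px Py] xy]]]|zz]; last by exists (z t), (z s); split=> //; split; exact: zP.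
  rewrite (Puniq j t (z t) x) ?mem_enum //; last exact: zP.
  by rewrite (Puniq j s (z s) y) ?mem_enum //; exact: zP.
have [E EP] := choice hmono.
pose e' := \big[Num.min/e]_(j < N) E j.
have e'E j : e' <= E j by exact: bigmin_le_cond.
have e'e : e' <= e by exact: bigmin_le_id.
exists e', z; split=> //.
- by apply: lt_bigmin => // j _; have [] := EP j.
- move=> t /andP[t0 te']; have := zP t; rewrite t0 (lt_le_trans te' e'e).
  by move=> /(_ isT)/Psub[].
- move=> j; have [_ _ [H|H]] := EP j; [left|right] => s t s0 st te'; apply: H => //;
    exact: lt_le_trans (e'E j).
Qed.

End Selection.

(** * Singular values and the nuclear norm *)

Section RealSpectral.
Variable R : realType.

(** Over the complex numbers [A] is Hermitian, hence diagonalizable with real eigenvalues, and being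
    an eigenvalue does not depend on the field. *)
Lemma symmetric_eigenvalue n (A : 'M[R]_n.+1) : A^T = A ->
  exists mu : R, eigenvalue A mu.
Proof.
move=> symA; pose f : {rmorphism R -> complex R} := real_complex R.
pose B := map_mx f A.
have hB : B \is hermsymmx.
  apply: realsym_hermsym.
    apply/is_hermitianmxP; rewrite /= expr0 scale1r map_mx_id //.
    by rewrite /B map_trmx symA.
  by apply/mxOverP => i j; rewrite mxE complex_real.
have /mxOverP/(_ 0 0)/complex_realP[mu muE] :=
  hermitian_spectral_diag_real hB.
have /orthomx_spectralP := hermitian_normalmx hB.
set P := spectralmx B; set sp := spectral_diag B => BE.
have Pu : P \in unitmx by exact: spectral_unit.
exists mu; rewrite -(eigenvalue_map f) -/B; apply/eigenvalueP; exists (row 0 P).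
  rewrite [in LHS]BE !mulmxA -row_mul mulmxV // -[f mu]muE.
  by rewrite row1 -rowE row_diag_mx -scalemxAl -rowE.
apply/eqP => P0; have := oner_neq0 (complex R).
suff -> : 1 = 0 :> complex R by rewrite eqxx.
have /matrixP/(_ 0 0) := mulmxV Pu.
rewrite [RHS]mxE eqxx mulr1n => <-; rewrite mxE big1 // => j _.
by have /rowP/(_ j) := P0; rewrite !mxE => ->; rewrite mul0r.
Qed.

Lemma row_dotE n (u : 'rV[R]_n) : (u *m u^T) 0 0 = \sum_j u 0 j ^+ 2.
Proof. by rewrite mxE; apply: eq_bigr => j _; rewrite mxE expr2. Qed.

Lemma row_dot_ge0 n (u : 'rV[R]_n) : 0 <= (u *m u^T) 0 0.
Proof. by rewrite row_dotE sumr_ge0 // => j _; exact: sqr_ge0. Qed.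

Lemma row_dot_eq0 n (u : 'rV[R]_n) : (u *m u^T) 0 0 = 0 -> u = 0.
Proof.
rewrite row_dotE => /eqP; rewrite psumr_eq0 => [/allP h|j _]; last exact: sqr_ge0.
by apply/rowP => j; have := h j (mem_index_enum _); rewrite mxE sqrf_eq0 => /eqP.
Qed.

(* [Q] is the reflection exchanging [v] and the first basis vector. *)
Lemma householder n (v : 'rV[R]_(1 + n)) : v *m v^T = 1%:M ->
  exists Q : 'M[R]_(1 + n), [/\ Q^T = Q, Q *m Q = 1%:M & delta_mx 0 0 *m Q = v].
Proof.
move=> v1; set e : 'rV[R]_(1 + n) := delta_mx 0 0.
have e1 : e *m e^T = 1%:M by rewrite trmx_delta mul_delta_mx [LHS]mx11_scalar mxE.
have [->|ve] := eqVneq v e.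
  by exists 1%:M; rewrite trmx1 mulmx1; split=> //; rewrite mulmx1.
pose w := v - e.
have evT : e *m v^T = (v 0 0)%:M.
  by rewrite -rowE; apply/matrixP => i j; rewrite !ord1 !mxE eqxx.
have veT : v *m e^T = (v 0 0)%:M by rewrite -[LHS]trmxK trmx_mul trmxK evT tr_scalar_mx.
(* [2 * c] is the squared length of [w], so [c^-1] is the coefficient [2 / |w|^2] of the reflection
   along [w]. *)
pose c := 1 - v 0 0.
have wwE : w *m w^T = (2 * c)%:M.
  rewrite /w linearB /= mulmxBl !mulmxBr v1 e1 evT veT.
  by rewrite -!raddfB /=; congr (_%:M); rewrite /c; ring.
have ewE : e *m w^T = (- c)%:M.
  by rewrite /w linearB /= mulmxBr e1 evT -raddfB; congr (_%:M); rewrite /c opprB.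
have c0 : c != 0.
  apply: contra ve => /eqP c0; rewrite -subr_eq0 -/w.
  by apply/eqP/row_dot_eq0; rewrite wwE c0 mulr0 mxE mul0rn.
have ewv : e + w = v by rewrite /w addrC subrK.
clearbody w; exists (1%:M - c^-1 *: (w^T *m w)); split.
- by rewrite linearB /= trmx1 linearZ /= trmx_mul trmxK.
- rewrite mulmxBl mul1mx mulmxBr mulmx1 -scalemxAl -scalemxAr mulmxA.
  rewrite -(mulmxA w^T w) wwE -mulmxA mul_scalar_mx -scalemxAr !scalerA.
  have -> : c^-1 * (c^-1 * (2 * c)) = c^-1 + c^-1 by field.
  by rewrite scalerDl opprB; apply/matrixP => i j; rewrite !mxE; ring.
- rewrite mulmxBr mulmx1 -scalemxAr mulmxA ewE mul_scalar_mx scalerA mulrN mulVf //.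
  by rewrite scaleN1r opprK.
Qed.

(** Deflation: a reflection takes a unit eigenvector to the first basis vector. The conjugate [B] of
    [A] then has a zero upper right block, by symmetry a zero lower left one too, and induction
    applies to the remaining block. *)
Lemma symmetric_spectral n (A : 'M[R]_n) : A^T = A ->
  exists (P : 'M[R]_n) (s : 'rV[R]_n),
    P *m P^T = 1%:M /\ A = P^T *m diag_mx s *m P.
Proof.
elim: n A => [|n IH] A.
  by exists 1%:M, 0; split; apply/matrixP => -[].
move: A; rewrite -[n.+1]/(1 + n)%N => A symA.
have [mu /eigenvalueP[u uA u0]] := @symmetric_eigenvalue n A symA.
pose N := (u *m u^T) 0 0.
have N0 : 0 < N.
  rewrite lt_neqAle eq_sym row_dot_ge0 andbT.
  by apply: contra u0 => /eqP/row_dot_eq0 ->.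
pose v := (Num.sqrt N)^-1 *: u.
have v1 : v *m v^T = 1%:M.
  rewrite /v linearZ /= -scalemxAl -scalemxAr scalerA [u *m _]mx11_scalar -/N.
  by rewrite -invfM -expr2 sqr_sqrtr ?ltW // scale_scalar_mx mulVf // gt_eqF.
have [Q [QT QQ eQ]] := @householder n v v1.
pose B : 'M[R]_(1 + n) := Q *m A *m Q.
have BT : B^T = B by rewrite /B !trmx_mul QT symA mulmxA.
have eB : delta_mx 0 0 *m B = mu *: (delta_mx 0 0 : 'rV_(1 + n)).
  rewrite /B !mulmxA eQ /v -!scalemxAl uA -scalemxAl scalerA mulrC -scalerA.
  by rewrite [_ *: (u *m Q)]scalemxAl -/v -eQ -mulmxA QQ mulmx1.
have AE : A = Q *m B *m Q.
  by rewrite /B !mulmxA QQ mul1mx -mulmxA QQ mulmx1.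
clearbody B.
have Bur : ursubmx B = 0.
  apply/rowP => j; have /rowP/(_ (rshift 1 j)) := eB.
  rewrite -rowE !mxE /= mulr0 => <-; congr (B _ _); exact/val_inj.
have Bdl : dlsubmx B = 0.
  by rewrite -[B]BT -[LHS]trmxK trmx_dlsub trmxK Bur trmx0.
have [|P [s [PP BE]]] := IH (drsubmx B).
  by rewrite trmx_drsub BT.
exists (block_mx 1%:M 0 0 P *m Q), (row_mx (ulsubmx B) s).
have Ptr : (block_mx 1%:M 0 0 P)^T = block_mx (1%:M : 'M[R]_1) 0 0 P^T.
  by rewrite tr_block_mx trmx1 !trmx0.
split.
  rewrite trmx_mul mulmxA -(mulmxA _ Q) QT QQ mulmx1 Ptr mulmx_block.
  by rewrite !mulmx0 !mul0mx !addr0 add0r mulmx1 PP -scalar_mx_block.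
rewrite AE trmx_mul QT Ptr diag_mx_row !mulmxA; congr (_ *m _).
rewrite -!mulmxA; congr (_ *m _).
rewrite mulmxA !mulmx_block !mulmx0 !mul0mx !addr0 !add0r mul0mx mulmx1 mul1mx -BE.
rewrite -[LHS]submxK Bur Bdl; congr (block_mx _ _ _ _).
  by apply/matrixP => i j; rewrite !ord1 !mxE eqxx mulr1n.
by rewrite mul0mx.
Qed.
End RealSpectral.

(** * Frobenius inner product and norm *)

Section MatrixDot.
Variable R : realType.

Lemma mxdotE p q (A B : 'M[R]_(p, q)) : mxdot A B = \sum_i \sum_j A i j * B i j.
Proof.
rewrite /mxdot /mxtrace exchange_big /=; apply: eq_bigr => j _.
by rewrite mxE; apply: eq_bigr => i _; rewrite mxE.
Qed.

Lemma mxdotC p q (A B : 'M[R]_(p, q)) : mxdot A B = mxdot B A.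
Proof. by rewrite !mxdotE; do 2!apply: eq_bigr => ? _; rewrite mulrC. Qed.

Lemma mxdotDl p q (A B C : 'M[R]_(p, q)) : mxdot (A + B) C = mxdot A C + mxdot B C.
Proof. by rewrite /mxdot linearD mulmxDl mxtraceD. Qed.

Lemma mxdotZl p q (a : R) (A B : 'M[R]_(p, q)) : mxdot (a *: A) B = a * mxdot A B.
Proof. by rewrite /mxdot linearZ -scalemxAl mxtraceZ. Qed.

Lemma mxdotNl p q (A B : 'M[R]_(p, q)) : mxdot (- A) B = - mxdot A B.
Proof. by rewrite -scaleN1r mxdotZl mulN1r. Qed.

Lemma mxdotBl p q (A B C : 'M[R]_(p, q)) : mxdot (A - B) C = mxdot A C - mxdot B C.
Proof. by rewrite mxdotDl mxdotNl. Qed.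

Lemma mxdotDr p q (A B C : 'M[R]_(p, q)) : mxdot C (A + B) = mxdot C A + mxdot C B.
Proof. by rewrite !(mxdotC C) mxdotDl. Qed.

Lemma mxdotZr p q (a : R) (A B : 'M[R]_(p, q)) : mxdot B (a *: A) = a * mxdot B A.
Proof. by rewrite !(mxdotC B) mxdotZl. Qed.

Lemma mxdotNr p q (A B : 'M[R]_(p, q)) : mxdot B (- A) = - mxdot B A.
Proof. by rewrite !(mxdotC B) mxdotNl. Qed.

Lemma mxdotBr p q (A B C : 'M[R]_(p, q)) : mxdot C (A - B) = mxdot C A - mxdot C B.
Proof. by rewrite !(mxdotC C) mxdotBl. Qed.

Lemma mxdot0l p q (A : 'M[R]_(p, q)) : mxdot 0 A = 0.
Proof. by rewrite -(scale0r 0) mxdotZl mul0r. Qed.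

Lemma mxdot0r p q (A : 'M[R]_(p, q)) : mxdot A 0 = 0.
Proof. by rewrite mxdotC mxdot0l. Qed.

Lemma mxdot_mull p q r (A : 'M[R]_(p, q)) (B : 'M[R]_(q, r)) C :
  mxdot (A *m B) C = mxdot B (A^T *m C).
Proof. by rewrite /mxdot trmx_mul mulmxA. Qed.

Lemma mxdot_mulr p q r (A : 'M[R]_(p, q)) (B : 'M[R]_(q, r)) C :
  mxdot (A *m B) C = mxdot A (C *m B^T).
Proof. by rewrite /mxdot trmx_mul -mulmxA mxtrace_mulC mulmxA. Qed.

Lemma mxdot_tr p q (A B : 'M[R]_(p, q)) : mxdot A^T B^T = mxdot A B.
Proof. by rewrite !mxdotE exchange_big; do 2!apply: eq_bigr => ? _; rewrite !mxE. Qed.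

Lemma mxdot_ge0 p q (A : 'M[R]_(p, q)) : 0 <= mxdot A A.
Proof. by rewrite mxdotE; do 2!(apply: sumr_ge0 => ? _); rewrite -expr2 sqr_ge0. Qed.

Lemma sqr_frob p q (A : 'M[R]_(p, q)) : frob_norm A ^+ 2 = mxdot A A.
Proof. by rewrite /frob_norm sqr_sqrtr ?mxdot_ge0. Qed.

Lemma frob_ge0 p q (A : 'M[R]_(p, q)) : 0 <= frob_norm A.
Proof. exact: sqrtr_ge0. Qed.

Lemma frob_sqr_le p q (A : 'M[R]_(p, q)) c : 0 <= c -> mxdot A A <= c ^+ 2 ->
  frob_norm A <= c.
Proof. by move=> c0 h; rewrite -(@ler_pXn2r _ 2) ?nnegrE ?frob_ge0 // sqr_frob. Qed.

Lemma mxdot_eq0 p q (A : 'M[R]_(p, q)) : mxdot A A = 0 -> A = 0.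
Proof.
rewrite mxdotE => /eqP; rewrite psumr_eq0 => [/allP h|i _]; last first.
  by apply: sumr_ge0 => j _; rewrite -expr2 sqr_ge0.
apply/matrixP => i j; rewrite mxE.
have := h i (mem_index_enum _); rewrite /= psumr_eq0 => [/allP h'|k _]; last first.
  by rewrite -expr2 sqr_ge0.
by have := h' j (mem_index_enum _); rewrite /= mulf_eq0 orbb => /eqP.
Qed.

Lemma frob_eq0 p q (A : 'M[R]_(p, q)) : frob_norm A = 0 -> A = 0.
Proof. by move=> h; apply: mxdot_eq0; rewrite -sqr_frob h expr0n. Qed.

Lemma frob0 p q : frob_norm (0 : 'M[R]_(p, q)) = 0.
Proof. by rewrite /frob_norm mxdot0l sqrtr0. Qed.

Lemma frobZ p q (a : R) (A : 'M[R]_(p, q)) : frob_norm (a *: A) = `|a| * frob_norm A.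
Proof. by rewrite /frob_norm mxdotZl mxdotZr mulrA -expr2 sqrtrM ?sqr_ge0// sqrtr_sqr. Qed.

Lemma frobN p q (A : 'M[R]_(p, q)) : frob_norm (- A) = frob_norm A.
Proof. by rewrite -scaleN1r frobZ normrN1 mul1r. Qed.

Lemma frob_distC p q (A B : 'M[R]_(p, q)) : frob_norm (A - B) = frob_norm (B - A).
Proof. by rewrite -frobN opprB. Qed.

Lemma frob_tr p q (A : 'M[R]_(p, q)) : frob_norm A^T = frob_norm A.
Proof. by rewrite /frob_norm mxdot_tr. Qed.

(** Cauchy-Schwarz, from [0 <= |b A - a B|^2 = 2 a b (a b - <A, B>)]. *)
Lemma mxdot_le p q (A B : 'M[R]_(p, q)) : mxdot A B <= frob_norm A * frob_norm B.
Proof.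
set a := frob_norm A; set b := frob_norm B.
have [a0|a0] := eqVneq a 0; first by rewrite (frob_eq0 a0) mxdot0l a0 mul0r.
have [b0|b0] := eqVneq b 0; first by rewrite (frob_eq0 b0) mxdot0r b0 mulr0.
have ab : 0 < a * b by rewrite mulr_gt0 // lt_neqAle eq_sym ?a0 ?b0 frob_ge0.
have := mxdot_ge0 (b *: A - a *: B).
rewrite mxdotBl !mxdotBr !mxdotZl !mxdotZr -!sqr_frob -/a -/b (mxdotC B A) => h.
rewrite -subr_ge0 -(pmulr_rge0 _ ab); nra.
Qed.

Lemma normr_mxdot_le p q (A B : 'M[R]_(p, q)) :
  `|mxdot A B| <= frob_norm A * frob_norm B.
Proof. by rewrite ler_norml mxdot_le andbT lerNl -mxdotNl -(frobN A) mxdot_le. Qed.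

Lemma frobD_le p q (A B : 'M[R]_(p, q)) :
  frob_norm (A + B) <= frob_norm A + frob_norm B.
Proof.
apply: frob_sqr_le; first by rewrite addr_ge0 ?frob_ge0.
rewrite mxdotDl !mxdotDr (mxdotC B A) -!sqr_frob.
by have := mxdot_le A B; nra.
Qed.

Lemma frobB_le p q (A B : 'M[R]_(p, q)) :
  frob_norm (A - B) <= frob_norm A + frob_norm B.
Proof. by rewrite -(frobN B) frobD_le. Qed.

Lemma entry_le_frob p q (A : 'M[R]_(p, q)) i j : `|A i j| <= frob_norm A.
Proof.
rewrite -(@ler_pXn2r _ 2) ?nnegrE ?frob_ge0 // sqr_frob mxdotE real_normK ?num_real //.
rewrite (bigD1 i) //= (bigD1 j) //= -expr2 -addrA lerDl addr_ge0 //.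
  by apply: sumr_ge0 => k _; rewrite -expr2 sqr_ge0.
by do 2!(apply: sumr_ge0 => ? _); rewrite -expr2 sqr_ge0.
Qed.

Lemma frob_le_sum p q (A : 'M[R]_(p, q)) : frob_norm A <= \sum_i \sum_j `|A i j|.
Proof.
have frob_sum (I : finType) (F : I -> 'M[R]_(p, q)) :
    frob_norm (\sum_i F i) <= \sum_i frob_norm (F i).
  elim/big_ind2 : _ => // [|A1 a1 A2 a2 h1 h2]; first by rewrite frob0.
  by apply: le_trans (frobD_le _ _) _; exact: lerD.
rewrite [in leLHS](matrix_sum_delta A); apply: le_trans (frob_sum _ _) _.
apply: ler_sum => i _; apply: le_trans (frob_sum _ _) _.
apply: ler_sum => j _; rewrite frobZ -[leRHS]mulr1 ler_wpM2l //.
apply: frob_sqr_le => //; rewrite /mxdot trmx_delta mul_delta_mx expr1n.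
rewrite /mxtrace (bigD1 j) //= mxE eqxx big1 ?addr0 //.
by move=> k kj; rewrite mxE (negPf kj).
Qed.

End MatrixDot.

(** * Singular values, and duality between the nuclear norm and contractions *)

Section SingularValues.
Variable R : realType.

(** The unit ball of the spectral norm, written without singular values: one polynomial inequality
    for each [y], hence a closed first-order condition. *)
Definition contraction p q (W : 'M[R]_(p, q)) :=
  forall y : 'rV[R]_q, mxdot (W *m y^T) (W *m y^T) <= mxdot y y.

Lemma mxdot_colE p q (X Y : 'M[R]_(p, q)) i :
  mxdot (col i X) (col i Y) = (X^T *m Y) i i.
Proof.
rewrite mxdotE mxE; apply: eq_bigr => k _.
by rewrite big_ord1 !mxE.
Qed.

Lemma mxdot_cols p q (X Y : 'M[R]_(p, q)) :
  mxdot X Y = \sum_i mxdot (col i X) (col i Y).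
Proof. by rewrite /mxdot /mxtrace; apply: eq_bigr => i _; rewrite -mxdot_colE. Qed.

Lemma char_poly_orthodiag n (P : 'M[R]_n) (s : 'rV[R]_n) : P *m P^T = 1%:M ->
  char_poly (P^T *m diag_mx s *m P) = \prod_i ('X - (s 0 i)%:P).
Proof.
move=> PP; have PtP : P^T *m P = 1%:M by exact: mulmx1C.
pose Q := map_mx polyC P.
have QtQ : Q^T *m Q = 1%:M by rewrite map_trmx -map_mxM PtP map_mx1.
have -> : char_poly (P^T *m diag_mx s *m P) =
    \det (Q^T *m ('X%:M - map_mx polyC (diag_mx s)) *m Q).
  rewrite /char_poly /char_poly_mx mulmxBr mulmxBl !map_mxM -map_trmx.
  by rewrite -[_ *m 'X%:M *m Q]mulmxA mul_scalar_mx -scalemxAr QtQ scalemx1.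
rewrite !det_mulmx mulrAC -det_mulmx QtQ det1 mul1r map_diag_mx -diag_const_mx.
rewrite -raddfB det_diag; apply: eq_bigr => i _.
by rewrite !mxE.
Qed.

(** Links the definition of singular values through roots and multiplicities to the diagonal of a
    diagonalization. *)
Lemma perm_rootsR_prod (s : seq R) (chi := \prod_(a <- s) ('X - a%:P)) :
  perm_eq (flatten [seq nseq (mup x chi) x | x <- rootsR chi]) s.
Proof.
have chi0 : chi != 0.
  by rewrite prodf_seq_neq0; apply/allP => a _; rewrite polyXsubC_eq0.
rewrite -[X in perm_eq _ X]/s; apply: perm_trans (perm_count_undup s).
apply: perm_flatten; under eq_map do rewrite mu_prod_XsubC.
apply: perm_map; apply: uniq_perm; rewrite ?undup_uniq ?uniq_roots // => x.
rewrite mem_undup -(root_prod_XsubC s x) -/chi.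
by have := roots_on_rootsR chi0 x; rewrite in_itv /= => <-.
Qed.

Lemma perm_map_rootsR_prod (f : R -> R) (s : seq R) (chi := \prod_(a <- s) ('X - a%:P)) :
  perm_eq (flatten [seq nseq (mup x chi) (f x) | x <- rootsR chi]) [seq f a | a <- s].
Proof.
have := perm_map f (perm_rootsR_prod s); rewrite map_flatten -map_comp.
by under eq_map do rewrite /= map_nseq.
Qed.

(** Diagonalize [A^T A]: its eigenvalues are the squared lengths of the columns of [A P^T], hence
    nonnegative, and their square roots are the singular values. *)
Lemma singular_valuesP p q (A : 'M[R]_(p, q)) :
  exists (P : 'M[R]_q) (s : 'rV[R]_q),
  [/\ P *m P^T = 1%:M, forall i, 0 <= s 0 i,
      A^T *m A = P^T *m diag_mx (\row_i s 0 i ^+ 2) *m P &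
      perm_eq (singular_values A) [seq s 0 i | i <- enum 'I_q]].
Proof.
have [|P [t [PP AE]]] := @symmetric_spectral R q (A^T *m A).
  by rewrite trmx_mul trmxK.
have PtP : P^T *m P = 1%:M by exact: mulmx1C.
have APE : (A *m P^T)^T *m (A *m P^T) = diag_mx t.
  rewrite trmx_mul trmxK mulmxA -(mulmxA P) AE !mulmxA PP mul1mx -mulmxA PP.
  by rewrite mulmx1.
have t0 i : 0 <= t 0 i.
  have -> : t 0 i = mxdot (col i (A *m P^T)) (col i (A *m P^T)).
    by rewrite mxdot_colE APE mxE eqxx.
  exact: mxdot_ge0.
exists P, (\row_i Num.sqrt (t 0 i)); split=> //.
- by move=> i; rewrite mxE sqrtr_ge0.
- by rewrite AE; congr (_ *m diag_mx _ *m _); apply/rowP => i; rewrite !mxE sqr_sqrtr.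
rewrite /singular_values AE char_poly_orthodiag //.
have -> : \prod_i ('X - (t 0 i)%:P) = \prod_(a <- [seq t 0 i | i <- enum 'I_q]) ('X - a%:P).
  by rewrite big_map big_enum.
apply: perm_trans (perm_map_rootsR_prod Num.sqrt _) _.
rewrite -[X in perm_eq X _]map_comp; apply/permP => ?; congr (count _ _).
by apply: eq_map => i /=; rewrite mxE.
Qed.

Lemma nuclear_normE p q (A : 'M[R]_(p, q)) (s : 'rV[R]_q) :
  perm_eq (singular_values A) [seq s 0 i | i <- enum 'I_q] ->
  nuclear_norm A = \sum_i s 0 i.
Proof. by move=> h; rewrite /nuclear_norm (perm_big _ h) /= big_map big_enum. Qed.

(** In the orthonormal basis of the right singular vectors [p_i], [<W, A>] is the sum of the
    [<W p_i, A p_i>], where [|W p_i| <= 1] and [|A p_i| = s_i]. *)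
Lemma mxdot_contraction_le p q (W A : 'M[R]_(p, q)) : contraction W ->
  mxdot W A <= nuclear_norm A.
Proof.
move=> Wc; have [P [s [PP s0 AE /nuclear_normE->]]] := singular_valuesP A.
have PtP : P^T *m P = 1%:M by exact: mulmx1C.
have -> : mxdot W A = mxdot (W *m P^T) (A *m P^T).
  by rewrite mxdot_mulr trmxK -mulmxA PtP mulmx1.
rewrite mxdot_cols; apply: ler_sum => i _.
apply: le_trans (mxdot_le _ _) _; rewrite -[leRHS]mul1r; apply: ler_pM; rewrite ?frob_ge0 //.
  apply: frob_sqr_le => //; rewrite expr1n colE -mulmxA -colE -tr_row.
  apply: le_trans (Wc (row i P)) _.
  by rewrite -mxdot_tr tr_row mxdot_colE trmxK PP mxE eqxx.
apply: frob_sqr_le => //; rewrite mxdot_colE trmx_mul trmxK mulmxA -(mulmxA P) AE.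
by rewrite !mulmxA PP mul1mx -mulmxA PP mulmx1 !mxE eqxx.
Qed.

Lemma mxdot_orthodiag n (P : 'M[R]_n) (a : 'rV[R]_n) (y : 'rV[R]_n) :
  mxdot y^T (P^T *m diag_mx a *m P *m y^T) = \sum_i a 0 i * (P *m y^T) i 0 ^+ 2.
Proof.
rewrite -!mulmxA -mxdot_mull mul_diag_mx mxdotE; apply: eq_bigr => i _.
by rewrite big_ord1 !mxE; ring.
Qed.

Lemma mxdot_ortho n (P : 'M[R]_n) (y : 'rV[R]_n) : P *m P^T = 1%:M ->
  mxdot y y = \sum_i (P *m y^T) i 0 ^+ 2.
Proof.
move=> /mulmx1C PtP; rewrite -[LHS]mxdot_tr -[X in mxdot _ X]mul1mx -PtP -mulmxA -mxdot_mull.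
by rewrite mxdotE; apply: eq_bigr => i _; rewrite big_ord1 expr2.
Qed.

Lemma orthodiag_mul n (P : 'M[R]_n) (a b : 'rV[R]_n) : P *m P^T = 1%:M ->
  P^T *m diag_mx a *m P *m (P^T *m diag_mx b *m P) =
  P^T *m diag_mx (\row_i (a 0 i * b 0 i)) *m P.
Proof.
by move=> PP; rewrite !mulmxA -(mulmxA _ P) PP mulmx1 -(mulmxA P^T) mulmx_diag.
Qed.

(** The maximizer is the partial isometry of the polar decomposition: [K] is the pseudo-inverse of
    the square root of [A^T A], and [W = A K]. *)
Lemma nuclear_norm_attained p q (A : 'M[R]_(p, q)) :
  exists2 W, contraction W & mxdot W A = nuclear_norm A.
Proof.
have [P [s [PP s0 AE /nuclear_normE->]]] := singular_valuesP A.
(* [0^-1 = 0], so the null singular values are discarded. *)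
pose K := P^T *m diag_mx (\row_i (s 0 i)^-1) *m P.
have KT : K^T = K by rewrite /K !trmx_mul trmxK tr_diag_mx mulmxA.
have KKA a b : P^T *m diag_mx a *m P *m (P^T *m diag_mx b *m P) =
  P^T *m diag_mx (\row_i (a 0 i * b 0 i)) *m P by exact: orthodiag_mul.
exists (A *m K).
  move=> y; rewrite -mulmxA mxdot_mull mxdot_mull.
  have -> : K^T *m (A^T *m (A *m (K *m y^T))) = K *m (A^T *m A) *m K *m y^T.
    by rewrite KT !mulmxA.
  rewrite AE /K !KKA mxdot_orthodiag (mxdot_ortho y PP); apply: ler_sum => i _.
  rewrite -[leRHS]mul1r ler_wpM2r ?sqr_ge0 // !mxE.
  have [->|si] := eqVneq (s 0 i) 0; first by rewrite invr0 mulr0.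
  by rewrite expr2 mulKf // divff.
rewrite mxdot_mull AE /mxdot KT /K KKA mxtrace_mulC mulmxA PP mul1mx mxtrace_diag.
apply: eq_bigr => i _; rewrite !mxE.
have [->|si] := eqVneq (s 0 i) 0; first by rewrite invr0 mul0r.
by rewrite expr2 mulKf.
Qed.

Lemma spectral_norm_ge0 p q (A : 'M[R]_(p, q)) : 0 <= spectral_norm A.
Proof. by rewrite /spectral_norm; elim/big_rec : _ => // s x _ x0; rewrite le_max x0 orbT. Qed.

Lemma mulmx_spectral_le p q (A : 'M[R]_(p, q)) (y : 'rV[R]_q) :
  mxdot (A *m y^T) (A *m y^T) <= spectral_norm A ^+ 2 * mxdot y y.
Proof.
have [P [s [PP s0 AE sE]]] := singular_valuesP A.
rewrite mxdot_mull mulmxA AE mxdot_orthodiag (mxdot_ortho y PP) mulr_sumr.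
apply: ler_sum => i _; rewrite ler_wpM2r ?sqr_ge0 // mxE.
rewrite ler_pXn2r ?nnegrE ?spectral_norm_ge0 //.
have : s 0 i \in singular_values A.
  by rewrite (perm_mem sE) map_f // mem_enum.
rewrite /spectral_norm; elim: (singular_values A) => // x l IH.
rewrite inE big_cons le_max => /predU1P[->|/IH->]; first by rewrite lexx.
by rewrite orbT.
Qed.

Lemma spectral_norm_le_frob p q (A : 'M[R]_(p, q)) : spectral_norm A <= frob_norm A.
Proof.
have [P [s [PP s0 AE sE]]] := singular_valuesP A.
have sf i : s 0 i <= frob_norm A.
  rewrite -(@ler_pXn2r _ 2) ?nnegrE ?frob_ge0 // sqr_frob /mxdot AE.
  rewrite mxtrace_mulC mulmxA PP mul1mx mxtrace_diag (bigD1 i) //= mxE lerDl.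
  by apply: sumr_ge0 => j _; rewrite mxE sqr_ge0.
rewrite /spectral_norm (eq_bigr (fun x => x)) //.
have : {in singular_values A, forall x, x <= frob_norm A}.
  by move=> x; rewrite (perm_mem sE) => /mapP[i _ ->].
elim: (singular_values A) => [_|x l IH H]; first by rewrite big_nil frob_ge0.
rewrite big_cons ge_max H ?mem_head // IH // => y yl.
by apply: H; rewrite inE yl orbT.
Qed.

Lemma frob_mul_spectral_le m p q (U : 'M[R]_(m, q)) (A : 'M[R]_(p, q)) :
  frob_norm (U *m A^T) <= frob_norm U * spectral_norm A.
Proof.
apply: frob_sqr_le; first by rewrite mulr_ge0 ?frob_ge0 ?spectral_norm_ge0.
rewrite exprMn sqr_frob -mxdot_tr trmx_mul trmxK mxdot_cols -(mxdot_tr U) mxdot_cols mulr_suml.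
apply: ler_sum => i _; rewrite colE -mulmxA -colE -tr_row mulrC mxdot_tr.
exact: mulmx_spectral_le.
Qed.

(** By [|A B|^2 = <A, (A B) B^T> <= |A| |A B| |B|_2], which avoids comparing the spectral norms of
    [B] and [B^T]. *)
Lemma frob_mulmx_spectral_le p q r (A : 'M[R]_(r, p)) (B : 'M[R]_(p, q)) :
  frob_norm (A *m B) <= frob_norm A * spectral_norm B.
Proof.
have [->|p0] := eqVneq (frob_norm (A *m B)) 0.
  by rewrite mulr_ge0 ?frob_ge0 ?spectral_norm_ge0.
have pp : 0 < frob_norm (A *m B) by rewrite lt_neqAle eq_sym p0 frob_ge0.
rewrite -(ler_pM2l pp) -expr2 sqr_frob mxdot_mulr.
apply: le_trans (mxdot_le _ _) _; rewrite mulrCA ler_wpM2l ?frob_ge0 //.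
exact: frob_mul_spectral_le.
Qed.

Lemma frobM_le m p q (U : 'M[R]_(m, q)) (B : 'M[R]_(q, p)) :
  frob_norm (U *m B) <= frob_norm U * frob_norm B.
Proof.
rewrite -[B in U *m B]trmxK -(frob_tr B); apply: le_trans (frob_mul_spectral_le _ _) _.
by rewrite ler_wpM2l ?frob_ge0 // spectral_norm_le_frob.
Qed.

Lemma spectral_norm0 p q : spectral_norm (0 : 'M[R]_(p, q)) = 0.
Proof.
by apply/eqP; rewrite eq_le spectral_norm_ge0 andbT -(@frob0 R p q) spectral_norm_le_frob.
Qed.

(** Each column [W e_i] has length at most 1. The bound serves both the [W] block of the slices and
    the Lipschitz constant of the nuclear norm. *)
Lemma contraction_frob p q (W : 'M[R]_(p, q)) : contraction W -> mxdot W W <= q%:R.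
Proof.
move=> Wc; rewrite mxdot_cols -[q in leRHS]card_ord -sumr_const.
apply: ler_sum => i _; rewrite colE -trmx_delta; apply: le_trans (Wc _) _.
by rewrite /mxdot trmx_delta mul_delta_mx /mxtrace (bigD1 i) //= mxE eqxx big1 ?addr0 //
  => j ji; rewrite mxE (negPf ji).
Qed.

Lemma contraction0 p q : contraction (0 : 'M[R]_(p, q)).
Proof. by move=> y; rewrite mul0mx mxdot0l mxdot_ge0. Qed.

Lemma nuclear_norm_ge0 p q (A : 'M[R]_(p, q)) : 0 <= nuclear_norm A.
Proof. by rewrite -(mxdot0l A); apply/mxdot_contraction_le/contraction0. Qed.

Lemma nuclear_norm0 p q : nuclear_norm (0 : 'M[R]_(p, q)) = 0.
Proof. by have [W _ <-] := nuclear_norm_attained (0 : 'M[R]_(p, q)); rewrite mxdot0r. Qed.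

(** [A] divided by its Frobenius norm is a contraction to test against. *)
Lemma frob_le_nuclear p q (A : 'M[R]_(p, q)) : frob_norm A <= nuclear_norm A.
Proof.
have [A0|A0] := eqVneq (frob_norm A) 0; first by rewrite A0 nuclear_norm_ge0.
have hc : contraction ((frob_norm A)^-1 *: A).
  move=> y; rewrite -scalemxAl mxdotZl mxdotZr mulrA -expr2.
  rewrite -sqr_frob exprVn -ler_pdivlMl ?invr_gt0 ?exprn_gt0 ?lt_neqAle 1?eq_sym ?A0 ?frob_ge0 //.
  by rewrite invrK -(sqr_frob y) -exprMn -(frob_tr y) ler_pXn2r ?nnegrE ?mulr_ge0 ?frob_ge0 // frobM_le.
apply: le_trans (mxdot_contraction_le _ hc).
by rewrite mxdotZl -sqr_frob expr2 mulKf.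
Qed.

Lemma nuclear_norm_convex p q (A B : 'M[R]_(p, q)) (t : R) : 0 <= t -> t <= 1 ->
  nuclear_norm (A + t *: (B - A)) <= (1 - t) * nuclear_norm A + t * nuclear_norm B.
Proof.
move=> t0 t1; have [W Wc <-] := nuclear_norm_attained (A + t *: (B - A)).
have -> : A + t *: (B - A) = (1 - t) *: A + t *: B.
  by rewrite scalerBr scalerBl scale1r addrCA addrC addrAC.
rewrite mxdotDr !mxdotZr lerD // ler_wpM2l ?subr_ge0 ?mxdot_contraction_le //.
Qed.

Lemma nuclear_norm_lip p q (A B : 'M[R]_(p, q)) :
  nuclear_norm A <= nuclear_norm B + Num.sqrt q%:R * frob_norm (A - B).
Proof.
have [W Wc <-] := nuclear_norm_attained A.
rewrite -[A in mxdot W A](subrK B) addrC mxdotDr lerD ?mxdot_contraction_le //.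
apply: le_trans (mxdot_le _ _) _; rewrite ler_wpM2r ?frob_ge0 //.
apply: frob_sqr_le; first exact: sqrtr_ge0.
by rewrite sqr_sqrtr ?ler0n // contraction_frob.
Qed.

End SingularValues.

(** * The data-fitting term *)

Section Fit.
Variables (R : realType) (m n d : nat) (D : 'M[R]_(m, n)) (Omega : {set 'I_m * 'I_n}).
Implicit Types (A B : 'M[R]_(m, n)) (U : 'M[R]_(m, d)) (V : 'M[R]_(n, d)).

Lemma proj_maskD A B : proj_mask Omega (A + B) = proj_mask Omega A + proj_mask Omega B.
Proof. by apply/matrixP => i j; rewrite !mxE; case: ifP => _ //; rewrite addr0. Qed.

Lemma proj_maskZ c A : proj_mask Omega (c *: A) = c *: proj_mask Omega A.
Proof. by apply/matrixP => i j; rewrite !mxE; case: ifP => _ //; rewrite mulr0. Qed.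

Lemma proj_maskB A B : proj_mask Omega (A - B) = proj_mask Omega A - proj_mask Omega B.
Proof. by rewrite -scaleN1r proj_maskD proj_maskZ scaleN1r. Qed.

Lemma mxdot_proj_mask A B :
  mxdot (proj_mask Omega A) (proj_mask Omega B) = mxdot (proj_mask Omega A) B.
Proof.
rewrite !mxdotE; do 2!apply: eq_bigr => ? _; rewrite !mxE.
by case: ifP => //; rewrite !mul0r.
Qed.

Lemma frob_proj_mask A : frob_norm (proj_mask Omega A) <= frob_norm A.
Proof.
have [->|p0] := eqVneq (frob_norm (proj_mask Omega A)) 0; first exact: frob_ge0.
have pp : 0 < frob_norm (proj_mask Omega A) by rewrite lt_neqAle eq_sym p0 frob_ge0.
by rewrite -(ler_pM2l pp) -expr2 sqr_frob mxdot_proj_mask mxdot_le.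
Qed.

Definition resid U V := proj_mask Omega (U *m V^T) - proj_mask Omega D.

Lemma residE U V : resid U V = proj_mask Omega (U *m V^T - D).
Proof. by rewrite proj_maskB. Qed.

Lemma fitE U V : fit D Omega U V = 2^-1 * mxdot (resid U V) (resid U V).
Proof. by rewrite /fit sqr_frob. Qed.

Lemma fit_ge0 U V : 0 <= fit D Omega U V.
Proof. by rewrite fitE mulr_ge0 ?mxdot_ge0. Qed.

Lemma resid_shift U V (A : 'M[R]_(m, d)) (B : 'M[R]_(n, d)) : resid (U + A) (V + B) = resid U V +
  proj_mask Omega (A *m V^T + U *m B^T + A *m B^T).
Proof.
rewrite !residE -proj_maskD; congr proj_mask.
rewrite linearD /= mulmxDl !mulmxDr.
by apply/matrixP => i j; rewrite !mxE; ring.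
Qed.

Lemma mxdot_resid_proj U V A : mxdot (resid U V) (proj_mask Omega A) = mxdot (resid U V) A.
Proof. by rewrite residE mxdot_proj_mask. Qed.

(** An exact expansion, source of both partial gradients, of the descent estimate and of weak
    convexity. Beyond the linear part and a square there is only the bilinear term [<R, A B^T>], the
    one obstruction to convexity. *)
Lemma fit_expand U V (A : 'M[R]_(m, d)) (B : 'M[R]_(n, d)) : fit D Omega (U + A) (V + B) =
  fit D Omega U V + mxdot (resid U V *m V) A + mxdot ((resid U V)^T *m U) B
  + mxdot (resid U V) (A *m B^T)
  + 2^-1 * frob_norm (proj_mask Omega (A *m V^T + U *m B^T + A *m B^T)) ^+ 2.
Proof.
have rQ : mxdot (resid U V) (proj_mask Omega (A *m V^T + U *m B^T + A *m B^T)) =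
    mxdot (resid U V *m V) A + mxdot ((resid U V)^T *m U) B + mxdot (resid U V) (A *m B^T).
  rewrite mxdot_resid_proj; move: (resid U V) => r; rewrite !mxdotDr.
  rewrite mxdot_mulr mxdot_mull trmxK -[mxdot r (U *m _)]mxdotC mxdot_mulr trmxK.
  by rewrite (mxdotC U).
rewrite !fitE sqr_frob resid_shift; move: rQ; set Q := proj_mask Omega (_ + _).
move: Q (resid U V) => Q r rQ.
by rewrite mxdotDl !mxdotDr (mxdotC Q r) rQ; lra.
Qed.

Lemma fit_lower U V (A : 'M[R]_(m, d)) (B : 'M[R]_(n, d)) : fit D Omega U V + mxdot (resid U V *m V) A +
  mxdot ((resid U V)^T *m U) B - frob_norm (resid U V) * (frob_norm A * frob_norm B)
  <= fit D Omega (U + A) (V + B).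
Proof.
rewrite fit_expand; set Q := frob_norm (proj_mask _ _).
have h : - (frob_norm (resid U V) * (frob_norm A * frob_norm B)) <= mxdot (resid U V) (A *m B^T).
  rewrite lerNl -mxdotNl; apply: le_trans (mxdot_le _ _) _.
  by rewrite frobN ler_wpM2l ?frob_ge0 // -(frob_tr B) frobM_le.
by have := sqr_ge0 Q; lra.
Qed.

Lemma derive_quadratic p q (f : 'M[R]_(p, q) -> R) (a v : 'M[R]_(p, q)) (b c : R) :
  (forall h, f (a + h *: v) = f a + h * b + h ^+ 2 * c) -> 'D_v f a = b.
Proof.
move=> H; apply/cvg_lim => //.
apply: (@cvg_trans _ ((fun h : R => b + h * c) @ 0^')).
  apply: near_eq_cvg; near=> h.
  have h0 : h != 0 by near: h; exact: nbhs_dnbhs_neq.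
  by rewrite /= [h *: v + a]addrC H /GRing.scale /=; field.
have h0 : (h : R) @[h --> 0^'] --> (0 : R) by exact: nbhs_dnbhs.
have := cvgD (cvg_cst (F := (0 : R)^') b) (cvgM h0 (cvg_cst (F := (0 : R)^') c)).
by rewrite mul0r addr0; apply.
Unshelve. all: by end_near. Qed.

Lemma mxdot_delta p q (A : 'M[R]_(p, q)) i j : mxdot A (delta_mx i j) = A i j.
Proof.
rewrite mxdotE (bigD1 i) //= (bigD1 j) //= mxE !eqxx mulr1 !big1 ?addr0 //.
  by move=> k ki; rewrite big1 // => l _; rewrite mxE (negPf ki) mulr0.
by move=> k kj; rewrite mxE (negPf kj) andbF mulr0.
Qed.

Lemma mxgrad_fit_U U V : mxgrad (fun W => fit D Omega W V) U = resid U V *m V.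
Proof.
apply/matrixP => i j; rewrite [LHS]mxE -mxdot_delta.
apply: (derive_quadratic (c := 2^-1 * frob_norm (proj_mask Omega (delta_mx i j *m V^T)) ^+ 2)).
move=> h; rewrite -[V in LHS]addr0 fit_expand !trmx0 !mulmx0 !addr0 !mxdot0r !addr0.
by rewrite mxdotZr -scalemxAl proj_maskZ frobZ exprMn real_normK ?num_real; ring.
Qed.

Lemma mxgrad_fit_V U V : mxgrad (fun W => fit D Omega U W) V = (resid U V)^T *m U.
Proof.
apply/matrixP => i j; rewrite [LHS]mxE -mxdot_delta.
apply: (derive_quadratic (c := 2^-1 * frob_norm (proj_mask Omega (U *m (delta_mx i j)^T)) ^+ 2)).
move=> h; rewrite -[U in LHS]addr0 fit_expand !mul0mx !addr0 !mxdot0r !addr0 add0r.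
by rewrite linearZ /= mxdotZr -scalemxAr proj_maskZ frobZ exprMn real_normK ?num_real; ring.
Qed.

Lemma resid_frob_le U V : frob_norm (resid U V) <= frob_norm U * frob_norm V + frob_norm D.
Proof.
rewrite residE; apply: le_trans (frob_proj_mask _) _; apply: le_trans (frobB_le _ _) _.
by rewrite lerD2r -(frob_tr V) frobM_le.
Qed.

Lemma mulmx_sub_split p q r (A A' : 'M[R]_(p, q)) (B B' : 'M[R]_(q, r)) :
  A *m B - A' *m B' = (A - A') *m B + A' *m (B - B').
Proof. by rewrite mulmxBl mulmxBr addrA subrK. Qed.

Lemma resid_lip (M : R) U V U' V' : 0 <= M -> frob_norm V <= M -> frob_norm U' <= M ->
  frob_norm (resid U V - resid U' V') <= M * (frob_norm (U - U') + frob_norm (V - V')).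
Proof.
move=> M0 VM UM; rewrite !residE -proj_maskB; apply: le_trans (frob_proj_mask _) _.
have -> : U *m V^T - D - (U' *m V'^T - D) = (U - U') *m V^T + U' *m (V - V')^T.
  rewrite [(V - V')^T]linearB /= [(U - U') *m _]mulmxBl [U' *m (_ - _)]mulmxBr.
  by apply/matrixP => i j; rewrite !mxE; ring.
apply: le_trans (frobD_le _ _) _; rewrite mulrDr; apply: lerD.
  apply: le_trans (frobM_le _ _) _; rewrite mulrC frob_tr.
  by rewrite ler_wpM2r ?frob_ge0.
apply: le_trans (frobM_le _ _) _; rewrite frob_tr.
by rewrite ler_wpM2r ?frob_ge0.
Qed.

(** One [M ^+ 2] comes from the variation of the residual, at rate [M], times a factor bounded by
    [M]; the rest is the bound [M^2 + |D|] of the residual times the variation of that factor. *)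
Lemma grad_U_lip (M : R) U V U' V' : 0 <= M -> frob_norm U <= M ->
  frob_norm V <= M -> frob_norm U' <= M -> frob_norm V' <= M ->
  frob_norm (resid U V *m V - resid U' V' *m V') <=
  (2 * M ^+ 2 + frob_norm D) * (frob_norm (U - U') + frob_norm (V - V')).
Proof.
move=> M0 UM VM UM' VM'.
rewrite mulmx_sub_split; apply: le_trans (frobD_le _ _) _.
have h1 := le_trans (frobM_le (resid U V - resid U' V') V)
  (ler_pM (frob_ge0 _) (frob_ge0 _) (resid_lip U V' M0 VM UM') VM).
have h2 : frob_norm (resid U' V' *m (V - V')) <= (M ^+ 2 + frob_norm D) * frob_norm (V - V').
  apply: le_trans (frobM_le _ _) _; rewrite ler_wpM2r ?frob_ge0 //.
  apply: le_trans (resid_frob_le _ _) _; rewrite lerD2r expr2.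
  by rewrite ler_pM ?frob_ge0.
apply: le_trans (lerD h1 h2) _.
have := frob_ge0 (U - U'); have := frob_ge0 (V - V'); have := frob_ge0 D.
have := sqr_ge0 M; nra.
Qed.

Lemma grad_V_lip (M : R) U V U' V' : 0 <= M -> frob_norm U <= M ->
  frob_norm V <= M -> frob_norm U' <= M -> frob_norm V' <= M ->
  frob_norm ((resid U V)^T *m U - (resid U' V')^T *m U') <=
  (2 * M ^+ 2 + frob_norm D) * (frob_norm (U - U') + frob_norm (V - V')).
Proof.
move=> M0 UM VM UM' VM'.
rewrite mulmx_sub_split -linearB; apply: le_trans (frobD_le _ _) _.
have := le_trans (frobM_le (resid U V - resid U' V')^T U)
  (ler_pM (frob_ge0 _) (frob_ge0 _) _ UM).
rewrite frob_tr => /(_ _ (resid_lip U V' M0 VM UM')) h1.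
have h2 : frob_norm ((resid U' V')^T *m (U - U')) <= (M ^+ 2 + frob_norm D) * frob_norm (U - U').
  apply: le_trans (frobM_le _ _) _; rewrite ler_wpM2r ?frob_ge0 // frob_tr.
  apply: le_trans (resid_frob_le _ _) _; rewrite lerD2r expr2.
  by rewrite ler_pM ?frob_ge0.
apply: le_trans (lerD h1 h2) _.
have := frob_ge0 (U - U'); have := frob_ge0 (V - V'); have := frob_ge0 D.
have := sqr_ge0 M; nra.
Qed.

End Fit.

(** * One step of the iteration *)

Section PalmStep.
Variable R : realType.

(** Replaces the limit [t -> 0] in first-order optimality arguments. *)
Lemma ge0_of_linear_perturbation (E K : R) :
  (forall t, 0 < t -> t <= 1 -> 0 <= E + t * K) -> 0 <= E.
Proof.
move=> H; rewrite leNgt; apply/negP => E0.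
have [K0|K0] := leP K 0; first by have := H 1 ltr01 (lexx _); nra.
pose t := Num.min 1 (- E / (2 * K)).
have EK : 0 < - E / (2 * K) by rewrite divr_gt0 ?oppr_gt0 // mulr_gt0.
have t0 : 0 < t by rewrite lt_min ltr01.
have t1 : t <= 1 by rewrite ge_min lexx.
have tK : t * K <= - E / 2.
  have -> : - E / 2 = - E / (2 * K) * K by field; rewrite gt_eqF.
  by rewrite ler_wpM2r ?(ltW K0) // ge_min lexx orbT.
by have := H t t0 t1; lra.
Qed.

(** Compare [x] with [x + t (y - x)], use the convexity of [phi], divide by [t] and let [t] tend to
    0: minus the gradient of the smooth part is a subgradient of [phi] at [x]. *)
Lemma prox_subgradient p q (phi : 'M[R]_(p, q) -> R) (G a x : 'M[R]_(p, q)) (l c : R) :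
  (forall A B t, 0 <= t -> t <= 1 ->
     phi (A + t *: (B - A)) <= (1 - t) * phi A + t * phi B) ->
  (forall y, phi x + c + mxdot G (x - a) + l / 2 * frob_norm (x - a) ^+ 2 <=
             phi y + c + mxdot G (y - a) + l / 2 * frob_norm (y - a) ^+ 2) ->
  forall y, phi x - mxdot (G + l *: (x - a)) (y - x) <= phi y.
Proof.
move=> cvx xmin y; rewrite lerBlDl -subr_ge0.
apply: (@ge0_of_linear_perturbation _ (l / 2 * mxdot (y - x) (y - x))) => t t0 t1.
rewrite -(pmulr_rge0 _ t0).
have h1 := cvx x y t (ltW t0) t1.
have := xmin (x + t *: (y - x)).
have -> : x + t *: (y - x) - a = (x - a) + t *: (y - x) by rewrite addrAC.
rewrite !sqr_frob; move: (y - x) (x - a) h1 => h b h1.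
rewrite !mxdotDl !mxdotDr !mxdotZl !mxdotZr (mxdotC h b); lra.
Qed.

Lemma nuclear_norm_rank1 p q (x : 'cV[R]_p) (y : 'rV[R]_q) :
  nuclear_norm (x *m y) <= frob_norm x * frob_norm y.
Proof.
have [W Wc <-] := nuclear_norm_attained (x *m y).
rewrite mxdotC mxdot_mulr mulrC mulrC; apply: le_trans (mxdot_le _ _) _.
rewrite ler_wpM2l ?frob_ge0 //; apply: frob_sqr_le; first exact: frob_ge0.
by rewrite sqr_frob.
Qed.

(** Testing at [2 U] and at 0 gives [<W, U> = |U|_*], so [<W, Y> <= |Y|_*] for all [Y]. The rank-one
    choice [Y = (W y^T) y] then yields [|W y^T|^2 <= |W y^T| |y|]. *)
Lemma nuclear_subgradient p q (W U : 'M[R]_(p, q)) :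
  (forall Y, nuclear_norm U + mxdot W (Y - U) <= nuclear_norm Y) ->
  contraction W /\ mxdot W U = nuclear_norm U.
Proof.
move=> H.
have WU : mxdot W U = nuclear_norm U.
  apply/eqP; rewrite eq_le; apply/andP; split.
    have := H (U + U); rewrite addrK => h.
    have : nuclear_norm (U + U) <= nuclear_norm U + nuclear_norm U.
      have [W' W'c <-] := nuclear_norm_attained (U + U).
      by rewrite mxdotDr lerD // mxdot_contraction_le.
    by move: h; lra.
  by have := H 0; rewrite sub0r mxdotNr nuclear_norm0; lra.
have WY Y : mxdot W Y <= nuclear_norm Y.
  by have := H Y; rewrite mxdotBr WU; lra.
split=> // y; set x := W *m y^T.
have := le_trans (WY (x *m y)) (nuclear_norm_rank1 x y).
rewrite mxdotC mxdot_mulr -/x -(sqr_frob x) -(sqr_frob y) => h.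
have [x0|x0] := eqVneq (frob_norm x) 0; first by rewrite x0 expr0n sqr_ge0.
have xp : 0 < frob_norm x by rewrite lt_neqAle eq_sym x0 frob_ge0.
by rewrite ler_pXn2r ?nnegrE ?frob_ge0 // -(ler_pM2l xp) -expr2.
Qed.

Lemma frob_sqr_convex p q (c : R) (A B : 'M[R]_(p, q)) t : 0 <= c -> 0 <= t -> t <= 1 ->
  c * frob_norm (A + t *: (B - A)) ^+ 2 <=
  (1 - t) * (c * frob_norm A ^+ 2) + t * (c * frob_norm B ^+ 2).
Proof.
move=> c0 t0 t1; rewrite !sqr_frob mulrCA [t * _]mulrCA -mulrDr ler_wpM2l //.
have t1t : 0 <= t * (1 - t) by rewrite mulr_ge0 // subr_ge0.
have := mulr_ge0 t1t (mxdot_ge0 (B - A)).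
rewrite !(mxdotDl, mxdotDr, mxdotZl, mxdotZr, mxdotNl, mxdotNr) (mxdotC B A).
by move: (mxdot A A) (mxdot A B) (mxdot B B) => a b e; lra.
Qed.

Variables (m n d : nat) (D : 'M[R]_(m, n)) (Omega : {set 'I_m * 'I_n}) (lambda : R).

Lemma palm_U_opt (Uk U1 : 'M[R]_(m, d)) (Vk : 'M[R]_(n, d)) :
  0 < lambda -> is_argmin (palm_U_model D Omega lambda Uk Vk) U1 ->
  forall Y, 2 * lambda / 3 * nuclear_norm U1
    - mxdot (resid D Omega Uk Vk *m Vk + spectral_norm Vk ^+ 2 *: (U1 - Uk)) (Y - U1)
    <= 2 * lambda / 3 * nuclear_norm Y.
Proof.
move=> lambda0 amin; have l0 : 0 <= 2 * lambda / 3 by lra.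
apply: (@prox_subgradient _ _ (fun Y => 2 * lambda / 3 * nuclear_norm Y) _ _ _ _
   (fit D Omega Uk Vk)).
  move=> A B t t0 t1; rewrite mulrCA [t * _]mulrCA -mulrDr ler_wpM2l //.
  exact: nuclear_norm_convex.
by move=> y; have := amin y; rewrite /palm_U_model mxgrad_fit_U.
Qed.

(** The left-hand side [T] is the gradient of the model at its minimizer; testing along [- T] forces
    [|T|^2 <= 0]. *)
Lemma palm_V_opt (Vk V1 : 'M[R]_(n, d)) (U1 : 'M[R]_(m, d)) :
  0 < lambda -> is_argmin (palm_V_model D Omega lambda U1 Vk) V1 ->
  (2 * lambda / 3) *: V1 + (resid D Omega U1 Vk)^T *m U1
    + spectral_norm U1 ^+ 2 *: (V1 - Vk) = 0.
Proof.
move=> lambda0 amin; have l0 : 0 <= lambda / 3 by lra.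
have cvx : forall (A B : 'M[R]_(n, d)) t, 0 <= t -> t <= 1 ->
    lambda / 3 * frob_norm (A + t *: (B - A)) ^+ 2 <=
    (1 - t) * (lambda / 3 * frob_norm A ^+ 2) + t * (lambda / 3 * frob_norm B ^+ 2).
  by move=> A B t; exact: frob_sqr_convex.
rewrite -addrA; set G := _ + spectral_norm U1 ^+ 2 *: _.
have H : forall Y, lambda / 3 * frob_norm V1 ^+ 2 - mxdot G (Y - V1) <=
    lambda / 3 * frob_norm Y ^+ 2.
  apply: (@prox_subgradient _ _ (fun Y : 'M[R]_(n, d) => lambda / 3 * frob_norm Y ^+ 2)
    _ _ _ _ (fit D Omega U1 Vk) cvx) => y.
  by have := amin y; rewrite /palm_V_model mxgrad_fit_V.
set T := _ + G; apply: mxdot_eq0; apply/eqP; rewrite eq_le mxdot_ge0 andbT -oppr_ge0.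
apply: (@ge0_of_linear_perturbation _ (lambda / 3 * mxdot T T)) => t t0 t1.
rewrite -(pmulr_rge0 _ t0).
have := H (V1 - t *: T); rewrite [_ - V1]addrAC subrr add0r !sqr_frob.
have -> : G = T - (2 * lambda / 3) *: V1 by rewrite /T addrAC subrr add0r.
clearbody T; rewrite !(mxdotDl, mxdotDr, mxdotZl, mxdotZr, mxdotNl, mxdotNr) (mxdotC T V1).
move: (mxdot V1 V1) (mxdot V1 T) (mxdot T T) => a b e; lra.
Qed.

(** In the [U] step, optimality yields [|V_k|_2^2 |U_(k+1) - U_k|^2], and the quadratic remainder of
    the fit costs at most half of it. In the [V] step, [lambda / 3] is the gain from the strong
    convexity of the ridge term; the gain from the proximal term is discarded. *)
Lemma palm_descent (Uk U1 : 'M[R]_(m, d)) (Vk V1 : 'M[R]_(n, d)) :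
  0 < lambda -> is_argmin (palm_U_model D Omega lambda Uk Vk) U1 ->
  is_argmin (palm_V_model D Omega lambda U1 Vk) V1 ->
  spectral_norm Vk ^+ 2 / 2 * frob_norm (U1 - Uk) ^+ 2 + lambda / 3 * frob_norm (V1 - Vk) ^+ 2
  <= objective D Omega lambda (Uk, Vk) - objective D Omega lambda (U1, V1).
Proof.
move=> l0 /(palm_U_opt l0)/(_ Uk) hU /(palm_V_opt l0) hV; rewrite /objective /=.
have fU := fit_expand D Omega Uk Vk (U1 - Uk) 0.
have fV := fit_expand D Omega U1 Vk 0 (V1 - Vk).
rewrite addrCA subrr !addr0 trmx0 !mulmx0 mxdot0r !addr0 mxdot0r addr0 in fU.
rewrite [Vk + _]addrCA subrr !addr0 !mul0mx mxdot0r !addr0 add0r mxdot0r addr0 in fV.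
have qU : frob_norm (proj_mask Omega ((U1 - Uk) *m Vk^T)) ^+ 2 <=
    frob_norm (U1 - Uk) ^+ 2 * spectral_norm Vk ^+ 2.
  rewrite -exprMn ler_pXn2r ?nnegrE ?mulr_ge0 ?frob_ge0 ?spectral_norm_ge0 //.
  exact: le_trans (frob_proj_mask _ _) (frob_mul_spectral_le _ _).
have qV : frob_norm (proj_mask Omega (U1 *m (V1 - Vk)^T)) ^+ 2 <=
    frob_norm (V1 - Vk) ^+ 2 * spectral_norm U1 ^+ 2.
  rewrite -exprMn ler_pXn2r ?nnegrE ?mulr_ge0 ?frob_ge0 ?spectral_norm_ge0 //.
  apply: le_trans (frob_proj_mask _ _) _.
  by rewrite -frob_tr trmx_mul trmxK frob_mul_spectral_le.
have VkE : frob_norm Vk ^+ 2 = frob_norm V1 ^+ 2 - 2 * mxdot V1 (V1 - Vk) + frob_norm (V1 - Vk) ^+ 2.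
  rewrite !sqr_frob !(mxdotDl, mxdotDr, mxdotNl, mxdotNr) (mxdotC Vk V1).
  by move: (mxdot V1 V1) (mxdot V1 Vk) (mxdot Vk Vk) => a b c; lra.
have hV' : 2 * lambda / 3 * mxdot V1 (V1 - Vk) + mxdot ((resid D Omega U1 Vk)^T *m U1) (V1 - Vk)
   + spectral_norm U1 ^+ 2 * frob_norm (V1 - Vk) ^+ 2 = 0.
  by rewrite sqr_frob -!mxdotZl -!mxdotDl hV mxdot0l.
rewrite -[Uk - U1]opprB mxdotNr mxdotDl mxdotZl -sqr_frob opprK in hU.
have := mulr_ge0 (sqr_ge0 (frob_norm (V1 - Vk))) (sqr_ge0 (spectral_norm U1)).
move: (frob_norm (V1 - Vk) ^+ 2) (spectral_norm U1 ^+ 2) qU qV VkE hV' hU fU fV.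
move: (spectral_norm Vk ^+ 2) (frob_norm (U1 - Uk) ^+ 2) (mxdot _ (U1 - Uk)) (mxdot V1 _).
move: (frob_norm Vk ^+ 2) (frob_norm V1 ^+ 2) (nuclear_norm Uk) (nuclear_norm U1).
move: (fit _ _ _ _) (fit _ _ _ _) (fit _ _ _ _) (mxdot _ _).
move: (frob_norm _ ^+ 2) (frob_norm _ ^+ 2) => *; nra.
Qed.

End PalmStep.

(** * The slices of the Kurdyka-Lojasiewicz argument *)

Definition mpolyf (R : realType) (T : Type) (vs : seq (T -> R)) (p q : nat)
    (M : T -> 'M[R]_(p, q)) :=
  forall i j, polyf vs (fun t => M t i j).

(** * Matrices with polynomial entries *)

Section MatrixPolyf.
Variables (R : realType) (T : Type) (vs : seq (T -> R)).

Lemma mpolyf_cst p q (A : 'M[R]_(p, q)) : mpolyf vs (fun=> A).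
Proof. by move=> i j; exact: polyf_cst. Qed.

Lemma mpolyf_tr p q (M : T -> 'M[R]_(p, q)) : mpolyf vs M -> mpolyf vs (fun t => (M t)^T).
Proof. by move=> hM i j; under eq_fun do rewrite mxE; exact: hM. Qed.

Lemma mpolyf_add p q (M M' : T -> 'M[R]_(p, q)) : mpolyf vs M -> mpolyf vs M' ->
  mpolyf vs (fun t => M t + M' t).
Proof. by move=> hM hM' i j; under eq_fun do rewrite mxE; apply: polyf_add. Qed.

Lemma mpolyf_scale p q c (M : T -> 'M[R]_(p, q)) : mpolyf vs M ->
  mpolyf vs (fun t => c *: M t).
Proof.
move=> hM i j; under eq_fun do rewrite mxE.
by apply: polyf_mul => //; exact: polyf_cst.
Qed.

Lemma mpolyf_opp p q (M : T -> 'M[R]_(p, q)) : mpolyf vs M -> mpolyf vs (fun t => - M t).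
Proof. by move=> hM i j; under eq_fun do rewrite mxE; exact: polyf_opp. Qed.

Lemma mpolyf_mul p q r (M : T -> 'M[R]_(p, q)) (M' : T -> 'M[R]_(q, r)) :
  mpolyf vs M -> mpolyf vs M' -> mpolyf vs (fun t => M t *m M' t).
Proof.
move=> hM hM' i j; under eq_fun do rewrite mxE.
by apply: polyf_sum => k; exact: polyf_mul.
Qed.

Lemma mpolyf_proj_mask m n (Omega : {set 'I_m * 'I_n}) (M : T -> 'M[R]_(m, n)) :
  mpolyf vs M -> mpolyf vs (fun t => proj_mask Omega (M t)).
Proof.
move=> hM i j; have [h|/negbTE h] := boolP ((i, j) \in Omega).
  by under eq_fun do rewrite mxE h; exact: hM.
by under eq_fun do rewrite mxE h; exact: polyf_cst.
Qed.

Lemma polyf_mxdot p q (M M' : T -> 'M[R]_(p, q)) :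
  mpolyf vs M -> mpolyf vs M' -> polyf vs (fun t => mxdot (M t) (M' t)).
Proof.
move=> hM hM'; under eq_fun do rewrite mxdotE.
by apply: polyf_sum => i; apply: polyf_sum => j; exact: polyf_mul.
Qed.

Lemma mpolyf_vec_mx p q (v : T -> 'rV[R]_(p * q)) :
  mpolyf vs v -> mpolyf vs (fun t => vec_mx (v t)).
Proof. by move=> hv i j; under eq_fun do rewrite mxE; exact: hv. Qed.

Lemma mpolyf_lsubmx p q r (v : T -> 'M[R]_(p, q + r)) :
  mpolyf vs v -> mpolyf vs (fun t => lsubmx (v t)).
Proof. by move=> hv i j; under eq_fun do rewrite mxE; exact: hv. Qed.

Lemma mpolyf_rsubmx p q r (v : T -> 'M[R]_(p, q + r)) :
  mpolyf vs v -> mpolyf vs (fun t => rsubmx (v t)).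
Proof. by move=> hv i j; under eq_fun do rewrite mxE; exact: hv. Qed.

Lemma mpolyf_ext_fst N p q (M : T -> 'M[R]_(p, q)) :
  mpolyf vs M -> mpolyf (ext vs N) (fun t => M t.1).
Proof. by move=> hM i j; apply: (@polyf_ext_fst _ _ _ _ (fun t => M t i j)). Qed.

Lemma mpolyf_ext_snd N : mpolyf (ext vs N) (fun t => t.2).
Proof. by move=> i j; rewrite !ord1; exact: polyf_ext_snd. Qed.

End MatrixPolyf.

Arguments mpolyf_cst {R T} vs {p q} A.
Arguments mpolyf_ext_fst {R T vs} N {p q M}.
Arguments mpolyf_ext_snd {R T} vs N.

Lemma semialg_contraction (R : realType) (T : Type) (vs : seq (T -> R)) (p q : nat)
    (M : T -> 'M[R]_(p, q)) :
  mpolyf vs M -> semialg vs (fun t => contraction (M t)).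
Proof.
move=> hM; apply: (@semialg_all _ _ _ _ (fun t : T * 'rV[R]_q =>
  mxdot (M t.1 *m t.2^T) (M t.1 *m t.2^T) <= mxdot t.2 t.2)).
have h2 := mpolyf_ext_snd vs q.
have h1 : mpolyf (ext vs q) (fun t => M t.1 *m t.2^T).
  exact: (mpolyf_mul (mpolyf_ext_fst q hM) (mpolyf_tr h2)).
by apply: semialg_le; exact: polyf_mxdot.
Qed.

Lemma mpolyf_ext_last (R : realType) (T : Type) (vs : seq (T -> R)) (N p q : nat)
    (M : 'rV[R]_N -> 'M[R]_(p, q)) :
  mpolyf (coords R N) M -> mpolyf (ext vs N) (fun t => M t.2).
Proof. by move=> hM i j; exact: (polyf_ext_last vs (hM i j)). Qed.

Arguments mpolyf_ext_last {R T} vs {N p q M}.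

Lemma closed_polyf_le (R : realType) (N : nat) (f g : 'rV[R]_N -> R) :
  polyf (coords R N) f -> polyf (coords R N) g -> closed [set x | f x <= g x].
Proof.
move=> hf hg.
have -> : [set x | f x <= g x] = (fun x => f x - g x) @^-1` [set y | y <= 0].
  by apply/seteqP; split=> x /=; rewrite subr_le0.
apply: closed_comp => [x _|]; last exact: closed_le.
exact: (polyf_continuous (polyf_sub hf hg)).
Qed.

(** * Level slices and weak convexity *)

Section Slices.
Variables (R : realType) (m n d : nat) (D : 'M[R]_(m, n)) (Omega : {set 'I_m * 'I_n}).
Variable lambda : R.

Let N := (m * d + (n * d + m * d))%N.
Implicit Types x y : 'rV[R]_N.

(* A point of ['rV_N] encodes a triple [(U, V, W)], where [W] is a candidate
   subgradient of the nuclear norm at [U]. *)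
Definition partU x : 'M[R]_(m, d) := vec_mx (lsubmx x).
Definition partV x : 'M[R]_(n, d) := vec_mx (lsubmx (rsubmx x)).
Definition partW x : 'M[R]_(m, d) := vec_mx (rsubmx (rsubmx x)).

Definition pack (U : 'M[R]_(m, d)) (V : 'M[R]_(n, d)) (W : 'M[R]_(m, d)) : 'rV[R]_N :=
  row_mx (mxvec U) (row_mx (mxvec V) (mxvec W)).

Lemma partUB x y : partU (x - y) = partU x - partU y.
Proof. by rewrite /partU !linearB. Qed.

Lemma partVB x y : partV (x - y) = partV x - partV y.
Proof. by rewrite /partV !linearB. Qed.

Lemma partU_pack U V W : partU (pack U V W) = U.
Proof. by rewrite /partU row_mxKl mxvecK. Qed.

Lemma partV_pack U V W : partV (pack U V W) = V.
Proof. by rewrite /partV row_mxKr row_mxKl mxvecK. Qed.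

Lemma partW_pack U V W : partW (pack U V W) = W.
Proof. by rewrite /partW !row_mxKr mxvecK. Qed.

Lemma mxdot_parts x y : mxdot x y = mxdot (partU x) (partU y) +
  mxdot (partV x) (partV y) + mxdot (partW x) (partW y).
Proof.
have dot_row p q (u v : 'rV[R]_(p + q)) :
    mxdot u v = mxdot (lsubmx u) (lsubmx v) + mxdot (rsubmx u) (rsubmx v).
  rewrite !mxdotE !big_ord1 big_split_ord /=.
  by congr (_ + _); apply: eq_bigr => j _; rewrite !mxE.
have dot_vec p q (u v : 'rV[R]_(p * q)) : mxdot u v = mxdot (vec_mx u) (vec_mx v).
  rewrite !mxdotE big_ord1 pair_bigA /=.
  rewrite (reindex (uncurry (@mxvec_index p q))) /=; last exact: curry_mxvec_bij.
  by apply: eq_bigr => -[i j] _; rewrite !mxE.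
by rewrite !dot_row !dot_vec addrA.
Qed.

(** The objective with the nuclear norm of [U] replaced by [<W, U>]: a polynomial, equal to the
    objective when [W] attains the maximum. *)
Definition Phi x := lambda * (2 * mxdot (partW x) (partU x) + mxdot (partV x) (partV x)) / 3
  + 2^-1 * mxdot (resid D Omega (partU x) (partV x)) (resid D Omega (partU x) (partV x)).

(** The partial gradients of [Phi] with [W] frozen; they form a subgradient of the objective when
    [W] is one of the nuclear norm at [U]. Their length enters [slope2] squared, to stay
    polynomial. *)
Definition gradPhiU x := (2 * lambda / 3) *: partW x + resid D Omega (partU x) (partV x) *m partV x.
Definition gradPhiV x := (2 * lambda / 3) *: partV x + (resid D Omega (partU x) (partV x))^T *m partU x.

Definition slope2 x := mxdot (gradPhiU x) (gradPhiU x) + mxdot (gradPhiV x) (gradPhiV x).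

(** The two middle clauses say that [W] is a subgradient of the nuclear norm at [U]; the last puts
    the objective at height [p.1] above [Fs]. Competitors are vectorized to fit [semialg_all]. *)
Definition slice (Fs rho : R) (p : R * 'rV[R]_N) :=
  mxdot p.2 p.2 <= rho /\ (contraction (partW p.2) /\
  ((forall w : 'rV[R]_(m * d), contraction (vec_mx w : 'M[R]_(m, d)) ->
      mxdot (vec_mx w) (partU p.2) <= mxdot (partW p.2) (partU p.2)) /\
   Phi p.2 = Fs + p.1)).

Lemma mpolyf_id : mpolyf (coords R N) (fun x => x).
Proof. by move=> i j; rewrite !ord1; exact: polyf_coord. Qed.

Lemma mpolyf_partU : mpolyf (coords R N) partU.
Proof. by apply: mpolyf_vec_mx; apply: mpolyf_lsubmx; exact: mpolyf_id. Qed.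

Lemma mpolyf_partV : mpolyf (coords R N) partV.
Proof.
by apply: mpolyf_vec_mx; apply: mpolyf_lsubmx; apply: mpolyf_rsubmx; exact: mpolyf_id.
Qed.

Lemma mpolyf_partW : mpolyf (coords R N) partW.
Proof.
by apply: mpolyf_vec_mx; apply: mpolyf_rsubmx; apply: mpolyf_rsubmx; exact: mpolyf_id.
Qed.

Lemma mpolyf_resid : mpolyf (coords R N) (fun x => resid D Omega (partU x) (partV x)).
Proof.
apply: mpolyf_add; last by apply: mpolyf_opp; exact: mpolyf_cst.
apply: mpolyf_proj_mask; apply: mpolyf_mul; first exact: mpolyf_partU.
by apply: mpolyf_tr; exact: mpolyf_partV.
Qed.

Lemma polyf_Phi : polyf (coords R N) Phi.
Proof.
have hU := mpolyf_partU; have hV := mpolyf_partV; have hW := mpolyf_partW.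
have hr := mpolyf_resid.
apply: polyf_add; last by apply: polyf_mul (polyf_cst _ _) _; exact: polyf_mxdot.
apply: polyf_mul; last exact: polyf_cst.
apply: polyf_mul; first exact: polyf_cst.
apply: polyf_add; last exact: polyf_mxdot.
by apply: polyf_mul (polyf_cst _ _) _; exact: polyf_mxdot.
Qed.

Lemma polyf_slope2 : polyf (coords R N) slope2.
Proof.
have hU := mpolyf_partU; have hV := mpolyf_partV; have hW := mpolyf_partW.
have hr := mpolyf_resid.
apply: polyf_add; apply: polyf_mxdot; apply: mpolyf_add;
  try by apply: mpolyf_scale.
- exact: mpolyf_mul.
- exact: mpolyf_mul.
- by apply: mpolyf_mul => //; exact: mpolyf_tr.
- by apply: mpolyf_mul => //; exact: mpolyf_tr.
Qed.

Lemma semialg_slice Fs rho : semialg (ext [:: id] N) (slice Fs rho).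
Proof.
have hU := mpolyf_ext_last [:: (@id R)] mpolyf_partU.
have hW := mpolyf_ext_last [:: (@id R)] mpolyf_partW.
have hx := mpolyf_ext_snd [:: (@id R)] N.
apply: semialg_and; first by apply: semialg_le (polyf_mxdot hx hx) (polyf_cst _ _).
apply: semialg_and; first exact: semialg_contraction.
apply: semialg_and.
  apply: (@semialg_all _ _ _ _ (fun q : R * 'rV[R]_N * 'rV[R]_(m * d) =>
    contraction (vec_mx q.2 : 'M[R]_(m, d)) ->
    mxdot (vec_mx q.2) (partU q.1.2) <= mxdot (partW q.1.2) (partU q.1.2))).
  have hw : mpolyf (ext (ext [:: (@id R)] N) (m * d))
    (fun q => vec_mx q.2 : 'M[R]_(m, d)) by apply: mpolyf_vec_mx; exact: mpolyf_ext_snd.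
  have hU' := mpolyf_ext_fst (m * d) hU.
  have hW' := mpolyf_ext_fst (m * d) hW.
  apply: semialg_imp; first exact: semialg_contraction.
  by apply: semialg_le; exact: polyf_mxdot.
apply: semialg_eq; first exact: (polyf_ext_last _ polyf_Phi).
apply: polyf_add; first exact: polyf_cst.
by apply: (@polyf_ext_fst _ _ [:: id] _ id); exact: (polyf_var (vs := [:: id]) (i := 0)).
Qed.

(** All quantifiers in the definition are universal, so the slice is an intersection of closed sets,
    and it lies in a ball. *)
Lemma compact_slice Fs rho t : compact [set x | slice Fs rho (t, x)].
Proof.
have hU := mpolyf_partU; have hW := mpolyf_partW; have hx := mpolyf_id.
have cst p q (A : 'M[R]_(p, q)) := mpolyf_cst (coords R N) A.
apply: bounded_closed_compact.
  exists (Num.sqrt rho); split; first exact: num_real.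
  move=> M rM x [/= xrho _]; apply: le_trans (ltW rM).
  have r0 : 0 <= rho := le_trans (mxdot_ge0 _) xrho.
  rewrite /Num.norm /= mx_normrE; apply/bigmax_leP; split; first exact: sqrtr_ge0.
  move=> [i j] _ /=; apply: le_trans (entry_le_frob _ _ _) _.
  by apply: frob_sqr_le; rewrite ?sqrtr_ge0 // sqr_sqrtr.
have -> : [set x | slice Fs rho (t, x)] =
  [set x | mxdot x x <= rho] `&`
  ((\bigcap_(y in [set: 'rV[R]_d]) [set x | mxdot (partW x *m y^T) (partW x *m y^T) <= mxdot y y]) `&`
   ((\bigcap_(w in [set w : 'rV[R]_(m * d) | contraction (vec_mx w : 'M[R]_(m, d))])
      [set x | mxdot (vec_mx w) (partU x) <= mxdot (partW x) (partU x)]) `&`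
    ([set x | Phi x <= Fs + t] `&` [set x | Fs + t <= Phi x]))).
  apply/seteqP; split=> x.
    case=> /= h1 [h2 [h3 h4]]; split=> //; split; first by move=> y _; exact: h2.
    split; first by move=> w; exact: h3.
    by rewrite /= h4.
  case=> /= h1 [h2 [h3 [h4 h5]]]; split=> //; split; first by move=> y; exact: h2.
  by split; [move=> w; exact: h3|apply/eqP; rewrite eq_le h4].
apply: closedI; first by apply: closed_polyf_le (polyf_mxdot hx hx) (polyf_cst _ _).
apply: closedI.
  apply: closed_bigI => y _; apply: closed_polyf_le (polyf_cst _ _).
  by apply: polyf_mxdot; apply: mpolyf_mul.
apply: closedI.
  by apply: closed_bigI => w _; apply: closed_polyf_le; exact: polyf_mxdot.
by apply: closedI; apply: closed_polyf_le; rewrite //; try exact: polyf_Phi; exact: polyf_cst.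
Qed.

(* [W] is a subgradient of the nuclear norm, so [Phi] is bounded below by its
   linearization up to the bilinear part of the data-fitting term. *)
Lemma slice_diff_le Fs rho t s x y (b L : R) : 0 < lambda ->
  slice Fs rho (t, x) -> slice Fs rho (s, y) ->
  slope2 x <= b ^+ 2 -> 0 <= b -> frob_norm (x - y) <= L ->
  t - s <= 2 * b * L + (rho + frob_norm D) * L ^+ 2.
Proof.
move=> l0 [/= xr [Wc [_ xE]]] [/= yr [_ [yM yE]]] sb b0 xyL.
have L0 : 0 <= L := le_trans (frob_ge0 _) xyL.
set A := partU y - partU x; set B := partV y - partV x.
have AL : frob_norm A <= L.
  apply: frob_sqr_le => //; apply: le_trans (_ : frob_norm (y - x) ^+ 2 <= _).
    rewrite sqr_frob mxdot_parts partUB -/A.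
    by rewrite -addrA lerDl addr_ge0 // mxdot_ge0.
  by rewrite ler_pXn2r ?nnegrE ?frob_ge0 // frob_distC.
have BL : frob_norm B <= L.
  apply: frob_sqr_le => //; apply: le_trans (_ : frob_norm (y - x) ^+ 2 <= _).
    rewrite sqr_frob mxdot_parts partVB -/B.
    by rewrite addrAC lerDr addr_ge0 // mxdot_ge0.
  by rewrite ler_pXn2r ?nnegrE ?frob_ge0 // frob_distC.
(* The contraction [partW x] is a competitor in the maximality clause of [y]. *)
have WU : mxdot (partW x) (partU y) <= mxdot (partW y) (partU y).
  by have := yM (mxvec (partW x)); rewrite mxvecK => /(_ Wc).
have G1 : frob_norm (gradPhiU x) <= b.
  by apply: frob_sqr_le => //; apply: le_trans sb; rewrite lerDl mxdot_ge0.
have G2 : frob_norm (gradPhiV x) <= b.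
  by apply: frob_sqr_le => //; apply: le_trans sb; rewrite lerDr mxdot_ge0.
(* [|U| |V| <= |U|^2 + |V|^2 <= rho], the origin of the constant [rho + |D|]. *)
have r0 : frob_norm (resid D Omega (partU x) (partV x)) <= rho + frob_norm D.
  apply: le_trans (resid_frob_le _ _ _ _) _; rewrite lerD2r.
  have := mxdot_ge0 (partW x); move: xr; rewrite mxdot_parts -!sqr_frob.
  have := sqr_ge0 (frob_norm (partU x) - frob_norm (partV x)).
  have := sqr_ge0 (frob_norm (partU x)); have := sqr_ge0 (frob_norm (partV x)); nra.
have fl := fit_lower D Omega (partU x) (partV x) A B.
have yU : partU x + A = partU y by rewrite addrCA subrr addr0.
have yV : partV x + B = partV y by rewrite addrCA subrr addr0.
rewrite yU yV !fitE in fl.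
have rAB : frob_norm (resid D Omega (partU x) (partV x)) * (frob_norm A * frob_norm B) <=
   (rho + frob_norm D) * L ^+ 2.
  by rewrite expr2 !ler_pM ?mulr_ge0 ?frob_ge0.
(* Each of the two blocks contributes one [b * L], hence the factor 2 in the conclusion. *)
have GA : - (b * L) <= mxdot (gradPhiU x) A.
  have := normr_mxdot_le (gradPhiU x) A; rewrite ler_norml => /andP[h _].
  by apply: le_trans h; rewrite lerN2 ler_pM ?frob_ge0.
have GB : - (b * L) <= mxdot (gradPhiV x) B.
  have := normr_mxdot_le (gradPhiV x) B; rewrite ler_norml => /andP[h _].
  by apply: le_trans h; rewrite lerN2 ler_pM ?frob_ge0.
rewrite /gradPhiU mxdotDl mxdotZl in GA; rewrite /gradPhiV mxdotDl mxdotZl in GB.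
have WA : mxdot (partW x) A = mxdot (partW x) (partU y) - mxdot (partW x) (partU x).
  by rewrite mxdotBr.
have VV : mxdot (partV x) (partV x) + 2 * mxdot (partV x) B <= mxdot (partV y) (partV y).
  have VVgen (v e : 'M[R]_(n, d)) : mxdot v v + 2 * mxdot v e <= mxdot (v + e) (v + e).
    by rewrite mxdotDl !mxdotDr (mxdotC e v); have := mxdot_ge0 e; lra.
  by have := VVgen (partV x) B; rewrite yV.
rewrite /Phi in xE yE; rewrite WA in GA.
have WU' := ler_wpM2l (ltW l0) WU; have VV' := ler_wpM2l (ltW l0) VV.
move: (mxdot (partW x) (partU y)) (mxdot (partW x) (partU x)) (mxdot (partW y) (partU y))
  (mxdot (partV x) (partV x)) (mxdot (partV y) (partV y)) (mxdot (partV x) B)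
  (mxdot (resid D Omega (partU x) (partV x) *m partV x) A)
  (mxdot ((resid D Omega (partU x) (partV x))^T *m partU x) B) xE yE GA GB WU' VV' fl rAB.
move: (mxdot (resid _ _ _ _) _) (mxdot (resid _ _ _ _) _) (frob_norm (resid _ _ _ _) * _)
  ((rho + frob_norm D) * L ^+ 2).
move=> r1 r2 r3 r4 e1 e2 e3 e4 e5 e6 e7 e8 xE yE GA GB WU' VV' fl rAB.
lra.
Qed.

End Slices.

(** * Finite length *)

Section FiniteLength.
Variable R : realType.

Lemma sum_bounded_of_recursion (delta ell : nat -> R) (K : nat) (M B : R) :
  (forall k, 0 <= delta k) -> 0 <= M ->
  (forall k, (K <= k)%N -> delta k.+1 <= delta k / 2 + M * ell k) ->
  (forall n, \sum_(K <= k < n) ell k <= B) ->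
  exists B', forall n, \sum_(0 <= k < n) delta k <= B'.
Proof.
move=> d0 M0 rec ellB.
(* The extra [2 * delta (K + i)] pays for the next summand and, by the recursion, for twice its
   successor up to [2 * M * ell]. *)
have main i : \sum_(K <= k < K + i) delta k + 2 * delta (K + i)%N <=
    2 * delta K + 2 * M * \sum_(K <= k < K + i) ell k.
  elim: i => [|i IH]; first by rewrite addn0 !big_geq // mulr0 addr0 add0r.
  rewrite addnS !big_nat_recr ?leq_addr //=.
  by have := rec (K + i)%N (leq_addr _ _); lra.
exists (\sum_(0 <= k < K) delta k + (2 * delta K + 2 * M * B)) => n.
have mono i j : (i <= j)%N -> \sum_(0 <= k < i) delta k <= \sum_(0 <= k < j) delta k.
  by move=> ij; rewrite (big_cat_nat (leq0n i) ij) /= lerDl sumr_ge0.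
apply: le_trans (mono _ _ (leq_addl K n)) _.
rewrite (big_cat_nat (leq0n K) (leq_addr n K)) /= lerD2l.
have h1 := main n; have h2 := d0 (K + n)%N.
have h3 : M * \sum_(K <= k < K + n) ell k <= M * B by rewrite ler_wpM2l.
lra.
Qed.

(** Along decreasing parameters the increments of a monotone function have one sign, so the sum
    telescopes to a difference of two values. *)
Lemma sum_variation_monotone_le (f : R -> R) (s : nat -> R) (e r : R) (K n : nat) : 0 <= r ->
  (forall k, (K <= k)%N -> 0 < s k < e) -> (forall k, s k.+1 <= s k) ->
  (forall t, 0 < t < e -> `|f t| <= r) ->
  (forall u t, 0 < u -> u <= t -> t < e -> f u <= f t) \/
  (forall u t, 0 < u -> u <= t -> t < e -> f t <= f u) ->
  \sum_(K <= k < n) `|f (s k) - f (s k.+1)| <= 2 * r.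
Proof.
move=> r0 se sdec fr fmono.
have [nK|Kn] := leqP n K; first by rewrite big_geq // mulr_ge0.
have bound : `|f (s n) - f (s K)| <= 2 * r.
  apply: le_trans (ler_normB _ _) _; rewrite mulr_natl mulr2n lerD // fr // se //.
  exact: ltnW.
apply: le_trans bound; rewrite -(telescope_sumr (fun k => f (s k)) (ltnW Kn)).
case: fmono => H.
  rewrite -[leRHS]normrN -sumrN; apply: le_trans (ler_norm _).
  rewrite big_nat_cond [leRHS]big_nat_cond; apply: ler_sum => k /andP[/andP[Kk _] _].
  have /andP[s1 s2] := se k Kk; have /andP[s3 s4] := se k.+1 (leqW Kk).
  by rewrite opprB ger0_norm // subr_ge0 H.
apply: le_trans (ler_norm _).
rewrite big_nat_cond [leRHS]big_nat_cond; apply: ler_sum => k /andP[/andP[Kk _] _].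
have /andP[s1 s2] := se k Kk; have /andP[s3 s4] := se k.+1 (leqW Kk).
by rewrite distrC ger0_norm // subr_ge0 H.
Qed.

(** Square the target: the cross term has coefficient [a * M = 2 c + C + a >= 2 c], and the
    coefficient of [l^2] is [M] times this, which exceeds [C] since the summand 1 makes [M >= 1]. *)
Lemma step_recursion (a c C x y l : R) : 0 < a -> 0 <= c -> 0 <= C -> 0 <= x -> 0 <= y ->
  0 <= l -> a * y ^+ 2 <= 2 * (c * x) * l + C * l ^+ 2 ->
  y <= x / 2 + (2 * c / a + C / a + 1) * l.
Proof.
move=> a0 c0 C0 x0 y0 l0 H; set M := _ + 1.
have aM : a * M = 2 * c + C + a by rewrite /M; field; rewrite gt_eqF.
have M1 : 1 <= M by rewrite /M lerDr addr_ge0 // divr_ge0 ?mulr_ge0 // ltW.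
have Ml : 0 <= M * l by rewrite mulr_ge0 // (le_trans ler01).
rewrite -(@ler_pXn2r _ 2) ?nnegrE ?addr_ge0 ?divr_ge0 // -(ler_pM2l a0).
apply: le_trans H _.
have -> : a * (x / 2 + M * l) ^+ 2 = a * x ^+ 2 / 4 + (a * M) * (x * l) + M * (a * M) * l ^+ 2.
  by field.
rewrite aM; have xl : 0 <= x * l by rewrite mulr_ge0.
have h1 : 0 <= a * x ^+ 2 by rewrite mulr_ge0 ?sqr_ge0 // ltW.
have h2 : 0 <= C * (x * l) by rewrite mulr_ge0.
have h3 : 0 <= a * (x * l) by rewrite mulr_ge0 // ltW.
have h4 : C * l ^+ 2 <= M * (2 * c + C + a) * l ^+ 2.
  rewrite ler_wpM2r ?sqr_ge0 //; apply: le_trans (_ : 1 * (2 * c + C + a) <= _).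
    by move: a0 c0; lra.
  by rewrite ler_wpM2r // ?addr_ge0 ?mulr_ge0 // ltW.
move: h1 h2 h3 h4 xl; move: (x ^+ 2) (l ^+ 2) => x2 l2; lra.
Qed.

Variables (m n d : nat) (D : 'M[R]_(m, n)) (Omega : {set 'I_m * 'I_n}) (lambda : R).

Lemma palm_finite_length (U W : nat -> 'M[R]_(m, d)) (V : nat -> 'M[R]_(n, d))
    (delta : nat -> R) (a c rho : R) :
  0 < lambda -> 0 < a -> 0 <= c ->
  (forall k, 0 <= delta k) ->
  (forall k, a * delta k ^+ 2 <= objective D Omega lambda (U k, V k) -
                                 objective D Omega lambda (U k.+1, V k.+1)) ->
  (forall k, 0 <= objective D Omega lambda (U k, V k)) ->
  (forall k, contraction (W k.+1) /\ mxdot (W k.+1) (U k.+1) = nuclear_norm (U k.+1)) ->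
  (forall k, slope2 D Omega lambda (pack (U k.+1) (V k.+1) (W k.+1)) <= (c * delta k) ^+ 2) ->
  (forall k, mxdot (pack (U k.+1) (V k.+1) (W k.+1)) (pack (U k.+1) (V k.+1) (W k.+1)) <= rho) ->
  exists B, forall i, \sum_(0 <= k < i) delta k <= B.
Proof.
move=> l0 a0 c0 d0 desc F0 HW slopeH bnd.
set F := fun k => objective D Omega lambda (U k, V k).
have Fdec k : F k.+1 <= F k.
  by rewrite -subr_ge0; apply: le_trans (desc k); rewrite mulr_ge0 ?sqr_ge0 // ltW.
have Fmono i j : (i <= j)%N -> F j <= F i.
  move=> /subnK <-; elim: (j - i)%N => // k IH; rewrite addSn.
  exact: le_trans (Fdec _) IH.
pose Fs := inf (range F).
have lbF : has_lbound (range F) by exists 0 => _ [k _ <-]; exact: F0.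
have FsF k : Fs <= F k by apply: ge_inf => //; exists k.
have Fcvg e : 0 < e -> exists k, F k < Fs + e.
  move=> e0; have [|_ [k _ <-] h] := @inf_adherent _ (range F) e e0.
    by split=> //; exists (F 0%N), 0%N.
  by exists k.
pose s k := F k.+1 - Fs.
have s0 k : 0 <= s k by rewrite subr_ge0.
have sdec k : s k.+1 <= s k by rewrite lerD2r.
have smono i j : (i <= j)%N -> s j <= s i by move=> ij; rewrite lerD2r Fmono.
have sdesc k : a * delta k.+1 ^+ 2 <= s k - s k.+1.
  by have := desc k.+1; rewrite /s -/(F k.+1) -/(F k.+2); lra.
(* If the infimum is reached, the descent forces all later steps to vanish, and the recursion holds
   with zero variation. *)
have [[K sK]|spos] := pselect (exists k, s k <= 0).
  apply: (@sum_bounded_of_recursion delta (fun=> 0) K 0 0) => // [k Kk|i]; last by rewrite big1.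
  rewrite mul0r addr0; apply: le_trans (_ : 0 <= _); last by rewrite divr_ge0.
  have : a * delta k.+1 ^+ 2 <= 0.
    by apply: le_trans (sdesc k) _; have := smono _ _ Kk; have := s0 k.+1; lra.
  rewrite pmulr_rle0 // => h; have : delta k.+1 ^+ 2 == 0 by rewrite eq_le h sqr_ge0.
  by rewrite sqrf_eq0 => /eqP->.
have {}spos k : 0 < s k by rewrite ltNge; apply/negP => h; apply: spos; exists k.
have ssmall e : 0 < e -> exists K, forall k, (K <= k)%N -> s k < e.
  move=> /Fcvg[K hK]; exists K => k Kk; rewrite ltrBlDr addrC.
  exact: le_lt_trans (Fmono _ _ (leqW Kk)) hK.
have inS k : slice D Omega lambda Fs rho (s k, pack (U k.+1) (V k.+1) (W k.+1)).
  have [Wc WU] := HW k; split=> //=; rewrite partW_pack; split=> //.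
  split=> [w wc|]; first by rewrite partU_pack WU mxdot_contraction_le.
  rewrite /Phi partW_pack partU_pack partV_pack WU [RHS]addrC subrK.
  by rewrite /F /objective /= fitE sqr_frob.
(* Near 0 the slices are either all nonempty or all empty; the iterates, with [s k] positive and
   tending to 0, exclude the latter. *)
have [[e [e0 eP]]|[e [e0 eP]]] :=
    semialg_ev_right_dich 0 (semialg_ex (@semialg_slice R m n d D Omega lambda Fs rho)); last first.
  have [K /(_ K (leqnn K)) sK] := ssmall e e0.
  by case: (eP (s K) (spos K)); rewrite ?add0r //; eexists; exact: inS.
have [|e' [z [e'0 e'e zP zmono]]] := semialg_selection e0 (@semialg_slice R m n d D Omega lambda Fs rho)
    (@polyf_slope2 R m n d D Omega lambda).
  move=> t /andP[t0 te]; split; first exact: compact_slice.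
  by apply: eP; rewrite ?add0r.
have [K sK] := ssmall e' e'0.
have sI k : (K <= k)%N -> 0 < s k < e' by move=> Kk; rewrite spos sK.
(* The sum over coordinates dominates the Euclidean distance, and its total over [k] can be bounded
   one coordinate at a time. *)
pose ell k := \sum_(j < m * d + (n * d + m * d)) `|z (s k) 0 j - z (s k.+1) 0 j|.
have C0 : 0 <= rho + frob_norm D.
  by rewrite addr_ge0 ?frob_ge0 //; apply: le_trans (bnd 0%N); exact: mxdot_ge0.
apply: (@sum_bounded_of_recursion delta ell K (2 * c / a + (rho + frob_norm D) / a + 1)
   (\sum_(j < m * d + (n * d + m * d)) (2 * Num.sqrt rho))) => //.
- by rewrite !addr_ge0 // divr_ge0 ?mulr_ge0 // ltW.
- move=> k Kk; apply: step_recursion => //; first by apply: sumr_ge0.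
  apply: le_trans (sdesc k) _.
  have [z1 z1min] := zP _ (sI k Kk); have [z2 _] := zP _ (sI k.+1 (leqW Kk)).
  apply: (slice_diff_le l0 z1 z2); first exact: le_trans (z1min _ (inS k)) (slopeH k).
    by rewrite mulr_ge0.
  apply: le_trans (frob_le_sum _) _; rewrite big_ord1.
  by apply: ler_sum => j _; rewrite !mxE.
- move=> i; rewrite exchange_big /=; apply: ler_sum => j _.
  apply: (@sum_variation_monotone_le (fun t => z t 0 j) s e') => // t te.
  have [[/= zr _] _] := zP t te.
  apply: le_trans (entry_le_frob _ _ _) _; apply: frob_sqr_le; first exact: sqrtr_ge0.
  by rewrite sqr_sqrtr //; apply: le_trans zr; exact: mxdot_ge0.
Qed.

End FiniteLength.

(** * Convergence and critical points *)

Section Convergence.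
Variable R : realType.

Lemma normr_le_frob p q (A : 'M[R]_(p, q)) : `|A| <= frob_norm A.
Proof.
rewrite /Num.norm /= mx_normrE; apply/bigmax_leP; split; first exact: frob_ge0.
by move=> [i j] _ /=; exact: entry_le_frob.
Qed.

Lemma frob_le_normr p q (A : 'M[R]_(p, q)) : frob_norm A <= (p%:R * q%:R) * `|A|.
Proof.
apply: le_trans (frob_le_sum _) _.
apply: (@le_trans _ _ (\sum_(i < p) \sum_(j < q) `|A|)).
  apply: ler_sum => i _; apply: ler_sum => j _.
  rewrite [leRHS]/Num.norm /= mx_normrE.
  exact: (le_bigmax_cond _ (j := (i, j)) (fun k : 'I_p * 'I_q => `|A k.1 k.2|)).
by rewrite !sumr_const !card_ord -mulrnA -[leLHS]mulr_natl natrM [p%:R * _]mulrC.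
Qed.

(** With [T] the partial sums of [delta], both [T] and [u + T] are nondecreasing and bounded; [u] is
    their difference. *)
Lemma finite_length_cvg (u delta : nat -> R) (B : R) :
  (forall k, `|u k.+1 - u k| <= delta k) ->
  (forall n, \sum_(0 <= k < n) delta k <= B) -> cvgn u.
Proof.
move=> ud sB; pose T n := \sum_(0 <= k < n) delta k.
have d0 k : 0 <= delta k := le_trans (normr_ge0 _) (ud k).
have TS n : T n.+1 = T n + delta n by rewrite /T big_nat_recr.
have uT n : `|u n - u 0%N| <= T n.
  elim: n => [|n IH]; first by rewrite subrr normr0 /T big_geq.
  rewrite TS; have -> : u n.+1 - u 0%N = (u n - u 0%N) + (u n.+1 - u n) by ring.
  exact: le_trans (ler_normD _ _) (lerD IH (ud n)).
have cT : cvgn T.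
  apply: nondecreasing_is_cvgn; last by exists B => _ [n _ <-]; exact: sB.
  by apply/nondecreasing_seqP => n; rewrite TS lerDl.
have cuT : cvgn (fun n => u n + T n).
  apply: nondecreasing_is_cvgn.
    apply/nondecreasing_seqP => n; rewrite TS.
    by have := ud n; rewrite ler_norml => /andP[h _]; lra.
  exists (u 0%N + B + B) => _ [n _ <-]; have := uT n; have := sB n; rewrite -/(T n).
  by rewrite ler_norml => h /andP[_ h']; lra.
have -> : u = (fun n => (u n + T n) - T n) by apply/funext => n; rewrite addrK.
exact: is_cvgB.
Qed.

Lemma frob_cvg_of_entries p q (X : nat -> 'M[R]_(p, q)) (L : 'M[R]_(p, q)) :
  (forall i j, (fun k => X k i j) @ \oo --> L i j) ->
  forall e, 0 < e -> \forall k \near \oo, frob_norm (X k - L) < e.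
Proof.
(* The added 1 covers empty matrices and makes the final inequality strict. *)
move=> cX e e0; pose e' := e / (p%:R * q%:R + 1).
have pq : 0 < p%:R * q%:R + 1 :> R by rewrite ltr_wpDl // mulr_ge0.
have e'0 : 0 < e' by rewrite divr_gt0.
have : \forall k \near \oo, forall ij : 'I_p * 'I_q, `|L ij.1 ij.2 - X k ij.1 ij.2| < e'.
  by apply: filter_forall => -[i j] /=; exact: cvgr_dist_lt (cX i j) _ e'0.
apply: filterS => k H; apply: le_lt_trans (frob_le_sum _) _.
apply: (@le_lt_trans _ _ (\sum_(i < p) \sum_(j < q) e')).
  apply: ler_sum => i _; apply: ler_sum => j _; rewrite !mxE distrC.
  exact: ltW (H (i, j)).
rewrite !sumr_const !card_ord -mulrnA -[ltLHS]mulr_natl natrM [q%:R * _]mulrC /e' mulrCA gtr_pMr //.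
by rewrite ltr_pdivrMr // mul1r ltrDl.
Qed.

Lemma mx_cvg_of_frob p q (X : nat -> 'M[R]_(p, q)) (L : 'M[R]_(p, q)) :
  (forall e, 0 < e -> \forall k \near \oo, frob_norm (X k - L) < e) -> X @ \oo --> L.
Proof.
move=> H; apply/cvgrPdist_lt => e e0; apply: filterS (H e e0) => k.
by apply: le_lt_trans; rewrite distrC normr_le_frob.
Qed.

End Convergence.

(** * Stationary pairs are critical points *)

Section Critical.
Variables (R : realType) (m n d : nat) (D : 'M[R]_(m, n)) (Omega : {set 'I_m * 'I_n}).
Variable lambda : R.

Lemma frob1_le_pairnorm (Y : 'M[R]_(m, d) * 'M[R]_(n, d)) : frob_norm Y.1 <= pairnorm Y.
Proof. by rewrite ler_wsqrtr // lerDl mxdot_ge0. Qed.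

Lemma frob2_le_pairnorm (Y : 'M[R]_(m, d) * 'M[R]_(n, d)) : frob_norm Y.2 <= pairnorm Y.
Proof. by rewrite ler_wsqrtr // lerDr mxdot_ge0. Qed.

Lemma pairnorm_le (Y : 'M[R]_(m, d) * 'M[R]_(n, d)) :
  pairnorm Y <= frob_norm Y.1 + frob_norm Y.2.
Proof.
rewrite -(@ler_pXn2r _ 2) ?nnegrE ?addr_ge0 ?frob_ge0 ?sqrtr_ge0 //.
rewrite /pairnorm sqr_sqrtr /pairdot ?addr_ge0 ?mxdot_ge0 // -!sqr_frob.
have := mulr_ge0 (frob_ge0 Y.1) (frob_ge0 Y.2).
by move: (frob_norm _) (frob_norm _) => a b; nra.
Qed.

(** By weak convexity the objective falls below its value at [(U, V)] by at most [C] times the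
    squared distance. Hence 0 is a Frechet subgradient at the point itself, and constant sequences
    witness the limiting one. *)
Lemma stationary_critical (U : 'M[R]_(m, d)) (V : 'M[R]_(n, d)) : 0 < lambda ->
  (forall Y, 2 * lambda / 3 * nuclear_norm U - mxdot (resid D Omega U V *m V) (Y - U)
     <= 2 * lambda / 3 * nuclear_norm Y) ->
  (2 * lambda / 3) *: V + (resid D Omega U V)^T *m U = 0 ->
  critical_point (fun Y => (objective D Omega lambda Y)%:E) (U, V).
Proof.
move=> l0 hU hV.
exists (fun=> (U, V)), (fun=> 0); split; try exact: cvg_cst.
move=> _; split; first exact: ltry.
set C := frob_norm (resid D Omega U V).
have lower Y : - (C * pairnorm (Y - (U, V)) ^+ 2) <=
    objective D Omega lambda Y - objective D Omega lambda (U, V).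
  case: Y => Y1 Y2; rewrite /objective /=.
  have fl := fit_lower D Omega U V (Y1 - U) (Y2 - V).
  rewrite [U + _]addrC subrK [V + _]addrC subrK -/C in fl.
  have hV' : 2 * lambda / 3 * mxdot V (Y2 - V) + mxdot ((resid D Omega U V)^T *m U) (Y2 - V) = 0.
    by rewrite -mxdotZl -mxdotDl hV mxdot0l.
  have VV : frob_norm V ^+ 2 + 2 * mxdot V (Y2 - V) <= frob_norm Y2 ^+ 2.
    have := mxdot_ge0 (Y2 - V); rewrite !sqr_frob.
    rewrite !(mxdotDl, mxdotDr, mxdotNl, mxdotNr) (mxdotC Y2 V).
    by move: (mxdot _ _) (mxdot _ _) (mxdot _ _) => x y z; lra.
  have hU' := hU Y1.
  have rAB : C * (frob_norm (Y1 - U) * frob_norm (Y2 - V)) <=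
      C * pairnorm ((Y1, Y2) - (U, V)) ^+ 2.
    rewrite ler_wpM2l ?frob_ge0 // expr2 ler_pM ?frob_ge0 //.
      exact: (frob1_le_pairnorm ((Y1, Y2) - (U, V))).
    exact: (frob2_le_pairnorm ((Y1, Y2) - (U, V))).
  have VV' := ler_wpM2l (ltW l0) VV.
  move: (C * pairnorm _ ^+ 2) rAB => q rAB.
  move: (C * _) rAB fl => q' rAB.
  move: (fit _ _ _ _) (fit _ _ _ _) (mxdot (_ *m U) _) (mxdot (_ *m V) _) hU' hV' => f1 f2 g1 g2.
  move: (mxdot V _) (frob_norm V ^+ 2) (frob_norm Y2 ^+ 2) (nuclear_norm _) (nuclear_norm _) VV'.
  move=> *; lra.
rewrite limf_einfE; apply/lee_addgt0Pr => e e0.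
(* Neighbourhoods are taken in the sup norm of the entries; passing to the Euclidean norm costs the
   factors [m d] and [n d]. Within [r], [C] times the distance is at most [e]. *)
pose r := e / (C + 1) / (m%:R * d%:R + n%:R * d%:R + 1).
have C1 : 0 < C + 1 by rewrite ltr_wpDl ?frob_ge0.
have s1 : 0 < m%:R * d%:R + n%:R * d%:R + 1 :> R by rewrite ltr_wpDl // addr_ge0 ?mulr_ge0.
have r0 : 0 < r by rewrite !divr_gt0.
pose X : 'M[R]_(m, d) * 'M[R]_(n, d) := (U, V).
pose f (Y : 'M[R]_(m, d) * 'M[R]_(n, d)) : \bar R :=
  (((objective D Omega lambda Y)%:E - (objective D Omega lambda X)%:E
    - (pairdot 0 (Y - X))%:E) * ((pairnorm (Y - X))^-1)%:E)%E.
rewrite -/X -/f.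
have n1 : \forall Y \near X, `|U - Y.1| < r.
  have c1 : (fst : 'M[R]_(m, d) * 'M[R]_(n, d) -> 'M[R]_(m, d)) @ X --> U by exact: cvg_fst.
  by move/cvgrPdist_lt : c1 => /(_ r r0).
have n2 : \forall Y \near X, `|V - Y.2| < r.
  have c2 : (snd : 'M[R]_(m, d) * 'M[R]_(n, d) -> 'M[R]_(n, d)) @ X --> V by exact: cvg_snd.
  by move/cvgrPdist_lt : c2 => /(_ r r0).
have nf : \forall Y \near X^', (- e%:E <= f Y)%E.
  near=> Y.
  have nY : Y != (U, V) by near: Y; exact: nbhs_dnbhs_neq.
  have h1 : `|U - Y.1| < r by near: Y; apply: nbhs_dnbhs.
  have h2 : `|V - Y.2| < r by near: Y; apply: nbhs_dnbhs.
  have pY : 0 < pairnorm (Y - (U, V)).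
    rewrite lt_neqAle sqrtr_ge0 andbT eq_sym; apply: contra nY => /eqP p0.
    rewrite -subr_eq0; have := frob1_le_pairnorm (Y - (U, V)).
    have := frob2_le_pairnorm (Y - (U, V)); rewrite p0 => q2 q1.
    apply/eqP; rewrite [LHS]surjective_pairing.
    congr (_, _); apply: frob_eq0; apply/eqP; rewrite eq_le frob_ge0 andbT //.
  have pr : pairnorm (Y - (U, V)) <= e / (C + 1).
    apply: le_trans (pairnorm_le _) _ => /=.
    rewrite !(frob_distC Y.1) !(frob_distC Y.2).
    have k1 := frob_le_normr (U - Y.1); have k2 := frob_le_normr (V - Y.2).
    have k1' := le_trans k1 (ler_wpM2l (mulr_ge0 (ler0n R m) (ler0n R d)) (ltW h1)).
    have k2' := le_trans k2 (ler_wpM2l (mulr_ge0 (ler0n R n) (ler0n R d)) (ltW h2)).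
    apply: le_trans (lerD k1' k2') _; rewrite -mulrDl.
    apply: le_trans (_ : (m%:R * d%:R + n%:R * d%:R + 1) * r <= _).
      by rewrite ler_wpM2r ?(ltW r0) // lerDl.
    by rewrite /r mulrCA divff ?mulr1 // gt_eqF.
  rewrite /f /pairdot /= !mxdot0l addr0 sube0 -EFinB -EFinM lee_fin.
  rewrite ler_pdivlMr // mulNr; apply: le_trans (lower Y); rewrite lerN2 expr2 mulrA.
  rewrite ler_wpM2r ?(ltW pY) //; apply: le_trans (_ : (C + 1) * (e / (C + 1)) <= _).
    by rewrite ler_pM ?frob_ge0 ?(ltW pY) // lerDl.
  by rewrite mulrCA divff ?mulr1 // gt_eqF.
(* The lower limit is a supremum of infima over the sets of the filter, and the set where [- e <= f]
   is one of them. *)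
apply: (@le_trans _ _ (ereal_inf [set f x | x in [set Y | (- e%:E <= f Y)%E]] + e%:E)%E).
  rewrite -leeBlDr // sub0e; apply/ereal_infP => _ [Y hY <-]; exact: hY.
rewrite leeD2rE //; apply: ereal_sup_ubound.
by exists [set Y | (- e%:E <= f Y)%E].
Unshelve. all: by end_near. Qed.

End Critical.

(** * Optimality conditions in the limit *)

Section Main.
Variables (R : realType) (m n d : nat) (D : 'M[R]_(m, n)) (Omega : {set 'I_m * 'I_n}).
Variable lambda : R.

Lemma le_of_eventually_small (x y K : R) (eps : nat -> R) : 0 <= K ->
  (forall e, 0 < e -> exists k, eps k < e) -> (forall k, x <= y + K * eps k) -> x <= y.
Proof.
move=> K0 small H; apply/ler_addgt0Pr => e e0.
have K1 : 0 < K + 1 by rewrite ltr_wpDl.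
have [k ek] := small (e / (K + 1)) (divr_gt0 e0 K1).
apply: le_trans (H k) _; rewrite lerD2l.
apply: le_trans (ler_wpM2l K0 (ltW ek)) _.
by rewrite mulrCA ler_piMr ?(ltW e0) // ler_pdivrMr // mul1r lerDl.
Qed.

(** The optimality conditions of the two steps hold at the limit up to an error [K * eps k]; the
    proximal terms are part of the error because the spectral norms are bounded. *)
Lemma palm_limit_critical (U : nat -> 'M[R]_(m, d)) (V : nat -> 'M[R]_(n, d))
    (Us : 'M[R]_(m, d)) (Vs : 'M[R]_(n, d)) (M : R) : 0 < lambda ->
  palm_sequence D Omega lambda U V ->
  (forall k, frob_norm (U k) <= M) -> (forall k, frob_norm (V k) <= M) ->
  frob_norm Us <= M -> frob_norm Vs <= M ->
  (forall e, 0 < e -> \forall k \near \oo, frob_norm (U k - Us) < e) ->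
  (forall e, 0 < e -> \forall k \near \oo, frob_norm (V k - Vs) < e) ->
  critical_point (fun Y => (objective D Omega lambda Y)%:E) (Us, Vs).
Proof.
move=> l0 palm UM VM UsM VsM cU cV.
have M0 : 0 <= M := le_trans (frob_ge0 _) UsM.
pose f k := frob_norm (U k - Us) + frob_norm (V k - Vs).
(* Both ends of a step enter: gradients are evaluated at old or mixed pairs, subgradients at the new
   point. *)
pose eps k := f k + f k.+1.
have f0 k : 0 <= f k by rewrite addr_ge0 ?frob_ge0.
have small e : 0 < e -> exists k, eps k < e.
  move=> e0; have e4 : 0 < e / 4 by rewrite divr_gt0.
  have [K1 _ H1] := cU _ e4; have [K2 _ H2] := cV _ e4.
  exists (maxn K1 K2); rewrite /eps /f.
  have := H1 _ (leq_maxl K1 K2); have := H2 _ (leq_maxr K1 K2).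
  have := H1 _ (leqW (leq_maxl K1 K2)); have := H2 _ (leqW (leq_maxr K1 K2)).
  by move=> /= *; lra.
have sV k : spectral_norm (V k) ^+ 2 <= M ^+ 2.
  rewrite ler_pXn2r ?nnegrE ?spectral_norm_ge0 //.
  exact: le_trans (spectral_norm_le_frob _) (VM k).
have sU k : spectral_norm (U k) ^+ 2 <= M ^+ 2.
  rewrite ler_pXn2r ?nnegrE ?spectral_norm_ge0 //.
  exact: le_trans (spectral_norm_le_frob _) (UM k).
have dU k : frob_norm (U k.+1 - U k) <= eps k.
  have -> : U k.+1 - U k = (U k.+1 - Us) - (U k - Us) by rewrite opprB addrA subrK.
  apply: le_trans (frobB_le _ _) _; rewrite addrC lerD // lerDl frob_ge0 //.
have dV k : frob_norm (V k.+1 - V k) <= eps k.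
  have -> : V k.+1 - V k = (V k.+1 - Vs) - (V k - Vs) by rewrite opprB addrA subrK.
  by apply: le_trans (frobB_le _ _) _; rewrite addrC lerD // lerDr frob_ge0.
have fe k : f k <= eps k by rewrite lerDl.
have fe' k : f k.+1 <= eps k by rewrite lerDr.
set L := 2 * M ^+ 2 + frob_norm D.
have L0 : 0 <= L by rewrite addr_ge0 ?frob_ge0 // mulr_ge0 // sqr_ge0.
have eps0 k : 0 <= eps k by rewrite addr_ge0.
have l3 : 0 <= 2 * lambda / 3 by lra.
apply: stationary_critical => // [Y|].
  set Gs := resid D Omega Us Vs *m Vs.
  pose G k := resid D Omega (U k) (V k) *m V k + spectral_norm (V k) ^+ 2 *: (U k.+1 - U k).
  have GE k : frob_norm (G k - Gs) <= (L + M ^+ 2) * eps k.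
    rewrite /G addrAC; apply: le_trans (frobD_le _ _) _; rewrite mulrDl lerD //.
      apply: le_trans (grad_U_lip D Omega M0 _ _ _ _) _ => //.
      by rewrite ler_wpM2l //; exact: fe.
    rewrite frobZ ger0_norm ?sqr_ge0 // ler_pM ?sqr_ge0 ?frob_ge0 //.
  apply: (@le_of_eventually_small _ _ (2 * lambda / 3 * Num.sqrt d%:R +
    (L + M ^+ 2) * (frob_norm Y + M) + frob_norm Gs) eps) => // [|k].
    apply: addr_ge0; last exact: frob_ge0.
    apply: addr_ge0; first exact: mulr_ge0 l3 (sqrtr_ge0 _).
    exact: mulr_ge0 (addr_ge0 L0 (sqr_ge0 M)) (addr_ge0 (frob_ge0 _) M0).
  have hU := palm_U_opt l0 (palm k).1 Y; rewrite -/(G k) in hU.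
  have hN := nuclear_norm_lip Us (U k.+1).
  have hUs : frob_norm (Us - U k.+1) <= eps k.
    by rewrite frob_distC; apply: le_trans (fe' k); rewrite lerDl frob_ge0.
  have hN' := ler_wpM2l l3 (le_trans hN (lerD (lexx _) (ler_wpM2l (sqrtr_ge0 d%:R) hUs))).
  have e1 : mxdot (G k - Gs) (Y - U k.+1) <= (L + M ^+ 2) * eps k * (frob_norm Y + M).
    apply: le_trans (mxdot_le _ _) _; rewrite ler_pM ?frob_ge0 //.
    by apply: le_trans (frobB_le _ _) _; rewrite lerD2l.
  have e2 : mxdot Gs (Us - U k.+1) <= frob_norm Gs * eps k.
    by apply: le_trans (mxdot_le _ _) _; rewrite ler_wpM2l ?frob_ge0.
  have e3 : mxdot (G k) (Y - U k.+1) =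
     mxdot (G k - Gs) (Y - U k.+1) + mxdot Gs (Us - U k.+1) + mxdot Gs (Y - Us).
    rewrite mxdotBl -addrA -mxdotDr [Us - _ + _]addrC addrA subrK.
    by rewrite subrK.
  rewrite e3 in hU; move: hU hN' e1 e2.
  move: (mxdot _ _) (mxdot _ _) (mxdot _ _) => x1 x2 x3 hU hN' e1 e2.
  rewrite mulrDr in hN'; move: hU hN' e1 e2; lra.
set T := _ + _; apply: frob_eq0; apply/eqP; rewrite eq_le frob_ge0 andbT.
apply: (@le_of_eventually_small _ _ (2 * lambda / 3 + L + M ^+ 2) eps) => // [|k].
  exact: addr_ge0 (addr_ge0 l3 L0) (sqr_ge0 M).
have hV := palm_V_opt l0 (palm k).2.
(* The vanishing optimality condition of the [V] step is subtracted; its gradient is taken at the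
   mixed pair [(U_(k+1), V_k)]. *)
have TE : T = (2 * lambda / 3) *: (Vs - V k.+1) +
    ((resid D Omega Us Vs)^T *m Us - (resid D Omega (U k.+1) (V k))^T *m U k.+1) -
    spectral_norm (U k.+1) ^+ 2 *: (V k.+1 - V k).
  rewrite -[LHS]subr0 -hV /T [_ *: (Vs - _)]scalerBr.
  move: (_ *: Vs) (_ *: V k.+1) (_ *: (V k.+1 - _)) => a1 a2 w.
  move: (_ *m Us) (_ *m U k.+1) => g1 g2.
  by apply/matrixP => i j; rewrite !mxE; ring.
rewrite add0r TE; apply: le_trans (frobB_le _ _) _; rewrite [leRHS]mulrDl lerD //.
  apply: le_trans (frobD_le _ _) _; rewrite [leRHS]mulrDl lerD //.
    rewrite frobZ ger0_norm // ler_wpM2l //.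
    by rewrite frob_distC; apply: le_trans (fe' k); rewrite lerDr frob_ge0.
  apply: le_trans (grad_V_lip D Omega M0 _ _ _ _) _ => //.
  rewrite ler_wpM2l // (frob_distC Us) (frob_distC Vs) /eps addrC lerD //.
    by rewrite lerDr frob_ge0.
  by rewrite lerDl frob_ge0.
by rewrite frobZ ger0_norm ?sqr_ge0 // ler_pM ?sqr_ge0 ?frob_ge0.
Qed.

End Main.

(** * Boundedness, the degenerate case, and convergence of the iterates *)

Section Iterates.
Variables (R : realType) (m n d : nat) (D : 'M[R]_(m, n)) (Omega : {set 'I_m * 'I_n}).
Variables (lambda : R) (U : nat -> 'M[R]_(m, d)) (V : nat -> 'M[R]_(n, d)).

Lemma objective_ge (A : 'M[R]_(m, d)) (B : 'M[R]_(n, d)) :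
  2 * lambda / 3 * nuclear_norm A + lambda / 3 * frob_norm B ^+ 2 <=
  objective D Omega lambda (A, B).
Proof. by have := fit_ge0 D Omega A B; rewrite /objective /=; lra. Qed.

Lemma palm_objective_le : 0 < lambda -> palm_sequence D Omega lambda U V ->
  forall k, objective D Omega lambda (U k, V k) <= objective D Omega lambda (U 0%N, V 0%N).
Proof.
move=> l0 palm; elim=> // k IH; apply: le_trans IH.
rewrite -subr_ge0; apply: le_trans (palm_descent l0 (palm k).1 (palm k).2).
by rewrite addr_ge0 // mulr_ge0 ?sqr_ge0 ?divr_ge0 ?sqr_ge0 // ltW.
Qed.

Lemma palm_bounded : 0 < lambda -> palm_sequence D Omega lambda U V ->
  exists2 M, 0 <= M & forall k, frob_norm (U k) <= M /\ frob_norm (V k) <= M.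
Proof.
move=> l0 palm; set F0 := objective D Omega lambda (U 0%N, V 0%N).
have FF k := palm_objective_le l0 palm k.
have key k : 2 * lambda / 3 * nuclear_norm (U k) + lambda / 3 * frob_norm (V k) ^+ 2 <= F0.
  exact: le_trans (objective_ge _ _) (FF k).
have F00 : 0 <= F0.
  apply: le_trans (key 0%N); rewrite addr_ge0 // mulr_ge0 ?sqr_ge0 ?nuclear_norm_ge0 //; lra.
have l3 : 0 <= 3 / lambda * F0 by rewrite mulr_ge0 ?divr_ge0 // ltW.
(* The 1 turns a bound on [|V|^2] into one on [|V|]. *)
exists (1 + 3 / lambda * F0) => [|k]; first by lra.
have FE : F0 = lambda / 3 * (3 / lambda * F0) by field; rewrite gt_eqF.
have l30 : 0 < lambda / 3 by lra.
have := key k; rewrite [X in _ <= X]FE.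
have -> : 2 * lambda / 3 * nuclear_norm (U k) + lambda / 3 * frob_norm (V k) ^+ 2 =
  lambda / 3 * (2 * nuclear_norm (U k) + frob_norm (V k) ^+ 2) by field.
rewrite ler_pM2l // => h.
have := frob_le_nuclear (U k); have := frob_ge0 (U k).
have := sqr_ge0 (frob_norm (V k)); have := sqr_ge0 (frob_norm (V k) - 1).
by move: h l3; move: (3 / lambda * F0) (frob_norm _) (frob_norm _) (nuclear_norm _)
  => *; split; nra.
Qed.

(** Once [U] vanishes, the [V] model reduces to its ridge term up to a constant, so [V] vanishes; at
    [(0, 0)] the next [U] model is a multiple of the nuclear norm plus a constant. *)
Lemma palm_zero : 0 < lambda -> palm_sequence D Omega lambda U V ->
  forall k, U k.+1 = 0 -> forall i, U (k.+1 + i)%N = 0 /\ V (k.+1 + i)%N = 0.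
Proof.
move=> l0 palm k Uk.
have V0 j : U j.+1 = 0 -> V j.+1 = 0.
  move=> Uj; have := palm_V_opt l0 (palm j).2.
  rewrite Uj mulmx0 spectral_norm0 expr0n scale0r !addr0 => /eqP.
  by rewrite scaler_eq0 gt_eqF /= => [/eqP|]; last by lra.
elim=> [|i [Ui Vi]]; first by rewrite addn0 V0.
have Ui1 : U (k.+1 + i).+1 = 0.
  have := palm_U_opt l0 (palm (k.+1 + i)%N).1 0.
  rewrite Ui Vi mulmx0 spectral_norm0 expr0n scale0r addr0 mxdot0l subr0 nuclear_norm0 mulr0.
  rewrite pmulr_rle0 => [h|]; last by lra.
  apply: frob_eq0; apply/eqP; rewrite eq_le frob_ge0 andbT.
  exact: le_trans (frob_le_nuclear _) h.
by rewrite addnS V0.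
Qed.

(* With a small step parameter [||V_k||_2^2] the threshold of the proximal map
   exceeds its argument, so [U_(k+1)] vanishes. *)
Lemma palm_spectral_lower (M : R) : 0 < lambda -> palm_sequence D Omega lambda U V ->
  0 <= M -> (forall k, frob_norm (U k) <= M /\ frob_norm (V k) <= M) ->
  exists2 c, 0 < c & forall k, U k.+1 != 0 -> c <= spectral_norm (V k).
Proof.
(* For [s = |V_k|_2 <= 1] the smooth part of the [U] model has gradient at most [C s] at [U_(k+1)]:
   [M^2 + |D|] bounds the residual and [2 M] the step. A nonzero [U_(k+1)] needs
   [2 lambda / 3 <= C s]. *)
move=> l0 palm M0 bnd; pose C := M ^+ 2 + frob_norm D + 2 * M + 1.
have C0 : 0 < C.
  by rewrite ltr_wpDl // !addr_ge0 ?sqr_ge0 ?frob_ge0 // mulr_ge0.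
have l3 : 0 < 2 * lambda / 3 by lra.
exists (Num.min 1 (2 * lambda / 3 / C)); first by rewrite lt_min ltr01 divr_gt0.
move=> k U1; rewrite leNgt lt_min; apply/negP => /andP[s1 sc].
have [UM VM] := bnd k; have [U1M _] := bnd k.+1.
set s := spectral_norm (V k) in s1 sc *.
have s0 : 0 <= s by exact: spectral_norm_ge0.
have u0 : 0 < frob_norm (U k.+1).
  rewrite lt_neqAle frob_ge0 andbT eq_sym; apply: contra U1 => /eqP/frob_eq0 ->.
  exact: eqxx.
have hU := palm_U_opt l0 (palm k).1 0.
rewrite nuclear_norm0 mulr0 sub0r mxdotNr opprK in hU.
set G := _ + _ *: _ in hU.
have GM : frob_norm G <= C * s.
  apply: le_trans (frobD_le _ _) _; rewrite frobZ ger0_norm ?sqr_ge0 // -/s.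
  have h1 : frob_norm (resid D Omega (U k) (V k) *m V k) <= (M ^+ 2 + frob_norm D) * s.
    apply: le_trans (frob_mulmx_spectral_le _ _) _; rewrite ler_wpM2r //.
    apply: le_trans (resid_frob_le _ _ _ _) _; rewrite lerD2r expr2.
    by rewrite ler_pM ?frob_ge0.
  have h2 : s ^+ 2 * frob_norm (U k.+1 - U k) <= s * (2 * M).
    rewrite ler_pM ?sqr_ge0 ?frob_ge0 //; first by rewrite expr2 ler_piMr // ltW.
    by apply: le_trans (frobB_le _ _) _; rewrite mulr_natl mulr2n lerD.
  apply: le_trans (lerD h1 h2) _; rewrite /C.
  by move: (M ^+ 2 + frob_norm D) => q; nra.
have GU := normr_mxdot_le G (U k.+1); rewrite ler_norml in GU.
have {GU} /andP[GU _] := GU.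
have := frob_le_nuclear (U k.+1); rewrite -(ler_pM2l l3) => hN.
have : 2 * lambda / 3 * frob_norm (U k.+1) <= C * s * frob_norm (U k.+1).
  have := ler_wpM2r (ltW u0) GM.
  by move: hN GU hU; move: (mxdot _ _) (_ * nuclear_norm _) => *; lra.
rewrite ler_pM2r // leNgt => /negP; apply.
by rewrite mulrC -ltr_pdivlMr.
Qed.

Lemma palm_cvg : 0 < lambda -> palm_sequence D Omega lambda U V ->
  exists (Us : 'M[R]_(m, d)) (Vs : 'M[R]_(n, d)),
  (forall e, 0 < e -> \forall k \near \oo, frob_norm (U k - Us) < e) /\
  (forall e, 0 < e -> \forall k \near \oo, frob_norm (V k - Vs) < e).
Proof.
move=> l0 palm; have [M M0 bnd] := palm_bounded l0 palm.
have [[k Uk]|Unz] := pselect (exists k, U k.+1 = 0).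
  exists 0, 0; split=> e e0; exists k.+1 => // i /= ki;
    by have [U0 V0] := palm_zero l0 palm Uk (i - k.+1);
      rewrite subnKC // in U0 V0; rewrite ?U0 ?V0 subr0 frob0.
have [c c0 cV] := palm_spectral_lower l0 palm M0 bnd.
have cV' k : c <= spectral_norm (V k).
  by apply: cV; apply/eqP => Uk; apply: Unz; exists k.
have UM k := (bnd k).1; have VM k := (bnd k).2.
pose delta k := frob_norm (U k.+1 - U k) + frob_norm (V k.+1 - V k).
have d0 k : 0 <= delta k by rewrite addr_ge0 ?frob_ge0.
pose G k := resid D Omega (U k) (V k) *m V k + spectral_norm (V k) ^+ 2 *: (U k.+1 - U k).
(* By optimality of the [U] step this is a subgradient of the nuclear norm at [U k], for positive
   [k]; the predecessor makes [W k.+1] come from step [k]. *)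
pose W k := - (3 / (2 * lambda)) *: G k.-1.
have l3 : 0 < 2 * lambda / 3 by lra.
have WG k : (2 * lambda / 3) *: W k.+1 = - G k.
  rewrite /W scalerA mulrN; have -> : 2 * lambda / 3 * (3 / (2 * lambda)) = 1.
    by field; rewrite gt_eqF.
  by rewrite scaleN1r.
have WP k : contraction (W k.+1) /\ mxdot (W k.+1) (U k.+1) = nuclear_norm (U k.+1).
  apply: nuclear_subgradient => Y; rewrite -(ler_pM2l l3) mulrDr -mxdotZl WG mxdotNl.
  exact: (palm_U_opt l0 (palm k).1 Y).
set L := 2 * M ^+ 2 + frob_norm D + M ^+ 2.
have L0 : 0 <= L by rewrite /L !addr_ge0 ?mulr_ge0 ?sqr_ge0 ?frob_ge0.
have sM p q (A : 'M[R]_(p, q)) : frob_norm A <= M -> spectral_norm A ^+ 2 <= M ^+ 2.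
  move=> AM; rewrite ler_pXn2r ?nnegrE ?spectral_norm_ge0 //.
  exact: le_trans (spectral_norm_le_frob _) AM.
(* The subgradient [W k.+1] cancels the old gradient, leaving a difference of gradients and the
   proximal term, both of order [delta k]. *)
have sl1 k : frob_norm (gradPhiU D Omega lambda (pack (U k.+1) (V k.+1) (W k.+1))) <= L * delta k.
  rewrite /gradPhiU partU_pack partV_pack partW_pack WG /G opprD addrAC [- _ + _]addrC.
  apply: le_trans (frobB_le _ _) _; rewrite /L [leRHS]mulrDl lerD //.
    exact: grad_U_lip.
  rewrite frobZ ger0_norm ?sqr_ge0 // ler_pM ?sqr_ge0 ?frob_ge0 ?sM //.
  by rewrite lerDl frob_ge0.
have sl2 k : frob_norm (gradPhiV D Omega lambda (pack (U k.+1) (V k.+1) (W k.+1))) <= L * delta k.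
  rewrite /gradPhiV partU_pack partV_pack.
  have hV := palm_V_opt l0 (palm k).2.
  have -> : (2 * lambda / 3) *: V k.+1 + (resid D Omega (U k.+1) (V k.+1))^T *m U k.+1 =
     ((resid D Omega (U k.+1) (V k.+1))^T *m U k.+1 -
      (resid D Omega (U k.+1) (V k))^T *m U k.+1) -
     spectral_norm (U k.+1) ^+ 2 *: (V k.+1 - V k).
    rewrite -[LHS]subr0 -hV; move: (_ *: V k.+1) (_ *: (V k.+1 - _)) => a w.
    move: (_ *m U k.+1) (_ *m U k.+1) => g1 g2.
    by apply/matrixP => i j; rewrite !mxE; ring.
  apply: le_trans (frobB_le _ _) _; rewrite /L [leRHS]mulrDl lerD //.
    apply: le_trans (grad_V_lip D Omega M0 _ _ _ _) _ => //.
    rewrite subrr frob0 add0r ler_wpM2l //; last by rewrite lerDr frob_ge0.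
    by rewrite addr_ge0 ?mulr_ge0 ?sqr_ge0 ?frob_ge0.
  rewrite frobZ ger0_norm ?sqr_ge0 // ler_pM ?sqr_ge0 ?frob_ge0 ?sM //.
  by rewrite lerDr frob_ge0.
(* The last halving comes from [(x + y)^2 <= 2 (x^2 + y^2)], [delta] being a sum of two norms. *)
pose a := Num.min (c ^+ 2 / 2) (lambda / 3) / 2.
have a0 : 0 < a by rewrite divr_gt0 // lt_min !divr_gt0 // exprn_gt0.
have [B sB] : exists B, forall i, \sum_(0 <= k < i) delta k <= B.
  (* [2 * L] accounts for the two blocks of the slope; the radius adds [M^2] for [U], [M^2] for [V]
     and [d] for the contraction [W]. *)
  apply: (@palm_finite_length _ _ _ _ D Omega lambda U W V delta a (2 * L)
    (M ^+ 2 + M ^+ 2 + d%:R)) => //.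
  - by rewrite mulr_ge0.
  - move=> k; apply: le_trans (palm_descent l0 (palm k).1 (palm k).2).
    have h1 : 2 * a * frob_norm (U k.+1 - U k) ^+ 2 <=
        spectral_norm (V k) ^+ 2 / 2 * frob_norm (U k.+1 - U k) ^+ 2.
      rewrite ler_wpM2r ?sqr_ge0 // /a mulrC divfK //.
      rewrite ge_min; apply/orP; left; rewrite ler_pM2r //.
      by rewrite ler_pXn2r ?nnegrE ?spectral_norm_ge0 // ltW.
    have h2 : 2 * a * frob_norm (V k.+1 - V k) ^+ 2 <=
        lambda / 3 * frob_norm (V k.+1 - V k) ^+ 2.
      by rewrite ler_wpM2r ?sqr_ge0 // /a mulrC divfK // ge_min lexx orbT.
    apply: le_trans (lerD h1 h2).
    have := mulr_ge0 (ltW a0) (sqr_ge0 (frob_norm (U k.+1 - U k) - frob_norm (V k.+1 - V k))).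
    by rewrite /delta; move: (frob_norm _) (frob_norm _) => x y; lra.
  - move=> k; apply: le_trans (objective_ge _ _).
    by rewrite addr_ge0 // mulr_ge0 ?sqr_ge0 ?nuclear_norm_ge0 // ltW // divr_gt0.
  - move=> k; rewrite /slope2 -!sqr_frob.
    have h1 : frob_norm (gradPhiU D Omega lambda
        (pack (U k.+1) (V k.+1) (W k.+1))) ^+ 2 <= (L * delta k) ^+ 2.
      by rewrite ler_pXn2r ?nnegrE ?frob_ge0 ?mulr_ge0.
    have h2 : frob_norm (gradPhiV D Omega lambda
        (pack (U k.+1) (V k.+1) (W k.+1))) ^+ 2 <= (L * delta k) ^+ 2.
      by rewrite ler_pXn2r ?nnegrE ?frob_ge0 ?mulr_ge0.
    apply: le_trans (lerD h1 h2) _; rewrite -mulrA [leRHS]exprMn.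
    by have := sqr_ge0 (L * delta k); move: (_ ^+ 2) => q; rewrite expr2; lra.
  - move=> k; rewrite mxdot_parts partU_pack partV_pack partW_pack lerD ?contraction_frob //.
      rewrite -!sqr_frob lerD // ler_pXn2r ?nnegrE ?frob_ge0 //.
    by have [] := WP k.
have entryU i j : cvgn (fun k => U k i j).
  apply: (@finite_length_cvg _ _ delta B) => // k.
  have := entry_le_frob (U k.+1 - U k) i j; rewrite !mxE => h.
  by apply: le_trans h _; rewrite lerDl frob_ge0.
have entryV i j : cvgn (fun k => V k i j).
  apply: (@finite_length_cvg _ _ delta B) => // k.
  have := entry_le_frob (V k.+1 - V k) i j; rewrite !mxE => h.
  by apply: le_trans h _; rewrite lerDr frob_ge0.
exists (\matrix_(i, j) limn (fun k => U k i j)), (\matrix_(i, j) limn (fun k => V k i j)).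
by split; apply: frob_cvg_of_entries => i j; rewrite mxE; [exact: entryU|exact: entryV].
Qed.

End Iterates.

Theorem theorem3 (R : realType) (m n d : nat) (D : 'M[R]_(m, n))
    (Omega : {set 'I_m * 'I_n}) (lambda : R)
    (U : nat -> 'M[R]_(m, d)) (V : nat -> 'M[R]_(n, d)) :
  (0 < d)%N -> 0 < lambda ->
  palm_sequence D Omega lambda U V ->
  cauchy ((fun k => (U k, V k)) @ \oo) /\
  exists X : 'M[R]_(m, d) * 'M[R]_(n, d),
    (U k, V k) @[k --> \oo] --> X /\
    critical_point (fun Y => (objective D Omega lambda Y)%:E) X.
Proof.
move=> _ l0 palm; have [M M0 bnd] := palm_bounded l0 palm.
have [Us [Vs [cU cV]]] := palm_cvg l0 palm.
have cX : (U k, V k) @[k --> \oo] --> (Us, Vs).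
  exact: (cvg_pair (mx_cvg_of_frob cU) (mx_cvg_of_frob cV)).
split.
  apply/(@cauchy_exP R) => e e0; exists (Us, Vs).
  by move/cvg_ballP : cX => /(_ e e0).
exists (Us, Vs); split=> //.
(* The bound is enlarged to cover the limit as well as the iterates. *)
apply: (@palm_limit_critical _ _ _ _ _ _ _ U V _ _ (M + (frob_norm Us + frob_norm Vs))) => //.
- by move=> k; apply: le_trans (bnd k).1 _; rewrite lerDl addr_ge0 ?frob_ge0.
- by move=> k; apply: le_trans (bnd k).2 _; rewrite lerDl addr_ge0 ?frob_ge0.
- by rewrite addrCA lerDl addr_ge0 ?frob_ge0.
- by rewrite addrA lerDr addr_ge0 ?frob_ge0.
Qed.
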